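(* Let $T$ be a tree with $k\ge 1$ edges, with vertex set $\{1,\dots,k+1\}$ and edge set $\mathcal{E}(T)$. Let $E \subset \mathbb{R}^d$ be compact with Hausdorff dimension $\dim_{\mathcal{H}}(E) > (d+1)/2$. Then there is a (nonempty) open interval $I\subset\mathbb{R}$ such that for each $t \in I$ the set $$T_t(E) = \{(x_1, \ldots, x_{k+1}) \in E^{k+1} : x_i \cdot x_j = t \text{ for all } (i,j)\in \mathcal{E}(T)\}$$ is nonempty.
   Context: Here $x\cdot y$ is the Euclidean dot product on $\mathbb{R}^d$. *)

(* Defs.v *)
From mathcomp Require Import all_boot all_order all_algebra.
From mathcomp Require Import all_classical all_reals all_analysis.

Set Implicit Arguments.
Unset Strict Implicit.
Unset Printing Implicit Defensive.

Import Order.TTheory GRing.Theory Num.Theory.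
Import numFieldNormedType.Exports.

Local Open Scope classical_set_scope.
Local Open Scope ring_scope.

Definition dotp (R : realType) (d : nat) (x y : 'rV[R]_d) : R :=
  \sum_(i < d) x 0 i * y 0 i.

(* The library norm on 'rV[R]_d is the sup norm; metric quantities below use
   the Euclidean norm instead. *)
Definition enorm (R : realType) (d : nat) (x : 'rV[R]_d) : R :=
  Num.sqrt (dotp x x).

(* diam set0 = -oo; see diam_pow for how the empty set is handled. *)
Definition diam (R : realType) (d : nat) (U : set 'rV[R]_d) : \bar R :=
  ereal_sup [set (enorm (p.1 - p.2))%:E | p in U `*` U].

(* diam(U)^s, with the conventions diam(set0)^s = 0 for every s (including
   s = 0) and diam([set x])^0 = 1, so that s = 0 yields the counting measure. *)
Definition diam_pow (R : realType) (d : nat) (s : R) (U : set 'rV[R]_d) :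
    \bar R :=
  if U == set0 then 0%E else poweR (diam U) s.

Definition delta_cover (R : realType) (d : nat) (delta : R)
    (E : set 'rV[R]_d) (U : nat -> set 'rV[R]_d) : Prop :=
  E `<=` \bigcup_i U i /\ forall i, (diam (U i) <= delta%:E)%E.

Definition hausdorff_delta_measure (R : realType) (d : nat) (s delta : R)
    (E : set 'rV[R]_d) : \bar R :=
  ereal_inf [set (\sum_(0 <= i <oo) diam_pow s (U i))%E
            | U in delta_cover delta E].

Definition hausdorff_measure (R : realType) (d : nat) (s : R)
    (E : set 'rV[R]_d) : \bar R :=
  ereal_sup [set hausdorff_delta_measure s delta E | delta in [set r : R | 0 < r]].

Definition hausdorff_dim (R : realType) (d : nat) (E : set 'rV[R]_d) : \bar R :=
  ereal_inf [set s%:E | s in [set s : R | 0 <= s /\ hausdorff_measure s E = 0%E]].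

Definition edges (n : nat) (e : rel 'I_n) : {set 'I_n * 'I_n} :=
  [set p : 'I_n * 'I_n | (p.1 < p.2)%N && e p.1 p.2]%SET.

(* ucycle is a closed walk without repeated vertex, written without its last
   return step;
   the bound on the length excludes the closed walks [:: x; y] along one edge. *)
Definition is_tree (n : nat) (e : rel 'I_n) : Prop :=
  [/\ symmetric e, irreflexive e, forall x y, connect e x y
    & forall c : seq 'I_n, (2 < size c)%N -> ~ ucycle e c].

Definition tree_configs (R : realType) (d k : nat) (e : rel 'I_k.+1)
    (E : set 'rV[R]_d) (t : R) : set ('I_k.+1 -> 'rV[R]_d) :=
  [set x | (forall i, E (x i)) /\
           forall i j, e i j -> dotp (x i) (x j) = t].

(* Main.v *)
Require Import Defs.
From mathcomp Require Import all_boot all_order all_algebra.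
From mathcomp Require Import all_classical all_reals all_analysis.
From mathcomp Require Import ring lra zify.
Import Order.TTheory GRing.Theory Num.Theory.
Import numFieldNormedType.Exports.
Local Open Scope classical_set_scope.
Local Open Scope ring_scope.

(* Vertices of a configuration may coincide, and a tree is bipartite, so it
   suffices to find x, y in E with x . y = t for all t in an interval.

   Frostman's lemma is used in finite form: for every n there are weights on
   the dyadic cubes of side 2^-n meeting E with total mass bounded below and
   mass at most sigma^l on the cubes of level l, where sigma = 2^-s and
   s > (d+1)/2, that is, sigma^2 2^(d+1) < 1.  Near a point with a large i0-th
   coordinate, put D(x, y) = (t - x . y) / (S x_i0) = r + u . z + h, where
   (r, u) depends on x only and (z, h) on y only.  For frequencies lambda in
   [L, 2L) the sums of a_x a_y cos (2 pi lambda D(x, y)) are estimated by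
   rounding (r, u) to a grid of mesh about 1/L (Taylor's formula separates the
   rounding error into products), the Cauchy-Schwarz inequality, orthogonality
   in r, and a large sieve inequality in (lambda, lambda u); summed over the
   block they are O((sigma^2 2^(d+1))^(l/2)) for L = 2^l.  Hence the averages of
   the Fejer kernel at D(x, y) at scales 2^-l form a Cauchy sequence uniformly
   in t and n: being bounded below at one coarse scale for t in an interval,
   they stay bounded below, which would fail at fine scales if x . y avoided
   t. *)

(** The lower bound at the coarse scale [2^-l1] has to beat the variation of the averages beyond
    that scale. Cutting the range of [x . y] into about [2^l1] bins leaves a popular bin whose pair
    mass is of order [2^-l1], while the peak of the Fejer kernel has height of order [2^l1]: the
    product is bounded below independently of [l1], whereas the variation is O([kap ^ l1]) with
    [kap < 1]. So [l1] is fixed first, and with it the popular bin and the interval around it. Only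
    the fine scale [l2] and the level [n] depend on [t], through the distance of [t] from the
    compact set of values [x . y].

    The popular bin and the cube carrying the points may change with [n], but they range over a
    finite set, so one choice serves infinitely many [n]; this replaces the passage to a limit
    measure.

    Integrals become finite sums over cyclic groups. The second points lie on a lattice of mesh
    [1 / M], and every frequency of the block divides [M], so that each orthogonality relation is
    exact. *)

(** * Trigonometric sums and orthogonality *)

(* [|\sum_i c i * exp (i * phi i)|^2] *)
Definition tsq (R : realType) (I : finType) (c phi : I -> R) : R :=
  (\sum_i c i * cos (phi i)) ^+ 2 + (\sum_i c i * sin (phi i)) ^+ 2.

Lemma tsq_ge0 (R : realType) (I : finType) (c phi : I -> R) : 0 <= tsq R I c phi.
Proof. by rewrite addr_ge0 ?sqr_ge0. Qed.

Lemma tsqE (R : realType) (I : finType) (c phi : I -> R) :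
  tsq R I c phi = \sum_i \sum_j c i * c j * cos (phi i - phi j).
Proof.
rewrite /tsq !expr2 !mulr_suml -big_split; apply: eq_bigr => i _ /=.
rewrite !mulr_sumr -big_split; apply: eq_bigr => j _ /=.
by rewrite cosB; ring.
Qed.

Lemma eq_tsq (R : realType) (I : finType) (c c' phi phi' : I -> R) :
  c =1 c' -> phi =1 phi' -> tsq R I c phi = tsq R I c' phi'.
Proof.
by move=> hc hp; rewrite !tsqE; apply: eq_bigr => i _; apply: eq_bigr => j _; rewrite !hc !hp.
Qed.

(** Multiplicativity of the squared modulus, in real form. It serves to insert the average over a
    box into an exponential sum. *)
Lemma tsqM (R : realType) (I J : finType) (a phi : I -> R) (b psi : J -> R) :
  tsq R I a phi * tsq R J b psi =
  tsq R (I * J)%type (fun p => a p.1 * b p.2) (fun p => phi p.1 + psi p.2).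
Proof.
set X := \sum_i a i * cos (phi i); set Y := \sum_i a i * sin (phi i).
set Z := \sum_i b i * cos (psi i); set W := \sum_i b i * sin (psi i).
have hc : \sum_(p : I * J) a p.1 * b p.2 * cos (phi p.1 + psi p.2) = X * Z - Y * W.
  rewrite -(pair_bigA _ (fun i j => a i * b j * cos (phi i + psi j))) /=.
  rewrite !mulr_suml -sumrB; apply: eq_bigr => i _.
  rewrite !mulr_sumr -sumrB; apply: eq_bigr => j _.
  by rewrite cosD; ring.
have hs : \sum_(p : I * J) a p.1 * b p.2 * sin (phi p.1 + psi p.2) = Y * Z + X * W.
  rewrite -(pair_bigA _ (fun i j => a i * b j * sin (phi i + psi j))) /=.
  rewrite !mulr_suml -big_split; apply: eq_bigr => i _.
  rewrite !mulr_sumr -big_split; apply: eq_bigr => j _ /=.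
  by rewrite sinD; ring.
by rewrite /tsq hc hs -/X -/Y -/Z -/W; ring.
Qed.

(** Cauchy-Schwarz in the plane. The pair [(A, B)] will be [ccf R k], [scf R k]. *)
Lemma tsq_lin_le (R : realType) (I : finType) (c phi : I -> R) (A B : R) :
  A ^+ 2 + B ^+ 2 <= 1 ->
  (\sum_i c i * (A * cos (phi i) - B * sin (phi i))) ^+ 2 <= tsq R I c phi.
Proof.
move=> hAB; rewrite /tsq.
set X := \sum_i c i * cos (phi i); set Y := \sum_i c i * sin (phi i).
have -> : \sum_i c i * (A * cos (phi i) - B * sin (phi i)) = A * X - B * Y.
  rewrite !mulr_sumr -sumrB; apply: eq_bigr => i _; ring.
have : 0 <= (A * Y + B * X) ^+ 2 by rewrite sqr_ge0.
have : (A ^+ 2 + B ^+ 2) * (X ^+ 2 + Y ^+ 2) <= 1 * (X ^+ 2 + Y ^+ 2).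
  by rewrite ler_wpM2r ?addr_ge0 ?sqr_ge0.
nra.
Qed.

(** Since [pi >= 2], it suffices to go up to [pi / 4], where the double angle formula gives the
    squared cosine 1/2. *)
Lemma cos_ge_half (R : realType) (x : R) : `|x| <= 2^-1 -> 2^-1 <= cos x.
Proof.
move=> hx; have p2 := pi_ge2 R.
have c4 : 2^-1 <= cos (pi / 4 : R).
  have := cos_mulr2n (pi / 4 : R).
  have -> : (pi / 4 : R) *+ 2 = pi / 2 by field.
  rewrite cos_pihalf => h.
  have : 0 <= cos (pi / 4 : R) by apply: cos_ge0_pihalf; apply/andP; split; lra.
  nra.
apply: le_trans c4 _; rewrite -(cos_norm x).
move: (normr_ge0 x) => n0.
by rewrite leNgt (@ltr_cos R) -?leNgt; [lra | rewrite in_itv /=; lra | rewrite in_itv /=; lra].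
Qed.

Lemma sum_cos_orth (R : realType) (N : nat) (m : int) (th : R) :
  (`|m| < N%:Z) ->
  \sum_(k < N) cos (2 * pi * (k%:R * m%:~R / N%:R) + th) =
  if m == 0 then N%:R * cos th else 0.
Proof.
move=> hm; have N0 : (N%:R : R) != 0.
  by rewrite pnatr_eq0; apply/eqP => N0; move: hm; rewrite N0 ltNge normr_ge0.
case: eqP => [->|/eqP m0].
  under eq_bigr do rewrite mulr0 mul0r mulr0 add0r.
  by rewrite sumr_const card_ord mulr_natl.
set x : R := 2 * pi * (m%:~R / N%:R).
(* Multiplying by [sin (x / 2)], nonzero because [0 < |m| < N], makes the sum telescope; its two
   ends differ by [m] full periods. *)
have sne : sin (x / 2) != 0.
  have -> : x / 2 = Num.sg (m%:~R : R) * (pi * (`|m|%:~R / N%:R)).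
    by rewrite /x intr_norm {1}(numEsg (m%:~R : R)); field.
  rewrite sin_sg mulf_neq0 ?sgr_eq0 ?intr_eq0 // gt_eqF // sin_gt0_pi //.
  have Np : 0 < (N%:R : R) by rewrite lt_neqAle eq_sym N0 ler0n.
  have mp : 0 < (`|m|%:~R : R) by rewrite ltr0z normr_gt0.
  have ml : (`|m|%:~R : R) < N%:R by rewrite -[N%:R]/(N%:Z%:~R) ltr_int.
  have pp := pi_gt0 R.
  apply/andP; split; first by rewrite mulr_gt0 ?divr_gt0.
  by rewrite gtr_pMr // ltr_pdivrMr // mul1r.
apply: (mulfI sne); rewrite mulr0 mulr_sumr.
pose g (k : nat) : R := sin ((k%:R - 2^-1) * x + th) / 2.
rewrite (eq_bigr (fun k : 'I_N => g k.+1 - g k)); last first.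
  move=> k _; rewrite /g.
  have -> : (k.+1%:R - 2^-1) * x + th = (k%:R * x + th) + x / 2 by rewrite -natr1; field.
  have -> : (k%:R - 2^-1) * x + th = (k%:R * x + th) - x / 2 by field.
  have -> : 2 * pi * (k%:R * m%:~R / N%:R) + th = k%:R * x + th by rewrite /x; field.
  by rewrite sinD sinB; field.
rewrite -(big_mkord xpredT (fun k => g k.+1 - g k)) telescope_sumr // /g.
have -> : (N%:R - 2^-1) * x + th = ((0%:R - 2^-1) * x + th) + 2 * pi * m%:~R.
  by rewrite /x; field.
suff -> : forall y : R, sin (y + 2 * pi * m%:~R) = sin y by rewrite subrr.
have per (y : R) (n : nat) : sin (y + 2 * pi * n%:R) = sin y.
  have -> : 2 * pi * n%:R = (pi *+ 2 *+ n : R) by rewrite -[RHS]mulr_natr -[pi *+ 2]mulr_natl.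
  by rewrite (periodicn (@sinD2pi R)).
move=> y; case: (intP m) => [|n|n]; rewrite ?mulr0 ?addr0 //.
- by rewrite -[(_%:Z)%:~R]/(n.+1%:R) per.
rewrite -[in RHS](subrK (2 * pi * n.+1%:R) y) per mulrNz mulrN; congr (sin (_ - _)).
Qed.

Lemma sum_ffun_cos_orth (R : realType) (n P : nat) (x : 'I_n -> int) (th : R) :
  (forall k, `|x k| < P%:Z) ->
  \sum_(U : {ffun 'I_n -> 'I_P})
    cos (2 * pi * (\sum_k (U k)%:R * (x k)%:~R / P%:R) + th) =
  if [forall k, x k == 0] then P%:R ^+ n * cos th else 0.
Proof.
move=> hx; case: ifPn => [/forallP x0|].
  rewrite (eq_bigr (fun=> cos th)) => [|U _]; last first.
    rewrite big1 ?mulr0 ?add0r // => k _.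
    by rewrite (eqP (x0 k)) mulr0 mul0r.
  by rewrite sumr_const card_ffun !card_ord -[LHS]mulr_natl natrX.
rewrite negb_forall => /existsP [k0 xk0].
case: P hx => [|P] hx; first by move: (hx k0); rewrite ltNge normr_ge0.
(* Translation of the coordinate [k0] in the cyclic group of order [P.+1]; averaging over all
   translations reduces the claim to one dimension. *)
pose sh (j : 'I_P.+1) (U : {ffun 'I_n -> 'I_P.+1}) : {ffun 'I_n -> 'I_P.+1} :=
  [ffun k => if k == k0 then U k + j else U k].
pose f (U : {ffun 'I_n -> 'I_P.+1}) : R :=
  cos (2 * pi * (\sum_k (U k)%:R * (x k)%:~R / P.+1%:R) + th).
have shb j : bijective (sh j).
  exists (sh (- j)) => U; apply/ffunP => k; rewrite !ffunE; case: eqP => // _.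
    by rewrite addrK.
  by rewrite subrK.
have hS : P.+1%:R * \sum_U f U = 0.
  rewrite -[X in X%:R]card_ord mulr_natl -sumr_const.
  rewrite (eq_bigr (fun j : 'I_P.+1 => \sum_U f (sh j U))); last first.
    by move=> j _; rewrite (reindex (sh j)) //; apply: onW_bij (shb j).
  rewrite exchange_big big1 // => U _.
  pose g (j : 'I_P.+1) : R := cos (2 * pi * (j%:R * (x k0)%:~R / P.+1%:R) +
     (2 * pi * (\sum_(k | k != k0) (U k)%:R * (x k)%:~R / P.+1%:R) + th)).
  rewrite (eq_bigr (fun j => g (U k0 + j))); last first.
    move=> j _; rewrite /f /g (bigD1 k0) //= /sh ffunE eqxx mulrDr -addrA.
    congr (cos (_ + (_ * _ + _))).
    by apply: eq_bigr => k kk0; rewrite ffunE (negbTE kk0).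
  transitivity (\sum_j g j).
    by rewrite [RHS](reindex_inj (addrI (U k0))).
  by rewrite /g sum_cos_orth // (negbTE xk0).
by apply/eqP; move/eqP: hS; rewrite mulf_eq0 pnatr_eq0.
Qed.

(* The sum of [tsq] over the fibres of [X]. *)
Definition fiber_tsq (R : realType) (I : finType) (V : eqType) (c phi : I -> R) (X : I -> V) : R :=
  \sum_i \sum_(j | X i == X j) c i * c j * cos (phi i - phi j).

(** Parseval on a power of the cyclic group of order [P]: differences of [X] are below [P], so
    congruence means equality. The shift [s], later the centre of the grid, cancels between points
    of one fibre. *)
Lemma lattice_parseval (R : realType) (I : finType) (n P : nat) (c phi : I -> R)
    (X : I -> {ffun 'I_n -> int}) (s : R) :
  (forall i j k, `|X i k - X j k| < P%:Z) ->
  \sum_(U : {ffun 'I_n -> 'I_P})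
    tsq R I c (fun i => phi i + 2 * pi * (\sum_k ((U k)%:R - s) * (X i k)%:~R / P%:R)) =
  P%:R ^+ n * fiber_tsq R I _ c phi X.
Proof.
move=> hX; under eq_bigr do rewrite tsqE.
rewrite exchange_big /fiber_tsq mulr_sumr; apply: eq_bigr => i _.
rewrite exchange_big mulr_sumr [RHS]big_mkcond; apply: eq_bigr => j _ /=.
rewrite -mulr_sumr.
pose th := phi i - phi j - 2 * pi * (\sum_k s * (X i k - X j k)%:~R / P%:R).
rewrite (eq_bigr (fun U : {ffun 'I_n -> 'I_P} =>
   cos (2 * pi * (\sum_k (U k)%:R * (X i k - X j k)%:~R / P%:R) + th))); last first.
  move=> U _; congr cos; rewrite /th.
  have -> : \sum_k (U k)%:R * (X i k - X j k)%:~R / P%:R =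
    \sum_k ((U k)%:R - s) * (X i k)%:~R / P%:R - \sum_k ((U k)%:R - s) * (X j k)%:~R / P%:R
    + \sum_k s * (X i k - X j k)%:~R / P%:R :> R.
    rewrite -sumrB -big_split; apply: eq_bigr => k _ /=.
    by rewrite rmorphB /=; ring.
  ring.
rewrite sum_ffun_cos_orth //.
have -> : [forall k, X i k - X j k == 0] = (X i == X j).
  apply/forallP/eqP => [h|-> k]; last by rewrite subrr.
  by apply/ffunP => k; apply/eqP; rewrite -subr_eq0.
case: eqP => [e|_]; last by rewrite mulr0.
rewrite mulrCA; congr (_ * (_ * cos _)); rewrite /th big1 ?mulr0 ?subr0 // => k _.
by rewrite e subrr mulr0 mul0r.
Qed.

Lemma ler_sum_ffun_widen (R : realType) (n N1 N2 : nat) (F : {ffun 'I_n -> nat} -> R) :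
  (N1 <= N2)%N -> (forall u, 0 <= F u) ->
  \sum_(U : {ffun 'I_n -> 'I_N1}) F [ffun k => nat_of_ord (U k)] <=
  \sum_(U : {ffun 'I_n -> 'I_N2}) F [ffun k => nat_of_ord (U k)].
Proof.
move=> le12 F0.
pose w (U : {ffun 'I_n -> 'I_N1}) : {ffun 'I_n -> 'I_N2} := [ffun k => widen_ord le12 (U k)].
have wi : injective w.
  move=> U V /ffunP e; apply/ffunP => k; have := e k; rewrite !ffunE => /(congr1 val) /= e'.
  exact: val_inj.
rewrite (eq_bigr (fun U => F [ffun k => nat_of_ord (w U k)])); last first.
  by move=> U _; congr F; apply/ffunP => k; rewrite !ffunE.
have := @big_imset _ _ +%R _ _ w predT (fun V : {ffun 'I_n -> 'I_N2} => F [ffun k => nat_of_ord (V k)]).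
move=> /(_ (in2W wi)) <- /=.
rewrite [leRHS](bigID [in w @: predT]) /= lerDl sumr_ge0 // => U _; exact: F0.
Qed.

(** * Large sieve and the estimate of a dyadic block of frequencies *)

(** Parseval exhibits it as an average of squares. *)
Lemma fiber_tsq_ge0 (R : realType) (I : finType) (n P : nat) (c phi : I -> R)
    (X : I -> {ffun 'I_n -> int}) :
  (0 < P)%N -> (forall i j k, `|X i k - X j k| < P%:Z) -> 0 <= fiber_tsq R I _ c phi X.
Proof.
move=> P0 hX; have Pn : 0 < (P%:R ^+ n : R) by rewrite exprn_gt0 // ltr0n.
rewrite -(pmulr_rge0 _ Pn) -(lattice_parseval R I n P c phi X 0 hX).
by apply: sumr_ge0 => U _; apply: tsq_ge0.
Qed.

(** Orthogonality in the frequency: over a full period [M], only pairs with equal [x] survive among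
    those with equal [X]. *)
Lemma sum_fiber_tsq (R : realType) (I : finType) (V : eqType) (M : nat) (c : I -> R)
    (x : I -> int) (X : I -> V) :
  (forall i j, `|x i - x j| < M%:Z) ->
  \sum_(l < M) fiber_tsq R I V c (fun i => 2 * pi * l%:R * ((x i)%:~R / M%:R)) X =
  M%:R * \sum_i \sum_(j | (X i == X j) && (x i == x j)) c i * c j.
Proof.
move=> hx; rewrite exchange_big mulr_sumr; apply: eq_bigr => i _ /=.
rewrite exchange_big mulr_sumr [RHS]big_mkcondr /=; apply: eq_bigr => j _ /=.
rewrite -mulr_sumr.
rewrite (eq_bigr (fun l : 'I_M => cos (2 * pi * (l%:R * (x i - x j)%:~R / M%:R) + 0))); last first.
  by move=> l _; congr cos; rewrite rmorphB /=; ring.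
rewrite sum_cos_orth // subr_eq0 cos0 mulr1; case: eqP => _; ring.
Qed.

(* Multiplying by the average of the characters over a box of side [K], which
   is at least [1/2] on the frequencies in play, replaces the sum over
   [U < 2 * J] by a sum over a full period [P], where Parseval is exact. *)
Lemma large_sieve_freq (R : realType) (I : finType) (n J M K P lam : nat) (w : I -> R)
    (H : I -> int) (Z : I -> {ffun 'I_n -> int}) :
  (0 < K)%N -> (0 < J)%N -> (0 < M)%N -> (0 < lam)%N ->
  (lam * P = J * M)%N -> (2 * J <= P)%N -> (16 * lam * n.+1 * K <= M)%N ->
  (forall i j k, `|Z i k - Z j k| + K%:Z < P%:Z) ->
  \sum_(U : {ffun 'I_n -> 'I_(2 * J)})
     tsq R I w (fun j => 2 * pi * lam%:R * (\sum_k ((U k)%:R - J%:R) * (Z j k)%:~R / (J%:R * M%:R)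
        + (H j)%:~R / M%:R)) <=
  4 / (K%:R ^+ n.+1) ^+ 2 * (P%:R ^+ n *
  fiber_tsq R (I * ({ffun 'I_n -> 'I_K} * 'I_K))%type _ (fun p => w p.1)
    (fun p => 2 * pi * lam%:R * ((H p.1 + (p.2.2 : nat)%:Z)%:~R / M%:R))
    (fun p => [ffun k => Z p.1 k + (p.2.1 k : nat)%:Z] : {ffun 'I_n -> int})).
Proof.
move=> K0 J0 M0 l0 lP JP KM hZ.
have K0r : 0 < (K%:R : R) by rewrite ltr0n.
have J0r : 0 < (J%:R : R) by rewrite ltr0n.
have M0r : 0 < (M%:R : R) by rewrite ltr0n.
have l0r : 0 < (lam%:R : R) by rewrite ltr0n.
have P0 : (0 < P)%N by case: P lP {JP hZ} => // ; rewrite muln0 => /esym/eqP; rewrite muln_eq0; lia.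
have P0r : 0 < (P%:R : R) by rewrite ltr0n.
have lPr : lam%:R * P%:R = J%:R * M%:R :> R by rewrite -!natrM lP.
set Q : finType := ({ffun 'I_n -> 'I_K} * 'I_K)%type.
pose psi (U : {ffun 'I_n -> nat}) (q : Q) : R :=
  2 * pi * lam%:R * (\sum_k ((U k)%:R - J%:R) * (q.1 k)%:R / (J%:R * M%:R) + q.2%:R / M%:R).
pose v : R := (K%:R ^+ n.+1)^-1.
have v0 : 0 < v by rewrite invr_gt0 exprn_gt0.
have cQ : (#|Q|%:R : R) = K%:R ^+ n.+1.
  by rewrite /Q card_prod card_ffun !card_ord -expnSr natrX.
(* There are [n.+1] terms, each at most [K / M] because [U k] is within [J] of [J]; with
   [16 * lam * n.+1 * K <= M] the phase is at most [pi / 8]. *)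
have psi_le (U : {ffun 'I_n -> nat}) q : (forall k, U k < 2 * J)%N -> `|psi U q| <= 2^-1.
  move=> hU.
  have : `|\sum_k ((U k)%:R - J%:R) * (q.1 k)%:R / (J%:R * M%:R) + q.2%:R / M%:R : R|
       <= n.+1%:R * (K%:R / M%:R).
    apply: (le_trans (ler_normD _ _)); rewrite -natr1 mulrDl mul1r lerD //.
      apply: (le_trans (ler_norm_sum _ _ _)).
      apply: (@le_trans _ _ (\sum_(k < n) K%:R / M%:R)); last by rewrite sumr_const card_ord -[leLHS]mulr_natl.
      apply: ler_sum => k _.
      rewrite !normrM normfV (ger0_norm (x := (q.1 k)%:R)) // (gtr0_norm (x := _ * _)) ?mulr_gt0 //.
      have h1 : `|(U k)%:R - J%:R| <= J%:R :> R.
        rewrite ler_norml; have := hU k; rewrite -(ltr_nat R) natrM => h.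
        have := ler0n R (U k); lra.
      have h2 : (q.1 k)%:R <= K%:R :> R by rewrite ler_nat ltnW.
      rewrite ler_pdivrMr ?mulr_gt0 //.
      have -> : K%:R / M%:R * (J%:R * M%:R) = J%:R * K%:R :> R by field; rewrite gt_eqF.
      by rewrite ler_pM.
    by rewrite ger0_norm ?divr_ge0 // ler_pM2r ?invr_gt0 // ler_nat ltnW.
  rewrite /psi normrM => h.
  have pp := pi_gt0 R; have p4 := pihalf_lt2 R.
  rewrite (gtr0_norm (x := 2 * pi * lam%:R)) ?mulr_gt0 //.
  have : 2 * pi * lam%:R * (n.+1%:R * (K%:R / M%:R)) <= 2^-1 :> R.
    rewrite mulrA mulrA ler_pdivrMr //.
    move: KM; rewrite -(ler_nat R) !natrM => KM.
    have : 0 <= (lam%:R * n.+1%:R * K%:R : R) by rewrite !mulr_ge0.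
    have : (pi : R) < 4 by lra.
    nra.
  apply: le_trans; rewrite ler_pM2l // !mulr_gt0 //.
have psi_avg (U : {ffun 'I_n -> nat}) : (forall k, U k < 2 * J)%N -> 4^-1 <= tsq R Q (fun=> v) (psi U).
  move=> hU; rewrite /tsq.
  have : 2^-1 <= \sum_(i : Q) v * cos (psi U i).
    rewrite -mulr_sumr -(ler_pM2l (x := K%:R ^+ n.+1)) ?exprn_gt0 // mulrA divff ?mul1r ?gt_eqF ?exprn_gt0 //.
    apply: (@le_trans _ _ (\sum_(q : Q) 2^-1)); first by rewrite sumr_const -cQ -[leRHS]mulr_natl.
    by apply: ler_sum => q _; apply: cos_ge_half; apply: psi_le.
  have : 0 <= (\sum_(i : Q) v * sin (psi U i)) ^+ 2 by rewrite sqr_ge0.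
  nra.
pose I' : finType := (I * Q)%type.
pose X (p : I') : {ffun 'I_n -> int} := [ffun k => Z p.1 k + (p.2.1 k : nat)%:Z].
pose phi0 (p : I') : R := 2 * pi * lam%:R * ((H p.1 + (p.2.2 : nat)%:Z)%:~R / M%:R).
pose F (U : {ffun 'I_n -> nat}) : R := tsq R I' (fun p => w p.1)
  (fun p => phi0 p + 2 * pi * (\sum_k ((U k)%:R - J%:R) * (X p k)%:~R / P%:R)).
have F0 U : 0 <= F U by apply: tsq_ge0.
have step (U : {ffun 'I_n -> 'I_(2 * J)}) :
  tsq R I w (fun j => 2 * pi * lam%:R * (\sum_k ((U k)%:R - J%:R) * (Z j k)%:~R / (J%:R * M%:R)
        + (H j)%:~R / M%:R)) <= 4 * v ^+ 2 * F [ffun k => nat_of_ord (U k)].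
  set T := tsq _ _ _ _; pose U' : {ffun 'I_n -> nat} := [ffun k => nat_of_ord (U k)].
  have hU' k : (U' k < 2 * J)%N by rewrite ffunE.
  apply: (@le_trans _ _ (4 * (T * tsq R Q (fun=> v) (psi U')))).
    have := psi_avg _ hU'; have : 0 <= T by apply: tsq_ge0.
    nra.
  rewrite /T tsqM -[leRHS]mulrA ler_pM2l // le_eqVlt; apply/orP; left; apply/eqP.
  rewrite /F !tsqE mulr_sumr; apply: eq_bigr => p _; rewrite mulr_sumr; apply: eq_bigr => p' _.
  rewrite (_ : w p.1 * v * (w p'.1 * v) = v ^+ 2 * (w p.1 * w p'.1)); last by ring.
  rewrite -[LHS]mulrA; congr (_ * (_ * cos _)).
  (* Because [lam * P = J * M], the factor [lam / (J * M)] equals [1 / P]: the grid points act as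
     characters of period [P]. *)
  have ph (r : I') : 2 * pi * lam%:R *
   (\sum_k ((U k)%:R - J%:R) * (Z r.1 k)%:~R / (J%:R * M%:R) + (H r.1)%:~R / M%:R) + psi U' r.2
   = phi0 r + 2 * pi * (\sum_k ((U' k)%:R - J%:R) * (X r k)%:~R / P%:R).
    rewrite /psi /phi0.
    have -> : \sum_k ((U' k)%:R - J%:R) * (X r k)%:~R / P%:R =
      lam%:R * (\sum_k ((U k)%:R - J%:R) * (Z r.1 k)%:~R / (J%:R * M%:R) +
               \sum_k ((U' k)%:R - J%:R) * (r.2.1 k)%:R / (J%:R * M%:R)) :> R.
      rewrite -big_split mulr_sumr; apply: eq_bigr => k _ /=.
      rewrite !ffunE -lPr rmorphD /= -[((r.2.1 k)%:Z)%:~R]/((r.2.1 k)%:R).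
      by field; rewrite !gt_eqF.
    rewrite rmorphD /= -[((r.2.2 : nat)%:Z)%:~R]/((r.2.2)%:R); field; exact: lt0r_neq0.
  by rewrite -!ph.
apply: le_trans (ler_sum _ (fun U _ => step U)) _.
rewrite -mulr_sumr /v exprVn. 
rewrite ler_pM2l ?mulr_gt0 ?invr_gt0 ?exprn_gt0 //.
apply: le_trans (ler_sum_ffun_widen R n (2 * J) P F JP F0) _.
rewrite le_eqVlt; apply/orP; left; apply/eqP.
rewrite -(lattice_parseval R I' n P (fun p => w p.1) phi0 X J%:R).
  apply: eq_bigr => U _; rewrite /F; apply: eq_tsq => // p.
  by congr (_ + _ * _); apply: eq_bigr => k _; rewrite ffunE.
move=> p p' k; rewrite !ffunE; have := hZ p.1 p'.1 k.
have := ltn_ord (p.2.1 k); have := ltn_ord (p'.2.1 k); lia.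
Qed.

(** Nonnegativity of [fiber_tsq] lets the block of frequencies be extended to a full period [M].
    Orthogonality then keeps only pairs lying in a common box of side [K], whose mass [A] controls.
    As [M] is proportional to [K], all powers of [K] cancel. *)
Lemma large_sieve (R : realType) (I : finType) (n L M K : nat) (w b : I -> R)
    (H : I -> int) (Z : I -> {ffun 'I_n -> int}) (A : R) (J := (32 * n.+1 * L)%N) :
  (0 < L)%N -> (0 < K)%N -> M = (64 * n.+1 * L * K)%N ->
  (forall lam, (L <= lam < 2 * L)%N -> (lam %| M)%N) ->
  (forall i, `|w i| <= b i) ->
  (forall i j k, `|Z i k - Z j k| * 2 <= M%:Z) ->
  (forall i j, `|H i - H j| * 2 <= M%:Z) ->
  (forall (x : int) (X : {ffun 'I_n -> int}),
     \sum_(i | (x <= H i < x + K%:Z) && [forall k, X k <= Z i k < X k + K%:Z]) b i <= A) ->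
  \sum_(l < L) \sum_(U : {ffun 'I_n -> 'I_(2 * J)})
     tsq R I w (fun j => 2 * pi * (L + l)%:R *
        (\sum_k ((U k)%:R - J%:R) * (Z j k)%:~R / (J%:R * M%:R) + (H j)%:~R / M%:R)) <=
  4 * (32 * n.+1%:R) ^+ n * (64 * n.+1%:R * L%:R) ^+ n.+1 * A * \sum_i b i.
Proof.
move=> L0 K0 eM dvM wb hZ hH hA.
have b0 i : 0 <= b i by apply: le_trans (wb i).
have M0 : (0 < M)%N by rewrite eM !muln_gt0 L0 K0.
have J0 : (0 < J)%N by rewrite /J !muln_gt0 L0.
have K0r : 0 < (K%:R : R) by rewrite ltr0n.
have J0r : 0 < (J%:R : R) by rewrite ltr0n.
have M0r : 0 < (M%:R : R) by rewrite ltr0n.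
have L0r : 0 < (L%:R : R) by rewrite ltr0n.
set Q : finType := ({ffun 'I_n -> 'I_K} * 'I_K)%type.
pose X (p : I * Q) : {ffun 'I_n -> int} := [ffun k => Z p.1 k + (p.2.1 k : nat)%:Z].
pose x (p : I * Q) : int := H p.1 + (p.2.2 : nat)%:Z.
pose T (lam : nat) := fiber_tsq R (I * Q)%type _ (fun p => w p.1)
   (fun p => 2 * pi * lam%:R * ((x p)%:~R / M%:R)) X.
have KM : (64 * K <= M)%N by rewrite eM leq_mul2r -mulnA -{1}(muln1 64%N) leq_mul2l muln_gt0 /= L0 orbT.
have T0 lam : 0 <= T lam.
  apply: (fiber_tsq_ge0 R _ n M) => // p p' k; rewrite !ffunE.
  have := hZ p.1 p'.1 k; have := ltn_ord (p.2.1 k); have := ltn_ord (p'.2.1 k); lia.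
apply: (@le_trans _ _ (\sum_(l < L) 4 / (K%:R ^+ n.+1) ^+ 2 *
    ((J%:R * M%:R / L%:R) ^+ n * T (L + l)%N))).
  apply: ler_sum => l _; set lam := (L + l)%N.
  have ll : (L <= lam < 2 * L)%N by have := ltn_ord l; rewrite /lam; lia.
  have /andP[l1 l2] := ll.
  have l0 : (0 < lam)%N by apply: leq_trans l1.
  have dv := dvM lam ll.
  (* The period [J * M / lam] is an integer because [lam] divides [M]. *)
  pose P := (J * (M %/ lam))%N.
  have lP : (lam * P = J * M)%N by rewrite /P mulnCA; congr (_ * _)%N; rewrite mulnC divnK.
  have m32 : (32 <= M %/ lam)%N.
    rewrite leq_divRL // eM.
    have : (2 * L * 32 <= 64 * n.+1 * L * K)%N by nia.
    by apply: leq_trans; rewrite mulnC leq_mul2r ltnW // orbT.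
  have P1 : (2 * J <= P)%N by rewrite /P mulnC leq_mul2l (leq_trans _ m32) ?orbT.
  have P2 : (16 * M <= P)%N.
    have : (lam * (16 * M) <= lam * P)%N by rewrite lP /J; nia.
    by rewrite leq_pmul2l.
  have P3 : (16 * lam * n.+1 * K <= M)%N by rewrite eM; nia.
  apply: le_trans (large_sieve_freq R I n J M K P lam w H Z K0 J0 M0 l0 lP P1 P3 _) _.
    by move=> i j k; have := hZ i j k; lia.
  rewrite ler_pM2l ?divr_gt0 ?exprn_gt0 // ler_wpM2r //; first exact: T0.
  rewrite lerXn2r ?nnegrE ?divr_ge0 ?mulr_ge0 //.
  rewrite ler_pdivlMr // -!natrM ler_nat -lP mulnC leq_mul2r l1 orbT //.
rewrite -mulr_sumr -mulr_sumr.
have sT : \sum_(l < L) T (L + l)%N <= \sum_(l < M) T l.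
  rewrite -(big_mkord xpredT T) -(big_mkord xpredT (fun l => T (L + l)%N)).
  have LM : (L + L <= M)%N by rewrite eM; nia.
  have -> : \sum_(0 <= i < L) T (L + i)%N = \sum_(L <= i < L + L) T i.
    rewrite -[X in _ = \sum_(X <= _ < _) _]add0n big_addn addnK; apply: eq_bigr => i _; by rewrite addnC.
  rewrite (@big_cat_nat _ _ _ L 0 M) ?(leq_trans (leq_addr L L)) //=.
  rewrite (@big_cat_nat _ _ _ (L + L) L M) ?leq_addr //= addrCA lerDl addr_ge0 // sumr_ge0 //.
have T1 : \sum_(l < M) T l <= M%:R * (K%:R ^+ n.+1 * (A * \sum_i b i)).
  rewrite /T sum_fiber_tsq; last first.
    move=> p p'; rewrite /x; have := hH p.1 p'.1.
    have := ltn_ord (p.2.2); have := ltn_ord (p'.2.2); lia.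
  rewrite ler_pM2l //.
  have -> : K%:R ^+ n.+1 * (A * \sum_i b i) = \sum_(p : I * Q) b p.1 * A.
    rewrite -(pair_bigA _ (fun i (q : Q) => b i * A)) /= mulr_sumr mulr_sumr; apply: eq_bigr => i _.
    by rewrite sumr_const card_prod card_ffun !card_ord -expnSr -[RHS]mulr_natl natrX; ring.
  apply: ler_sum => -[i q] _ /=.
  apply: (@le_trans _ _ (\sum_(p' | (X (i, q) == X p') && (x (i, q) == x p')) b i * b p'.1)).
    apply: ler_sum => p' _; apply: le_trans (ler_norm _) _; rewrite normrM ler_pM //.
  rewrite -mulr_sumr ler_wpM2l //.
  (* If [H j] plus an offset in [[0, K)] equals [x], then [H j] lies in [[x - K + 1, x + 1)]. The
     offset is determined by [j], so each [b j] is counted at most once. *)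
  apply: le_trans (hA (x (i, q) - K%:Z + 1) [ffun k => X (i, q) k - K%:Z + 1]).
  rewrite big_mkcond -(pair_bigA _ (fun j q' => if (X (i, q) == X (j, q')) && (x (i, q) == x (j, q')) then b j else 0)) /=.
  rewrite [leRHS]big_mkcond; apply: ler_sum => j _.
  rewrite -big_mkcond.
  case: (pickP (fun q' : Q => (X (i, q) == X (j, q')) && (x (i, q) == x (j, q')))) => [q' /andP[/eqP/ffunP e1 /eqP e2]|none]; last first.
    by rewrite big_pred0 //; case: ifP.
  rewrite (big_pred1 q') => [|q'']; last first.
    apply/andP/eqP => [[/eqP/ffunP f1 /eqP f2]|->].
      case: q'' q' f1 f2 e1 e2 => [a1 a2] [c1 c2] f1 f2 e1 e2; congr pair.
        by apply/ffunP => k; apply: val_inj; have := f1 k; rewrite e1 !ffunE /=; lia.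
      by apply: val_inj; move: f2; rewrite e2 /x /=; lia.
    by rewrite e2; split => //; apply/eqP/ffunP.
  rewrite ifT // e2 /x /=; apply/andP; split.
    by have := ltn_ord q'.2; move: (nat_of_ord q'.2) (H j) => u h hu; clear -hu; lia.
  apply/forallP => k; rewrite ffunE e1 !ffunE /=.
  by have := ltn_ord (q'.1 k); move: (nat_of_ord (q'.1 k)) (Z j k) => u h hu; clear -hu; lia.
have := le_trans sT T1 => {sT T1} sT.
have c0 : 0 <= 4 / (K%:R ^+ n.+1) ^+ 2 * (J%:R * M%:R / L%:R) ^+ n :> R.
  by rewrite mulr_ge0 ?exprn_ge0 ?divr_ge0 ?mulr_ge0 ?exprn_ge0.
rewrite mulrA; apply: le_trans (ler_wpM2l c0 sT) _.
rewrite le_eqVlt; apply/orP; left; apply/eqP.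
have -> : J%:R = 32 * n.+1%:R * L%:R :> R by rewrite /J !natrM.
have -> : M%:R = 64 * n.+1%:R * L%:R * K%:R :> R by rewrite eM !natrM.
rewrite (_ : 32 * n.+1%:R * L%:R * (64 * n.+1%:R * L%:R * K%:R) / L%:R =
  (32 * n.+1%:R) * (64 * n.+1%:R * L%:R) * K%:R); last by field; rewrite gt_eqF.
rewrite !exprMn !exprS; field; rewrite ?expf_neq0 ?gt_eqF //.
Qed.

Lemma sqr_wsum_le (R : realType) (I : finType) (a x : I -> R) :
  (forall i, 0 <= a i) -> (\sum_i a i * x i) ^+ 2 <= (\sum_i a i) * \sum_i a i * x i ^+ 2.
Proof.
move=> a0.
have h : 0 <= \sum_i \sum_j a i * a j * (x i - x j) ^+ 2.
  by apply: sumr_ge0 => i _; apply: sumr_ge0 => j _; rewrite mulr_ge0 ?sqr_ge0 ?mulr_ge0.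
suff e : \sum_i \sum_j a i * a j * (x i - x j) ^+ 2 =
   2 * ((\sum_i a i) * (\sum_i a i * x i ^+ 2)) - 2 * (\sum_i a i * x i) ^+ 2.
  by move: h; rewrite e; lra.
have e1 : (\sum_i a i) * (\sum_i a i * x i ^+ 2) = \sum_i \sum_j a i * a j * x j ^+ 2.
  by rewrite mulr_suml; apply: eq_bigr => i _; rewrite mulr_sumr; apply: eq_bigr => j _; ring.
have e2 : (\sum_i a i) * (\sum_i a i * x i ^+ 2) = \sum_i \sum_j a i * a j * x i ^+ 2.
  rewrite mulrC mulr_suml; apply: eq_bigr => i _; rewrite mulr_sumr; apply: eq_bigr => j _; ring.
have e3 : (\sum_i a i * x i) ^+ 2 = \sum_i \sum_j a i * a j * (x i * x j).
  by rewrite expr2 mulr_suml; apply: eq_bigr => i _; rewrite mulr_sumr; apply: eq_bigr => j _; ring.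
rewrite (_ : 2 * (_ * _) = (\sum_i a i) * (\sum_i a i * x i ^+ 2) + (\sum_i a i) * (\sum_i a i * x i ^+ 2)); last by ring.
rewrite {1}e1 e2 e3.
rewrite mulr_sumr -big_split -sumrB; apply: eq_bigr => i _ /=.
rewrite mulr_sumr -big_split -sumrB; apply: eq_bigr => j _ /=; ring.
Qed.

Lemma circle_parseval (R : realType) (I : finType) (N : nat) (c phi : I -> R)
    (x : I -> int) (s : R) :
  (forall i j, `|x i - x j| < N%:Z) ->
  \sum_(r < N) tsq R I c (fun i => phi i + 2 * pi * ((r%:R - s) * (x i)%:~R / N%:R)) =
  N%:R * fiber_tsq R I _ c phi x.
Proof.
move=> hx; under eq_bigr do rewrite tsqE.
rewrite exchange_big /fiber_tsq mulr_sumr; apply: eq_bigr => i _.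
rewrite exchange_big mulr_sumr [RHS]big_mkcond; apply: eq_bigr => j _ /=.
rewrite -mulr_sumr.
rewrite (eq_bigr (fun r : 'I_N => cos (2 * pi * (r%:R * (x i - x j)%:~R / N%:R) +
   (phi i - phi j - 2 * pi * (s * (x i - x j)%:~R / N%:R))))); last first.
  by move=> r _; congr cos; rewrite rmorphB /=; ring.
rewrite sum_cos_orth // subr_eq0; case: eqP => [e|_]; last by rewrite mulr0.
by rewrite e subrr !(mulr0, mul0r) subr0; ring.
Qed.

Lemma fiber_tsq_prod (R : realType) (I K : finType) (V : eqType) (c phi : I -> K -> R)
    (x : I -> V) : injective x ->
  fiber_tsq R (I * K)%type V (fun p => c p.1 p.2) (fun p => phi p.1 p.2) (fun p => x p.1) =
  \sum_i tsq R K (c i) (phi i).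
Proof.
move=> xi; rewrite /fiber_tsq -(pair_bigA _ (fun i k => \sum_(q : I * K | x i == x q.1)
  c i k * c q.1 q.2 * cos (phi i k - phi q.1 q.2))) /=.
apply: eq_bigr => i _; rewrite tsqE; apply: eq_bigr => k _.
rewrite big_mkcond -(pair_bigA _ (fun i' k' => if x i == x i' then
  c i k * c i' k' * cos (phi i k - phi i' k') else 0)) /=.
rewrite (bigD1 i) //= [X in _ + X]big1 ?addr0 => [|i' ne].
  by apply: eq_bigr => k' _; rewrite eqxx.
by rewrite big1 // => k' _; rewrite (inj_eq xi) eq_sym (negbTE ne).
Qed.

(** [T], [c] and [w] absorb one product of Taylor factors and enter only through their bounds. After
    Cauchy-Schwarz, the points [i] of a grid cell are replaced by the cell mass [A'], which
    completes the sum to all grid points [(u, t)]; the sum over [t] separates the frequencies and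
    the large sieve handles [u]. *)
Lemma grid_form_bound (R : realType) (I V : finType) (n L M K : nat) (a T : I -> R) (w b : V -> R)
    (U : I -> {ffun 'I_n -> 'I_(2 * (32 * n.+1 * L))}) (r : I -> 'I_(2 * (32 * n.+1 * L)))
    (H : V -> int) (Z : V -> {ffun 'I_n -> int}) (c : 'I_L -> R) (A A' B B' : R)
    (J := (32 * n.+1 * L)%N) :
  (0 < L)%N -> (0 < K)%N -> M = (64 * n.+1 * L * K)%N ->
  (forall lam, (L <= lam < 2 * L)%N -> (lam %| M)%N) ->
  (forall i, 0 <= a i) -> (forall i, `|T i| <= 1) -> (forall l, `|c l| <= 1) ->
  (forall i, `|w i| <= b i) ->
  B ^+ 2 + B' ^+ 2 <= 1 ->
  (forall i j k, `|Z i k - Z j k| * 2 <= M%:Z) ->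
  (forall i j, `|H i - H j| * 2 <= M%:Z) ->
  (forall (x : int) (X : {ffun 'I_n -> int}),
     \sum_(i | (x <= H i < x + K%:Z) && [forall k, X k <= Z i k < X k + K%:Z]) b i <= A) ->
  (forall u t, \sum_(i | (U i == u) && (r i == t)) a i <= A') ->
  (\sum_i a i * (T i * \sum_(p : 'I_L * V) c p.1 * w p.2 *
     (let ph := 2 * pi * (L + p.1)%:R * (((r i)%:R - J%:R) / J%:R +
        (\sum_k ((U i k)%:R - J%:R) * (Z p.2 k)%:~R / (J%:R * M%:R) + (H p.2)%:~R / M%:R)) in
      B * cos ph - B' * sin ph))) ^+ 2 <=
  (\sum_i a i) * (A' * ((2 * J)%:R * (4 * (32 * n.+1%:R) ^+ n * (64 * n.+1%:R * L%:R) ^+ n.+1 * A * \sum_i b i))).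
Proof.
move=> L0 K0 eM dvM a0 T1 c1 wb hB hZ hH hA hA'.
have J0 : (0 < J)%N by rewrite /J !muln_gt0 L0.
have J0r : 0 < (J%:R : R) by rewrite ltr0n.
have A'0 : 0 <= A' by apply: le_trans (hA' [ffun=> Ordinal (ltn_addr _ J0)] (Ordinal (ltn_addr _ J0))); apply: sumr_ge0.
pose ph (u : {ffun 'I_n -> 'I_(2 * J)}) (t : 'I_(2 * J)) (p : 'I_L * V) : R :=
  2 * pi * (L + p.1)%:R * ((t%:R - J%:R) / J%:R +
    (\sum_k ((u k)%:R - J%:R) * (Z p.2 k)%:~R / (J%:R * M%:R) + (H p.2)%:~R / M%:R)).
pose G u t := \sum_p c p.1 * w p.2 * (B * cos (ph u t p) - B' * sin (ph u t p)).
rewrite -/(G _ _).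
apply: le_trans (sqr_wsum_le R I a (fun i => T i * G (U i) (r i)) a0) _.
rewrite ler_wpM2l ?sumr_ge0 //.
apply: (@le_trans _ _ (\sum_i a i * G (U i) (r i) ^+ 2)).
  apply: ler_sum => i _; rewrite ler_wpM2l // exprMn -[leRHS]mul1r ler_wpM2r ?sqr_ge0 //.
  by rewrite -real_normK ?num_real // expr_le1 ?T1 ?c1 ?normr_ge0.
rewrite (partition_big (fun i => (U i, r i)) xpredT) //=.
rewrite -(pair_bigA _ (fun u t => \sum_(i | (U i, r i) == (u, t)) a i * G (U i) (r i) ^+ 2)) /=.
apply: (@le_trans _ _ (\sum_u \sum_t A' * G u t ^+ 2)).
  apply: ler_sum => u _; apply: ler_sum => t _.
  rewrite (eq_bigr (fun i => a i * G u t ^+ 2)) => [|i /eqP[-> ->] //].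
  by rewrite -mulr_suml ler_wpM2r ?sqr_ge0 //; apply: hA'.
rewrite (eq_bigr (fun u => A' * \sum_t G u t ^+ 2)) => [|u _]; last by rewrite mulr_sumr.
rewrite -mulr_sumr ler_wpM2l //.
apply: le_trans (ler_wpM2l _ (large_sieve R V n L M K w b H Z A L0 K0 eM dvM wb hZ hH hA)); last by [].
rewrite [X in _ <= _ * X]exchange_big [leRHS]mulr_sumr; apply: ler_sum => u _ /=.
apply: (@le_trans _ _ (\sum_t tsq R ('I_L * V)%type (fun p => c p.1 * w p.2) (ph u t))).
  by apply: ler_sum => t _; apply: tsq_lin_le.
pose phi (p : 'I_L * V) : R := 2 * pi * (L + p.1)%:R *
    (\sum_k ((u k)%:R - J%:R) * (Z p.2 k)%:~R / (J%:R * M%:R) + (H p.2)%:~R / M%:R).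
(* Writing [1 / J] as [2 / (2 * J)] gives period [2 * J] in [t] and the integer frequencies
   [2 * (L + l)]. They are distinct and differ by less than [2 * J], so each [l] is a fibre of its
   own. *)
rewrite (eq_bigr (fun t : 'I_(2 * J) => tsq R ('I_L * V)%type (fun p => c p.1 * w p.2) (fun p => phi p +
   2 * pi * ((t%:R - J%:R) * ((2 * (L + p.1))%N : int)%:~R / (2 * J)%:R)))); last first.
  move=> t _; apply: eq_tsq => // p; rewrite /ph /phi.
  rewrite -[((2 * _)%N : int)%:~R]/((2 * (L + p.1))%:R) !natrM; field.
  by rewrite nat1r !pnatr_eq0 -!lt0n L0 eM !muln_gt0 L0 K0.
rewrite circle_parseval; last first.
  move=> p p'; have := ltn_ord p.1; have := ltn_ord p'.1; rewrite /J; lia.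
rewrite ler_wpM2l //.
have xi : injective (fun l : 'I_L => ((2 * (L + l))%N : int)).
  by move=> l l' e; apply: val_inj => /=; lia.
rewrite (fiber_tsq_prod R 'I_L V _ (fun l v => c l * w v) (fun l v => phi (l, v)) _ xi); apply: ler_sum => l _ /=.
rewrite /tsq /=; under eq_bigr do rewrite -mulrA; under [X in _ + X ^+ 2 <= _]eq_bigr do rewrite -mulrA.
rewrite -!mulr_sumr !exprMn -mulrDr -[leRHS]mul1r ler_wpM2r ?addr_ge0 ?sqr_ge0 //.
by rewrite -real_normK ?num_real // expr_le1 ?T1 ?c1 ?normr_ge0.
Qed.

(* Up to a factor [1 / k`!], the Taylor coefficients of [cos] and [sin]. *)
Definition ccf (R : pzRingType) (k : nat) : R := (~~ odd k)%:R * (-1) ^+ k./2.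
Definition scf (R : pzRingType) (k : nat) : R := (odd k)%:R * (-1) ^+ k.-1./2.

Lemma ccf_scf (R : realDomainType) (k : nat) : ccf R k ^+ 2 + scf R k ^+ 2 <= 1.
Proof.
by rewrite /ccf /scf; case: (odd k);
  rewrite /= mul0r mul1r expr0n /= ?(addr0, add0r) -exprM mulnC exprM sqrrN expr1n expr1n.
Qed.

Lemma cosD_taylor (R : realType) (phi th : R) :
  (fun N => \sum_(k < N) (ccf R k * cos phi - scf R k * sin phi) * th ^+ k / k`!%:R) @ \oo
  --> cos (phi + th).
Proof.
have hc : series (cos_coeff th) @ \oo --> cos th by rewrite unlock; apply: is_cvg_series_cos_coeff.
have hs : series (sin_coeff th) @ \oo --> sin th by rewrite unlock; apply: is_cvg_series_sin_coeff.
have -> : (fun N => \sum_(k < N) (ccf R k * cos phi - scf R k * sin phi) * th ^+ k / k`!%:R) =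
    (fun N => cos phi * series (cos_coeff th) N - sin phi * series (sin_coeff th) N).
  apply/funext => N; rewrite /series /= !big_mkord !mulr_sumr -sumrB; apply: eq_bigr => k _.
  by rewrite /ccf /scf /cos_coeff /sin_coeff /= -exprnP; ring.
by rewrite cosD; apply: cvgB; apply: cvgMl_tmp.
Qed.

Lemma ler_factX2 (R : realFieldType) (y : R) (k : nat) :
  0 <= y -> y <= 2^-1 -> y ^+ k / k`!%:R <= (2^-1) ^+ k.
Proof.
move=> y0 y1; rewrite ler_pdivrMr ?ltr0n ?fact_gt0 //.
rewrite -[leLHS]mulr1 ler_pM ?exprn_ge0 //; first by rewrite lerXn2r ?nnegrE.
by rewrite ler1n fact_gt0.
Qed.

Lemma sum_half_le2 (R : realFieldType) (N : nat) : \sum_(k < N) (2^-1 : R) ^+ k <= 2.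
Proof.
suff -> : \sum_(k < N) (2^-1 : R) ^+ k = 2 - 2 * (2^-1) ^+ N.
  by rewrite gerBl mulr_ge0 ?exprn_ge0.
elim: N => [|N IH]; first by rewrite big_ord0; ring.
by rewrite big_ord_recr /= IH exprS; field.
Qed.

Lemma sum_ord_pow (R : comPzRingType) (I : finType) (k : nat) (x : I -> R) :
  (\sum_i x i) ^+ k = \sum_(f : {ffun 'I_k -> I}) \prod_l x (f l).
Proof. by rewrite -(bigA_distr_bigA (fun _ i => x i)) prodr_const card_ord. Qed.

(* After rounding [(r, u)] to a grid of mesh [1 / J], the phase is a grid phase
   plus [th = 2 * pi * (L + l) / J * \sum_o T i o * W j o] with [|T|, |W| <= 1];
   expanding the powers of [th] in the Taylor series gives sums of products of
   functions of [i], [j] and [l], each bounded by [grid_form_bound], and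
   [J = 32 * n.+1 * L] makes the series geometric with ratio [1 / 2]. *)
Lemma block_bound (R : realType) (I V : finType) (n L M K : nat) (a : I -> R) (b : V -> R)
    (r : I -> R) (u : I -> 'I_n -> R) (H : V -> int) (Z : V -> {ffun 'I_n -> int})
    (c : 'I_L -> R) (A A' X : R) (J := (32 * n.+1 * L)%N) :
  (0 < L)%N -> (0 < K)%N -> M = (64 * n.+1 * L * K)%N ->
  (forall lam, (L <= lam < 2 * L)%N -> (lam %| M)%N) ->
  (forall i, 0 <= a i) -> (forall i, 0 <= b i) -> (forall l, `|c l| <= 1) ->
  (forall i, -1 <= r i < 1) -> (forall i k, -1 <= u i k < 1) ->
  (forall i k, `|Z i k| * 4 <= M%:Z) -> (forall i, `|H i| * 4 <= M%:Z) ->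
  0 <= A -> 0 <= A' -> 0 <= X ->
  (forall j, \sum_(i | (`|H i - H j| < K%:Z) && [forall k, `|Z i k - Z j k| < K%:Z]) b i <= A) ->
  (forall j, \sum_(i | (`|r i - r j| <= J%:R^-1) && [forall k, `|u i k - u j k| <= J%:R^-1]) a i <= A') ->
  (\sum_i a i) * (A' * ((2 * J)%:R * (4 * (32 * n.+1%:R) ^+ n * (64 * n.+1%:R * L%:R) ^+ n.+1 * A * \sum_i b i)))
    <= X ^+ 2 ->
  `|\sum_l c l * (\sum_i \sum_j a i * b j *
     cos (2 * pi * (L + l)%:R * (r i + \sum_k u i k * ((Z j k)%:~R / M%:R) + (H j)%:~R / M%:R)))| <= 2 * X.
Proof.
move=> L0 K0 eM dvM a0 b0 c1 hr hu hZ hH A0 A'0 X0 hA hA' hX.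
have J0 : (0 < J)%N by rewrite /J !muln_gt0 L0.
have M0 : (0 < M)%N by rewrite eM !muln_gt0 L0 K0.
have J0r : 0 < (J%:R : R) by rewrite ltr0n.
have M0r : 0 < (M%:R : R) by rewrite ltr0n.
have L0r : 0 < (L%:R : R) by rewrite ltr0n.
(* The half-open range of [x] makes the floor of [J * x + J] an index below [2 * J]. *)
have cellP (x : R) : -1 <= x < 1 -> exists q : 'I_(2 * J), 0 <= J%:R * x + J%:R - q%:R < 1.
  move=> /andP[x1 x2].
  have y0 : 0 <= J%:R * x + J%:R by nra.
  have /andP[q1 q2] := truncn_itv y0.
  have ql : (Num.truncn (J%:R * x + J%:R) < 2 * J)%N.
    by rewrite -(ltr_nat R) natrM; apply: le_lt_trans q1 _; nra.
  exists (Ordinal ql) => /=; move: q1 q2; rewrite -natr1; lra.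
pose rc i : 'I_(2 * J) := xchoose (cellP _ (hr i)).
have rcP i : 0 <= J%:R * r i + J%:R - (rc i)%:R < 1 by exact: (xchooseP (cellP _ (hr i))).
pose uc i : {ffun 'I_n -> 'I_(2 * J)} := [ffun k => xchoose (cellP _ (hu i k))].
have ucP i k : 0 <= J%:R * u i k + J%:R - (uc i k)%:R < 1.
  by rewrite /uc ffunE; exact: (xchooseP (cellP _ (hu i k))).
have cellA' t q : \sum_(i | (uc i == t) && (rc i == q)) a i <= A'.
  case: (pickP (fun i => (uc i == t) && (rc i == q))) => [j /andP[/eqP ej /eqP fj]|none]; last first.
    by rewrite big_pred0.
  have close (x y v : R) : 0 <= J%:R * x + J%:R - v < 1 -> 0 <= J%:R * y + J%:R - v < 1 -> `|x - y| <= J%:R^-1.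
    move=> h1 h2; rewrite -(ler_pM2l J0r) divff ?gt_eqF // -{1}(gtr0_norm J0r) -normrM.
    by rewrite ler_norml mulrBr; lra.
  apply: le_trans (hA' j); rewrite big_mkcond [leRHS]big_mkcond; apply: ler_sum => i _.
  case: ifP => [/andP[/eqP ei /eqP fi]|_]; last by case: ifP.
  rewrite ifT //; apply/andP; split.
    by apply: (close _ _ (rc i)%:R) (rcP i) _; rewrite fi -fj.
  by apply/forallP => k; apply: (close _ _ (uc i k)%:R) (ucP i k) _; rewrite ei -ej.
have boxA x (Y : {ffun 'I_n -> int}) :
   \sum_(i | (x <= H i < x + K%:Z) && [forall k, Y k <= Z i k < Y k + K%:Z]) b i <= A.
  case: (pickP (fun i => (x <= H i < x + K%:Z) && [forall k, Y k <= Z i k < Y k + K%:Z])) =>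
     [j /andP[hj /forallP Zj]|none]; last by rewrite big_pred0.
  apply: le_trans (hA j); rewrite big_mkcond [leRHS]big_mkcond; apply: ler_sum => i _.
  case: ifP => [/andP[hi /forallP Zi]|_]; last by case: ifP.
  rewrite ifT //; apply/andP; split; first by move: hi hj; clear; lia.
  by apply/forallP => k; move: (Zi k) (Zj k); clear; lia.
(* [T] is the rounding error in units of [1 / J]: [None] stands for [r], with cofactor 1, and
   [Some k] for [u k], with cofactor the [k]-th coordinate of the second point. *)
pose T i (o : option 'I_n) : R := if o is Some k then J%:R * u i k + J%:R - (uc i k)%:R
  else J%:R * r i + J%:R - (rc i)%:R.
pose W j (o : option 'I_n) : R := if o is Some k then (Z j k)%:~R / M%:R else 1.
have T1 i o : `|T i o| <= 1.
  by case: o => [k|] /=; rewrite ger0_norm; have := ucP i; have := rcP i; 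
     [move=> _ /(_ k) | move=> _ /(_ k) | |]; lra.
have W1 j o : `|W j o| <= 1.
  case: o => [k|] /=; last by rewrite normr1.
  rewrite normrM normfV (gtr0_norm M0r) ler_pdivrMr // mul1r -intr_norm -[M%:R]/(M%:Z%:~R) ler_int.
  by have := hZ j k; lia.
pose phi i (p : 'I_L * V) : R := 2 * pi * (L + p.1)%:R * (((rc i)%:R - J%:R) / J%:R +
        (\sum_k ((uc i k)%:R - J%:R) * (Z p.2 k)%:~R / (J%:R * M%:R) + (H p.2)%:~R / M%:R)).
pose th i (p : 'I_L * V) : R := 2 * pi * (L + p.1)%:R / J%:R * (\sum_o T i o * W p.2 o).
have phth i p : phi i p + th i p =
   2 * pi * (L + p.1)%:R * (r i + \sum_k u i k * ((Z p.2 k)%:~R / M%:R) + (H p.2)%:~R / M%:R).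
  rewrite /phi /th.
  have -> : \sum_o T i o * W p.2 o = T i None + \sum_k T i (Some k) * W p.2 (Some k).
    rewrite (bigD1 None) //= mulr1; congr (_ + _).
    rewrite [LHS](reindex_omap Some id) /=; last by case.
    by apply: eq_bigl => k; rewrite eqxx.
  have -> : \sum_k u i k * ((Z p.2 k)%:~R / M%:R) =
    \sum_k ((uc i k)%:R - J%:R) * (Z p.2 k)%:~R / (J%:R * M%:R) +
      J%:R^-1 * \sum_k T i (Some k) * W p.2 (Some k).
    rewrite mulr_sumr -big_split; apply: eq_bigr => k _ /=.
    by field; rewrite !gt_eqF.
  by rewrite /=; field; rewrite !gt_eqF.
pose S := \sum_l c l * (\sum_i \sum_j a i * b j *
     cos (2 * pi * (L + l)%:R * (r i + \sum_k u i k * ((Z j k)%:~R / M%:R) + (H j)%:~R / M%:R))).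
pose g k i (p : 'I_L * V) := ccf R k * cos (phi i p) - scf R k * sin (phi i p).
have SE : S = \sum_i \sum_(p : 'I_L * V) a i * (c p.1 * b p.2) * cos (phi i p + th i p).
  rewrite (eq_bigr (fun i => \sum_l \sum_j a i * (c l * b j) * cos (phi i (l, j) + th i (l, j)))); last first.
    by move=> i _; rewrite (pair_bigA _ (fun l j => a i * (c l * b j) * cos (phi i (l, j) + th i (l, j)))) /=;
       apply: eq_bigr => -[l j].
  rewrite /S exchange_big /=; apply: eq_bigr => l _; rewrite mulr_sumr; apply: eq_bigr => i _.
  by rewrite mulr_sumr; apply: eq_bigr => j _; rewrite phth /=; ring.
pose term k := \sum_i \sum_(p : 'I_L * V) a i * (c p.1 * b p.2) * (g k i p * th i p ^+ k / k`!%:R).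
have cvS : (fun N => \sum_(k < N) term k) @ \oo --> S.
  rewrite SE.
  have -> : (fun N => \sum_(k < N) term k) = (fun N => \sum_i \sum_(p : 'I_L * V) a i * (c p.1 * b p.2) *
      \sum_(k < N) (g k i p * th i p ^+ k / k`!%:R)).
    apply/funext => N; rewrite /term exchange_big; apply: eq_bigr => i _ /=.
    by rewrite exchange_big; apply: eq_bigr => p _ /=; rewrite mulr_sumr.
  apply: cvg_big => [|i _]; first exact: add_continuous.
  apply: cvg_big => [|p _]; first exact: add_continuous.
  by apply: cvgMl_tmp; apply: cosD_taylor.
(* A majorant of [|th|]: the frequency is below [2 * L] and there are [n.+1] summands bounded by 1.
   The constant in [J] makes it [pi / 8]. *)
pose y : R := 2 * pi * (2 * L%:R) / J%:R * n.+1%:R.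
have y0 : 0 <= y by rewrite /y !(mulr_ge0, invr_ge0, pi_ge0).
have y1 : y <= 2^-1.
  have p4 := pihalf_lt2 R; have n0 : 0 < (n.+1%:R : R) by rewrite ltr0n.
  rewrite /y /J !natrM (_ : _ * _ = pi / 8); first by lra.
  by field; rewrite nat1r gt_eqF // gt_eqF.
have termle k : `|term k| <= X * (2^-1) ^+ k.
  pose q : R := 2 * pi * (2 * L%:R) / J%:R.
  have q0 : 0 <= q by rewrite /q !(mulr_ge0, invr_ge0, pi_ge0).
  (* Each [f] picks one summand of [th] per factor. The frequency is divided by [2 * L], so that its
     power can join [c] without exceeding 1. *)
  have -> : term k = q ^+ k / k`!%:R * \sum_(f : {ffun 'I_k -> option 'I_n}) \sum_i a i *
     ((\prod_l T i (f l)) * \sum_(p : 'I_L * V) (c p.1 * ((L + p.1)%:R / (2 * L%:R)) ^+ k) *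
       (b p.2 * \prod_l W p.2 (f l)) * g k i p).
    rewrite /term [X in _ = _ * X]exchange_big [RHS]mulr_sumr; apply: eq_bigr => i _ /=.
    rewrite (eq_bigr (fun f : {ffun 'I_k -> option 'I_n} => \sum_(p : 'I_L * V)
       (a i * (c p.1 * b p.2) * g k i p * ((L + p.1)%:R / (2 * L%:R)) ^+ k) *
         (\prod_l T i (f l) * \prod_l W p.2 (f l)))); last first.
      by move=> f _; rewrite mulr_sumr mulr_sumr; apply: eq_bigr => p _; ring.
    rewrite [X in _ = _ * X]exchange_big [RHS]mulr_sumr; apply: eq_bigr => p _ /=.
    rewrite -mulr_sumr /th exprMn sum_ord_pow.
    under eq_bigr do rewrite big_split /=.
    have -> : 2 * pi * (L + p.1)%:R / J%:R = q * ((L + p.1)%:R / (2 * L%:R)) :> R.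
      by rewrite /q; field; rewrite !gt_eqF.
    by rewrite [(q * _) ^+ k]exprMn; ring.
  have fle (f : {ffun 'I_k -> option 'I_n}) : `|\sum_i a i *
     ((\prod_l T i (f l)) * \sum_(p : 'I_L * V) (c p.1 * ((L + p.1)%:R / (2 * L%:R)) ^+ k) *
       (b p.2 * \prod_l W p.2 (f l)) * g k i p)| <= X.
    rewrite -(ler_sqr (x := `|_|)) ?nnegrE // real_normK ?num_real //.
    apply: le_trans _ hX.
    have := grid_form_bound R I V n L M K a (fun i => \prod_l T i (f l)) (fun j => b j * \prod_l W j (f l)) b uc rc H Z
      (fun l => c l * ((L + l)%:R / (2 * L%:R)) ^+ k) A A' (ccf R k) (scf R k) L0 K0 eM dvM a0.
    apply => //.
    - by move=> i; rewrite normr_prod prodr_ile1 // => l; rewrite normr_ge0 T1.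
    - move=> l; have lr : 0 <= ((L + l)%:R / (2 * L%:R) : R) <= 1.
        rewrite divr_ge0 ?mulr_ge0 //= ler_pdivrMr ?mulr_gt0 // mul1r -natrM ler_nat.
        by have := ltn_ord l; lia.
      have /andP[l1 l2] := lr.
      by rewrite normrM normrX mulr_ile1 ?exprn_ge0 ?exprn_ile1 // ger0_norm.
    - move=> j; rewrite normrM ger0_norm // ler_piMr // normr_prod prodr_ile1 // => l; rewrite normr_ge0 W1 //.
    - exact: ccf_scf.
    - by move=> i j k'; have := hZ i k'; have := hZ j k'; clear; lia.
    - by move=> i j; have := hH i; have := hH j; clear; lia.
  rewrite normrM ger0_norm ?divr_ge0 ?exprn_ge0 //.
  apply: (@le_trans _ _ (q ^+ k / k`!%:R * (n.+1%:R ^+ k * X))).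
    rewrite ler_wpM2l ?divr_ge0 ?exprn_ge0 //.
    apply: le_trans (ler_norm_sum _ _ _) _; apply: le_trans (ler_sum _ (fun f _ => fle f)) _.
    by rewrite sumr_const card_ffun card_option !card_ord -[leLHS]mulr_natl natrX.
  rewrite mulrA [leLHS]mulrC ler_wpM2l //.
  apply: le_trans (ler_factX2 R y k y0 y1); rewrite /y -/q [(q * _) ^+ k]exprMn.
  rewrite le_eqVlt; apply/orP; left; apply/eqP; ring.
apply: (@ler_cvg_to _ \oo _ R (fun N => `|\sum_(k < N) term k|) (fun=> 2 * X)).
- exact: cvg_norm cvS.
- exact: cvg_cst.
- apply: nearW => N; apply: le_trans (ler_norm_sum _ _ _) _.
  apply: (@le_trans _ _ (\sum_(k < N) X * (2^-1) ^+ k)); first exact: ler_sum.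
  by rewrite -mulr_sumr mulrC ler_wpM2r // sum_half_le2.
Qed.

(** * Fejer kernel *)

Definition fejer (R : realType) (L : nat) (x : R) : R :=
  tsq R 'I_L (fun=> 1) (fun k => 2 * pi * k%:R * x) / L%:R.

Lemma fejer_ge0 (R : realType) (L : nat) (x : R) : 0 <= fejer R L x.
Proof. by rewrite divr_ge0 // tsq_ge0. Qed.

(** Passing from [L] to [L.+1] adds a Dirichlet kernel to [tsq]. *)
Lemma fejerE (R : realType) (L : nat) (x : R) : (0 < L)%N ->
  fejer R L x = 2 * (\sum_(0 <= k < L) (1 - k%:R / L%:R) * cos (2 * pi * k%:R * x)) - 1.
Proof.
move=> L0.
have L0r : (L%:R : R) != 0 by rewrite pnatr_eq0 -lt0n.
apply: (mulIf L0r); rewrite /fejer divfK //.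
have -> : (2 * (\sum_(0 <= k < L) (1 - k%:R / L%:R) * cos (2 * pi * k%:R * x)) - 1) * L%:R =
   2 * (\sum_(0 <= k < L) (L%:R - k%:R) * cos (2 * pi * k%:R * x)) - L%:R.
  rewrite mulrBl mul1r -mulrA mulr_suml; congr (_ * _ - _); apply: eq_bigr => k _.
  by field.
elim: L {L0 L0r} => [|L IH].
  by rewrite /tsq !big_ord0 big_geq //; ring.
have st : tsq R 'I_L.+1 (fun=> 1) (fun k => 2 * pi * k%:R * x) =
  tsq R 'I_L (fun=> 1) (fun k => 2 * pi * k%:R * x) + 1 +
  2 * \sum_(0 <= k < L) cos (2 * pi * k.+1%:R * x).
  have -> : \sum_(0 <= k < L) cos (2 * pi * k.+1%:R * x) =
     \sum_(k < L) cos (2 * pi * L%:R * x - 2 * pi * k%:R * x).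
    rewrite big_nat_rev big_mkord; apply: eq_bigr => k _; congr cos.
    by rewrite add0n subnSK // natrB ?(ltnW (ltn_ord k)) //; ring.
  rewrite (eq_bigr (fun k : 'I_L => cos (2 * pi * L%:R * x) * (1 * cos (2 * pi * k%:R * x)) +
     sin (2 * pi * L%:R * x) * (1 * sin (2 * pi * k%:R * x)))); last first.
    by move=> k _; rewrite cosB; ring.
  rewrite big_split -!mulr_sumr /tsq !big_ord_recr /=.
  have := cos2Dsin2 (2 * pi * L%:R * x).
  set X := \sum_(i < L) 1 * cos _; set Y := \sum_(i < L) 1 * sin _ => h.
  have -> : \sum_(i < L) cos (2 * pi * i%:R * x) = X by apply: eq_bigr => i _; rewrite mul1r.
  have -> : \sum_(i < L) sin (2 * pi * i%:R * x) = Y by apply: eq_bigr => i _; rewrite mul1r.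
  by move: h; lra.
rewrite st IH.
have -> : \sum_(0 <= k < L.+1) (L.+1%:R - k%:R) * cos (2 * pi * k%:R * x) =
  \sum_(0 <= k < L) (L%:R - k%:R) * cos (2 * pi * k%:R * x) +
  \sum_(0 <= k < L.+1) cos (2 * pi * k%:R * x).
  rewrite !big_nat_recr //= addrA -big_split /= -natr1; congr (_ + _); last by ring.
  by apply: eq_bigr => k _; ring.
rewrite [\sum_(0 <= k < L.+1) cos _]big_nat_recl // mulr0 mul0r cos0 -natr1; ring.
Qed.

(** All phases are at most [pi / 8], so nothing cancels and the cosine sum is at least [L / 2]. *)
Lemma fejer_lower (R : realType) (L : nat) (x : R) : (0 < L)%N ->
  `|x| * (16 * L%:R) <= 1 -> L%:R / 4 <= fejer R L x.
Proof.
move=> L0 hx; have L0r : 0 < (L%:R : R) by rewrite ltr0n.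
rewrite /fejer ler_pdivlMr // /tsq.
have h : L%:R / 2 <= \sum_(k < L) 1 * cos (2 * pi * k%:R * x).
  have -> : L%:R / 2 = \sum_(k < L) 2^-1 :> R by rewrite sumr_const card_ord mulr_natl.
  apply: ler_sum => k _; rewrite mul1r; apply: cos_ge_half.
  have p4 := pihalf_lt2 R; have p0 := pi_gt0 R.
  have kL : (k%:R : R) <= L%:R by rewrite ler_nat ltnW.
  rewrite !normrM (ger0_norm (x := 2)) // (ger0_norm (pi_ge0 R)) normr_nat.
  have := normr_ge0 x => x0.
  have : k%:R * `|x| <= L%:R * `|x| by rewrite ler_wpM2r.
  have : 0 <= L%:R * `|x| by rewrite mulr_ge0.
  have : 0 <= k%:R * `|x| by rewrite mulr_ge0.
  nra.
have := sqr_ge0 (\sum_(i < L) 1 * sin (2 * pi * i%:R * x)).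
nra.
Qed.

(** The geometric sum multiplied by [2 * sin (pi * x)] telescopes to a difference of two unit
    vectors, whose square is at most 4. *)
Lemma fejer_upper (R : realType) (L : nat) (rho x : R) : (0 < L)%N ->
  0 < rho -> rho <= `|x| -> `|x| <= 2^-1 -> fejer R L x <= (sin (pi * rho)) ^- 2 / L%:R.
Proof.
move=> L0 r0 rx x2; have L0r : 0 < (L%:R : R) by rewrite ltr0n.
have p0 := pi_gt0 R.
have s0 : 0 < sin (pi * rho) by apply: sin_gt0_pi; apply/andP; split; nra.
have sx : sin (pi * rho) ^+ 2 <= sin (pi * x) ^+ 2.
  have -> : sin (pi * x) ^+ 2 = sin (pi * `|x|) ^+ 2.
    by case: (ger0P x) => _; rewrite // mulrN sinN sqrrN.
  have h := @ltr_sin R.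
  have le : sin (pi * rho) <= sin (pi * `|x|).
    rewrite leNgt h -?leNgt ?in_itv /=; [nra|nra|nra].
  nra.
rewrite /fejer ler_pM2r ?invr_gt0 //.
have tsq_sin : (2 * sin (pi * x)) ^+ 2 * tsq R 'I_L (fun=> 1) (fun k => 2 * pi * k%:R * x) <= 4.
  rewrite /tsq mulrDr -!exprMn !mulr_sumr.
  pose f (k : nat) : R := sin ((2 * k%:R - 1) * (pi * x)).
  pose g (k : nat) : R := cos ((2 * k%:R - 1) * (pi * x)).
  have e k : (2 * k.+1%:R - 1) * (pi * x) = 2 * pi * k%:R * x + pi * x :> R.
    by rewrite -natr1; ring.
  have e' k : (2 * k%:R - 1) * (pi * x) = 2 * pi * k%:R * x - pi * x :> R by ring.
  rewrite (eq_bigr (fun k : 'I_L => f k.+1 - f k)); last first.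
    by move=> k _; rewrite /f e e' sinD sinB; ring.
  rewrite [X in _ + X ^+ 2](eq_bigr (fun k : 'I_L => - (g k.+1 - g k))); last first.
    by move=> k _; rewrite /g e e' cosD cosB; ring.
  rewrite sumrN -(big_mkord xpredT (fun k => f k.+1 - f k)) -(big_mkord xpredT (fun k => g k.+1 - g k)).
  rewrite !telescope_sumr // sqrrN /f /g.
  set a := (_ - 1) * _; set b := (_ - 1) * _.
  have := cos2Dsin2 a; have := cos2Dsin2 b; have := sqr_ge0 (sin a + sin b); have := sqr_ge0 (cos a + cos b).
  nra.
have t0 := tsq_ge0 R 'I_L (fun=> 1) (fun k => 2 * pi * k%:R * x).
rewrite -[_ ^- 2]mul1r ler_pdivlMr ?exprn_gt0 //.
move: tsq_sin t0; move: (tsq _ _ _ _) => t; rewrite exprMn; nra.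
Qed.

(** Doubling the length of a Fejer mean raises the weight of each old term by [k / 2 ^ l.+1] and
    adds one block. The first effect is measured by [E], with [E l.+1 <= E l / 2 + X * kap ^+ l];
    the assumption [3 / 4 <= kap] propagates [E l <= 4 * X * kap ^+ l]. Each step costs
    [6 * X * kap ^+ l], and the costs form a geometric series. *)
Lemma fejer_dyadic_diff (R : realType) (s : nat -> R) (X kap : R) (l1 l2 : nat)
    (S := fun l => 2 * (\sum_(0 <= k < 2 ^ l) (1 - k%:R / (2 ^ l)%:R) * s k) - s 0%N) :
  0 <= X -> 3 / 4 <= kap -> kap < 1 -> (l1 <= l2)%N ->
  (forall l, (l < l2)%N -> \sum_(i < 2 ^ l) `|s (2 ^ l + i)%N| <= X * kap ^+ l) ->
  `|S l2 - S l1| <= 6 * X * kap ^+ l1 / (1 - kap).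
Proof.
move=> X0 k34 k1 l12 hs.
have kp l : 0 < kap ^+ l by apply: exprn_gt0; lra.
have split l (F : nat -> R) : \sum_(0 <= k < 2 ^ l.+1) F k =
    \sum_(0 <= k < 2 ^ l) F k + \sum_(i < 2 ^ l) F (2 ^ l + i)%N.
  rewrite (@big_cat_nat _ _ _ (2 ^ l)) ?leq_exp2l //=; congr (_ + _).
  rewrite -[X in \sum_(X <= _ < _) _]add0n big_addn expnS mul2n -addnn addnK big_mkord.
  by apply: eq_bigr => i _; rewrite addnC.
pose E l := \sum_(0 <= k < 2 ^ l) k%:R * `|s k| / (2 ^ l)%:R.
have p2 l : 0 < ((2 ^ l)%:R : R) by rewrite ltr0n expn_gt0.
have p2S l : (2 ^ l.+1)%:R = 2 * (2 ^ l)%:R :> R by rewrite expnS natrM.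
have hE l : (l <= l2)%N -> E l <= 4 * X * kap ^+ l.
  elim: l => [|l IH] ll.
    by rewrite /E expn0 big_nat1 !mul0r expr0 mulr1 mulr_ge0.
  have h1 := IH (ltnW ll); have h2 := hs l ll.
  have : E l.+1 <= E l / 2 + X * kap ^+ l.
    rewrite /E split lerD //.
      rewrite mulr_suml le_eqVlt; apply/orP; left; apply/eqP.
      by apply: eq_bigr => k _; rewrite p2S; field; rewrite gt_eqF.
    apply: le_trans h2; apply: ler_sum => i _.
    rewrite mulrAC ler_piMl // ler_pdivrMr // mul1r ler_nat expnS.
    by have := ltn_ord i; lia.
  rewrite exprS; have := mulr_ge0 X0 (ltW (kp l)); nra.
have step l : (l < l2)%N -> `|S l.+1 - S l| <= 6 * X * kap ^+ l.
  move=> ll.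
  have -> : S l.+1 - S l = 2 * (\sum_(0 <= k < 2 ^ l) (k%:R * s k / (2 ^ l)%:R / 2) +
      \sum_(i < 2 ^ l) (1 - (2 ^ l + i)%:R / (2 ^ l.+1)%:R) * s (2 ^ l + i)%N).
    rewrite /S split.
    have -> : \sum_(0 <= k < 2 ^ l) (1 - k%:R / (2 ^ l.+1)%:R) * s k =
      \sum_(0 <= k < 2 ^ l) (1 - k%:R / (2 ^ l)%:R) * s k + \sum_(0 <= k < 2 ^ l) (k%:R * s k / (2 ^ l)%:R / 2).
      rewrite -big_split; apply: eq_bigr => k _ /=; rewrite p2S; field; by rewrite gt_eqF.
    by ring.
  rewrite normrM ger0_norm //.
  have h1 : `|\sum_(0 <= k < 2 ^ l) (k%:R * s k / (2 ^ l)%:R / 2)| <= E l / 2.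
    apply: le_trans (ler_norm_sum _ _ _) _; rewrite /E mulr_suml; apply: ler_sum => k _.
    by rewrite !normrM !normfV !normr_nat.
  have h2 : `|\sum_(i < 2 ^ l) (1 - (2 ^ l + i)%:R / (2 ^ l.+1)%:R) * s (2 ^ l + i)%N| <= X * kap ^+ l.
    apply: le_trans (hs l ll); apply: le_trans (ler_norm_sum _ _ _) _; apply: ler_sum => i _.
    rewrite normrM ler_piMl // ger0_norm.
      by rewrite gerBl divr_ge0.
    rewrite subr_ge0 ler_pdivrMr // mul1r ler_nat expnS.
    by have := ltn_ord i; lia.
  have := hE l (ltnW ll); have := ler_normD (\sum_(0 <= k < 2 ^ l) (k%:R * s k / (2 ^ l)%:R / 2))
    (\sum_(i < 2 ^ l) (1 - (2 ^ l + i)%:R / (2 ^ l.+1)%:R) * s (2 ^ l + i)%N).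
  lra.
suff : forall m, (l1 + m <= l2)%N -> `|S (l1 + m)%N - S l1| <= 6 * X * (kap ^+ l1 - kap ^+ (l1 + m)) / (1 - kap).
  move=> /(_ (l2 - l1)%N); rewrite subnKC // => /(_ (leqnn _)) h; apply: le_trans h _.
  rewrite ler_pM2r ?invr_gt0 ?subr_gt0 // ler_wpM2l ?mulr_ge0 // gerBl ltW //.
elim=> [|m IH] lm; first by rewrite addn0 !subrr normr0 mulr0 mul0r.
have lm' : (l1 + m <= l2)%N by lia.
have h1 := IH lm'.
rewrite addnS in lm *.
have := step _ lm; have := ler_normD (S (l1 + m).+1 - S (l1 + m)%N) (S (l1 + m)%N - S l1).
rewrite addrA subrK.
have -> : 6 * X * (kap ^+ l1 - kap ^+ (l1 + m).+1) / (1 - kap) =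
  6 * X * (kap ^+ l1 - kap ^+ (l1 + m)) / (1 - kap) + 6 * X * kap ^+ (l1 + m).
  by rewrite [kap ^+ _.+1]exprS; field; lra.
move: h1; lra.
Qed.

(** * Finite form of Frostman's lemma *)

(** [j] counts coarsenings: for [N = 2 ^ n] the classes are the dyadic cubes of level [n - j], with
    [2 ^ j] cells per side. *)
Definition same_cube (d N : nat) (j : nat) (Y Y' : {ffun 'I_d -> 'I_N}) : bool :=
  [forall i, (Y i %/ 2 ^ j == Y' i %/ 2 ^ j)%N].

Definition cube_mass (R : realType) (d N : nat) (m : {ffun 'I_d -> 'I_N} -> R) (j : nat)
  (Y : {ffun 'I_d -> 'I_N}) : R := \sum_(Y' | same_cube d N j Y Y') m Y'.

Lemma same_cubexx d N j Y : same_cube d N j Y Y.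
Proof. by apply/forallP. Qed.

Lemma same_cube_sym d N j Y Y' : same_cube d N j Y Y' = same_cube d N j Y' Y.
Proof. by apply: eq_forallb => i; rewrite eq_sym. Qed.

Lemma same_cube_trans d N j Y1 Y2 Y3 :
  same_cube d N j Y1 Y2 -> same_cube d N j Y2 Y3 -> same_cube d N j Y1 Y3.
Proof.
by move=> /forallP h1 /forallP h2; apply/forallP => i; rewrite (eqP (h1 i)).
Qed.

Lemma same_cubeW d N j k Y Y' : (j <= k)%N -> same_cube d N j Y Y' -> same_cube d N k Y Y'.
Proof.
move=> jk /forallP h; apply/forallP => i.
by rewrite -(subnKC jk) expnD !divnMA (eqP (h i)).
Qed.

Lemma same_cube0 d N Y Y' : same_cube d N 0 Y Y' = (Y == Y').
Proof.
apply/forallP/eqP => [h|-> //]; apply/ffunP => i; apply: val_inj.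
by have := h i; rewrite !divn1 => /eqP.
Qed.

Lemma eq_same_cube d N j Y Y' : same_cube d N j Y Y' -> same_cube d N j Y =1 same_cube d N j Y'.
Proof.
move=> h Z; apply/idP/idP; apply: same_cube_trans => //; by rewrite same_cube_sym.
Qed.

Lemma eq_cube_mass (R : realType) d N (m : {ffun 'I_d -> 'I_N} -> R) j Y Y' :
  same_cube d N j Y Y' -> cube_mass R d N m j Y = cube_mass R d N m j Y'.
Proof. by move=> h; apply: eq_bigl; apply: eq_same_cube. Qed.

(** Every cell of [P] starts with mass [sg ^+ n]; going up through the levels, each overfull cube is
    scaled down to its cap. A scaled cube becomes saturated, and where nothing is scaled the
    saturated cube found at a lower stage is unchanged, so every cell of [P] stays inside a
    saturated cube. *)
Lemma dyadic_flow (R : realType) (d n : nat) (P : pred {ffun 'I_d -> 'I_(2 ^ n)}) (sg : R) :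
  0 < sg -> sg <= 1 ->
  exists m : {ffun 'I_d -> 'I_(2 ^ n)} -> R,
  [/\ forall Y, 0 <= m Y, forall Y, m Y != 0 -> P Y,
     forall j Y, (j <= n)%N -> cube_mass R d _ m j Y <= sg ^+ (n - j) &
     forall Y, P Y -> exists2 j, (j <= n)%N & cube_mass R d _ m j Y = sg ^+ (n - j)].
Proof.
move=> s0 s1.
suff H J : (J <= n)%N -> exists m : {ffun 'I_d -> 'I_(2 ^ n)} -> R,
  [/\ forall Y, 0 <= m Y, forall Y, m Y != 0 -> P Y,
     forall j Y, (j <= J)%N -> cube_mass R d _ m j Y <= sg ^+ (n - j) &
     forall Y, P Y -> exists2 j, (j <= J)%N & cube_mass R d _ m j Y = sg ^+ (n - j)] by exact: H.
elim: J => [|J IH] Jn.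
  exists (fun Y => if P Y then sg ^+ n else 0).
  have e Y : cube_mass R d _ (fun Y => if P Y then sg ^+ n else 0) 0 Y = if P Y then sg ^+ n else 0.
    by rewrite /cube_mass (big_pred1 Y) // => Y'; rewrite same_cube0 eq_sym.
  have p0 : 0 <= sg ^+ n by rewrite exprn_ge0 // ltW.
  split.
  - by move=> Y; case: ifP.
  - by move=> Y; case: ifP => // _; rewrite eqxx.
  - by move=> j Y; rewrite leqn0 => /eqP->; rewrite e subn0; case: ifP.
  - by move=> Y PY; exists 0%N => //; rewrite e PY subn0.
have [m [m0 mP mle mtight]] := IH (ltnW Jn).
set cap := sg ^+ (n - J.+1).
have cap0 : 0 < cap by rewrite exprn_gt0.
pose M Y := cube_mass R d _ m J.+1 Y.
pose t Y : R := if M Y <= cap then 1 else cap / M Y.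
have tP Y : 0 <= t Y <= 1.
  rewrite /t; case: (leP (M Y) cap) => h; first by rewrite ler01 lexx.
  have M0 := lt_trans cap0 h.
  apply/andP; split; first by rewrite divr_ge0 // ltW.
  by rewrite ler_pdivrMr // mul1r ltW.
(* [t] is constant on the cubes of these sizes, hence factors out of their masses. *)
have tE j Y : (j <= J.+1)%N -> cube_mass R d _ (fun Z => t Z * m Z) j Y = t Y * cube_mass R d _ m j Y.
  move=> jJ; rewrite /cube_mass mulr_sumr; apply: eq_bigr => Z h.
  by rewrite /t /M (eq_cube_mass _ _ _ _ _ _ _ (same_cubeW _ _ _ _ _ _ jJ h)).
have mm0 j Y : 0 <= cube_mass R d _ m j Y by apply: sumr_ge0.
exists (fun Z => t Z * m Z); split.
- by move=> Y; have /andP[? _] := tP Y; rewrite mulr_ge0.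
- by move=> Y; rewrite mulf_eq0 negb_or => /andP[_]; apply: mP.
- move=> j Y; rewrite leq_eqVlt => /orP[/eqP->|jJ].
    rewrite tE // -/cap -/(M Y) /t; case: (leP (M Y) cap) => h; first by rewrite mul1r.
    by rewrite divfK // gt_eqF // (lt_trans cap0 h).
  rewrite tE ?(ltnW jJ) //; have /andP[t0 t1] := tP Y.
  by apply: le_trans (mle j Y jJ); rewrite ler_piMl.
- move=> Y PY; case: (leP (M Y) cap) => h.
    have [j jJ e] := mtight Y PY; exists j; first exact: leqW.
    by rewrite tE ?leqW // /t h mul1r.
  exists J.+1 => //; rewrite tE // /t leNgt h /= -/(M Y) divfK // gt_eqF //.
  exact: lt_trans cap0 h.
Qed.

(* The maximal saturated cubes are pairwise disjoint and cover [P]. *)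
Lemma saturated_cover (R : realType) (d n : nat) (P : pred {ffun 'I_d -> 'I_(2 ^ n)}) (sg : R)
    (m : {ffun 'I_d -> 'I_(2 ^ n)} -> R) :
  (forall Y, 0 <= m Y) ->
  (forall Y, P Y -> exists2 j, (j <= n)%N & cube_mass R d _ m j Y = sg ^+ (n - j)) ->
  exists C : {set 'I_n.+1 * {ffun 'I_d -> 'I_(2 ^ n)}},
    (forall Y, P Y -> exists2 c, c \in C & same_cube d _ c.1 c.2 Y) /\
    \sum_(c in C) sg ^+ (n - c.1) <= \sum_Y m Y.
Proof.
move=> m0 mt; pose V := {ffun 'I_d -> 'I_(2 ^ n)}.
pose sat (Y : V) (j : 'I_n.+1) := cube_mass R d _ m j Y == sg ^+ (n - j).
pose jm (Y : V) : 'I_n.+1 := [arg max_(j > ord0 | sat Y j) (j : nat)]%N.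
have ex Y : P Y -> exists j, sat Y j.
  by move=> /mt[j jn e]; exists (Ordinal (jn : j < n.+1)%N); apply/eqP.
have jmP Y : P Y -> sat Y (jm Y) /\ forall j, sat Y j -> (j <= jm Y)%N.
  move=> /ex [j0 hj0]; rewrite /jm.
  (* The default [ord0] need not be saturated; once some [j0] is, the maximum does not depend on the
     default. *)
  rewrite (_ : [arg max_(j > ord0 | sat Y j) (j : nat)]%N = [arg max_(j > j0 | sat Y j) (j : nat)]%N).
    by case: arg_maxnP => // j h1 h2; split.
  rewrite /arg_max /extremum; case: pickP => // h.
  case: (arg_maxnP (fun j : 'I_n.+1 => j : nat) hj0) => j hj hmax.
  have := h j; rewrite /= hj /= => /negP[]; apply/forallP => k; apply/implyP => hk; exact: hmax.
(* A canonical representative, so that all points of a cube yield the same pair and no cube is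
   counted twice. *)
pose rep (Y : V) : V := odflt Y [pick Z | same_cube d _ (jm Y) Y Z].
have repP Y : same_cube d _ (jm Y) Y (rep Y).
  by rewrite /rep; case: pickP => //= _; apply: same_cubexx.
have rep_eq Y Y' : jm Y = jm Y' -> same_cube d _ (jm Y) Y Y' -> rep Y = rep Y'.
  move=> e h; rewrite /rep -e (eq_pick (eq_same_cube _ _ _ _ _ h)).
  by case: pickP => //= /(_ Y'); rewrite same_cubexx.
exists [set (jm Y, rep Y) | Y in P]%SET; split.
  move=> Y PY; exists (jm Y, rep Y); first by apply: imset_f.
  by rewrite /= same_cube_sym.
rewrite (eq_bigr (fun c : 'I_n.+1 * V => cube_mass R d _ m c.1 c.2)); last first.
  move=> c /imsetP[Y PY ->] /=; rewrite -(eq_cube_mass _ _ _ _ _ _ _ (repP Y)).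
  by have [/eqP] := jmP Y PY.
rewrite /cube_mass (exchange_big_dep xpredT) //=.
apply: ler_sum => Z _; rewrite sumr_const -[leRHS]mulr1n ler_wpMn2l //.
apply/card_le1_eqP => c c'; rewrite !unfold_in => /andP[/imsetP[Y PY ->] /= h] /andP[/imsetP[Y' PY' ->] /= h'].
have hY : same_cube d _ (jm Y) Y Z by apply: same_cube_trans h.
have hY' : same_cube d _ (jm Y') Y' Z by apply: same_cube_trans h'.
(* Two chosen cubes through [Z] are nested; maximality of the smaller one forces equal sizes. *)
have key (Y1 Y2 : V) : P Y1 -> P Y2 -> same_cube d _ (jm Y1) Y1 Z -> same_cube d _ (jm Y2) Y2 Z ->
   (jm Y1 <= jm Y2)%N -> jm Y1 = jm Y2 /\ same_cube d _ (jm Y2) Y1 Y2.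
  move=> P1 P2 h1 h2 le.
  have s12 : same_cube d _ (jm Y2) Y1 Y2.
    by apply: same_cube_trans (same_cubeW _ _ _ _ _ _ le h1) _; rewrite same_cube_sym.
  split=> //; apply: val_inj; apply/eqP; rewrite eqn_leq le /=.
  have [_ mx] := jmP Y1 P1; apply: mx; rewrite /sat (eq_cube_mass _ _ _ _ _ _ _ s12).
  by have [] := jmP Y2 P2.
case: (leqP (jm Y) (jm Y')) => le.
  have [e s] := key Y Y' PY PY' hY hY' le.
  by rewrite (rep_eq Y Y') ?e.
have [e s] := key Y' Y PY' PY hY' hY (ltnW le).
by rewrite (rep_eq Y' Y) ?e.
Qed.

(* In each coordinate at most [2 * w + 3] dyadic intervals of length [2 ^ j]
   lie within distance [w * 2 ^ j] of a point. *)
Lemma near_mass_le (R : realType) (d N : nat) (m : {ffun 'I_d -> 'I_N} -> R) (j w : nat)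
    (c : R) (Y : {ffun 'I_d -> 'I_N}) :
  (forall Y, 0 <= m Y) -> (forall Y, cube_mass R d N m j Y <= c) ->
  \sum_(Y' : {ffun 'I_d -> 'I_N} |
     [forall i, (Y' i <= Y i + w * 2 ^ j) && (Y i <= Y' i + w * 2 ^ j)]%N) m Y'
  <= (2 * w + 3)%:R ^+ d * c.
Proof.
move=> m0 mc; have p2 : (0 < 2 ^ j)%N by rewrite expn_gt0.
have c0 : 0 <= c by apply: le_trans (mc Y); apply: sumr_ge0.
(* The offset of the cube of [Y'] from that of [Y]; adding [w.+1] keeps the subtraction from being
   truncated. *)
rewrite addn3; pose key (Y' : {ffun 'I_d -> 'I_N}) : {ffun 'I_d -> 'I_(2 * w).+3} :=
  [ffun i => inord (Y' i %/ 2 ^ j + w.+1 - Y i %/ 2 ^ j)%N].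
rewrite (partition_big key xpredT) //=.
apply: (@le_trans _ _ (\sum_(t : {ffun 'I_d -> 'I_(2 * w).+3}) c)); last first.
  by rewrite sumr_const card_ffun !card_ord -[leLHS]mulr_natl natrX.
apply: ler_sum => t _.
case: (pickP (fun Y' : {ffun 'I_d -> 'I_N} =>
  [forall i, (Y' i <= Y i + w * 2 ^ j) && (Y i <= Y' i + w * 2 ^ j)]%N && (key Y' == t))) => [Y0 /andP[/forallP h0 /eqP k0]|none]; last by rewrite big_pred0.
apply: le_trans (mc Y0); rewrite /cube_mass big_mkcond [leRHS]big_mkcond; apply: ler_sum => Y' _.
case: ifP => [/andP[/forallP h1 /eqP k1]|_]; last by case: ifP.
rewrite ifT //; apply/forallP => i.
have := congr1 (fun f : {ffun _} => f i) (etrans k0 (esym k1)); rewrite !ffunE => /(congr1 val) /=.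
have B (A : nat) : (A <= Y i + w * 2 ^ j)%N -> (Y i <= A + w * 2 ^ j)%N ->
   (Y i %/ 2 ^ j <= A %/ 2 ^ j + w.+1)%N /\ (A %/ 2 ^ j + w.+1 - Y i %/ 2 ^ j < (2 * w).+3)%N.
  move=> a1 a2.
  have b1 : (A %/ 2 ^ j <= Y i %/ 2 ^ j + w)%N.
    by rewrite -[X in (_ <= _ + X)%N](mulnK w p2) -divnDr ?dvdn_mull // leq_div2r.
  have b2 : (Y i %/ 2 ^ j <= A %/ 2 ^ j + w)%N.
    by rewrite -[X in (_ <= _ + X)%N](mulnK w p2) -divnDr ?dvdn_mull // leq_div2r.
  lia.
have /andP[x1 x2] := h0 i; have /andP[y1 y2] := h1 i.
have [c1 c2] := B _ x1 x2; have [e1 e2] := B _ y1 y2.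
by rewrite !inordK // => e; apply/eqP; move: e c1 e1; clear; lia.
Qed.

(** Lower corner of the cell [Y] when [[-B, B)^d] is cut into [2 ^ n] intervals along each axis. *)
Definition grid_pt (R : realType) (d n : nat) (B : R) (Y : {ffun 'I_d -> 'I_(2 ^ n)}) (i : 'I_d) : R :=
  - B + 2 * B * (Y i)%:R / (2 ^ n)%:R.

Lemma sum_nth_le (R : realDomainType) (l : seq R) (k : nat) :
  (forall x, x \in l -> 0 <= x) -> \sum_(0 <= i < k) nth 0 l i <= \sum_(x <- l) x.
Proof.
elim: l k => [|x l IH] k h.
  by rewrite big_nil big1 // => i _; rewrite nth_nil.
have hl y : y \in l -> 0 <= y by move=> yl; apply: h; rewrite inE yl orbT.
have x0 : 0 <= x by apply: h; rewrite mem_head.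
rewrite big_cons; case: k => [|k].
  by rewrite big_geq // addr_ge0 // big_seq sumr_ge0.
by rewrite big_nat_recl //= lerD2l; exact: IH.
Qed.

(** Otherwise [hausdorff_delta_measure] vanishes for every [delta], so does the Hausdorff measure,
    and [s] bounds the dimension from above. *)
Lemma hausdorff_content_gt0 (R : realType) (d : nat) (E : set 'rV[R]_d) (s : R) :
  0 <= s -> (s%:E < hausdorff_dim E)%E ->
  exists delta c, [/\ 0 < delta, 0 < c &
    forall U, delta_cover delta E U -> (c%:E <= \sum_(0 <= i <oo) diam_pow s (U i))%E].
Proof.
move=> s0 hs; apply: contrapT => H.
have dp0 (U : set 'rV[R]_d) : (0 <= diam_pow s U)%E.
  by rewrite /diam_pow; case: ifP => // _; apply: poweR_ge0.
move: hs; apply/negP; rewrite -leNgt; apply: ereal_inf_lbound; exists s => //; split=> //.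
apply/eqP; rewrite eq_le; apply/andP; split.
  apply: ge_ereal_sup => _ [delta /= d0 <-].
  rewrite leNgt; apply/negP => hpos.
  have [c c0 hc] : exists2 c : R, 0 < c & (c%:E <= hausdorff_delta_measure s delta E)%E.
    move: hpos; case: (hausdorff_delta_measure s delta E) => [r| |] //.
      by rewrite lte_fin => r0; exists r.
    by move=> _; exists 1; rewrite ?leey.
  apply: H; exists delta, c; split=> // U hU; apply: le_trans hc _.
  by apply: ereal_inf_lbound; exists U.
apply: (@le_trans _ _ (hausdorff_delta_measure s 1 E)).
  apply: le_ereal_inf_tmp => _ [U _ <-]; apply: nneseries_ge0 => *; exact: dp0.
by apply: ereal_sup_ubound; exists 1 => //=.
Qed.

(** The factor [d.+1] is a crude bound for the square root of [d], positive also for [d = 0]. *)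
Lemma diam_pow_le (R : realType) (d : nat) (s l : R) (U : set 'rV[R]_d) : 0 <= s -> 0 <= l ->
  (forall x y, U x -> U y -> forall i, `|x 0 i - y 0 i| <= l) ->
  (diam U <= (d.+1%:R * l)%:E)%E /\ (diam_pow s U <= ((d.+1%:R * l) `^ s)%:E)%E.
Proof.
move=> s0 l0 hU.
have en x y : U x -> U y -> enorm (x - y) <= d.+1%:R * l.
  move=> Ux Uy; rewrite /enorm -[leRHS]ger0_norm ?mulr_ge0 // -sqrtr_sqr ler_sqrt ?sqr_ge0 //.
  apply: (@le_trans _ _ (\sum_(i < d) l ^+ 2)).
    apply: ler_sum => i _; rewrite -expr2 !mxE -(real_normK (num_real _)) ler_sqr ?nnegrE //.
    exact: hU.
  rewrite sumr_const card_ord -[leLHS]mulr_natl exprMn ler_wpM2r ?sqr_ge0 //.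
  by rewrite -natrX ler_nat expnS expn1; lia.
have dU : (diam U <= (d.+1%:R * l)%:E)%E.
  by apply: ge_ereal_sup => _ [[x y] /= [Ux Uy] <-]; rewrite lee_fin; apply: en.
split=> //; rewrite /diam_pow; case: ifPn => [_|/set0P[x Ux]]; first by rewrite lee_fin powR_ge0.
rewrite -poweR_EFin; apply: gt0_ler_poweR => //; rewrite in_itv /= leey andbT.
  apply: le_trans (_ : (enorm (x - x))%:E <= _)%E; first by rewrite lee_fin sqrtr_ge0.
  by apply: ereal_sup_ubound; exists (x, x).
by rewrite lee_fin mulr_ge0.
Qed.

Lemma powR_half_exp (R : realType) (s : R) (k : nat) :
  (2^-1 ^+ k) `^ s = (2 `^ (- s)) ^+ k.
Proof.
elim: k => [|k IH]; first by rewrite !expr0 powR1.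
rewrite !exprS powRM ?exprn_ge0 // IH; congr (_ * _).
have p0 : 2 `^ s != 0 :> R by rewrite gt_eqF // powR_gt0.
apply: (mulIf p0); rewrite -powRM // powRN mulVf // mulVf // powR1 //.
Qed.

(** The total mass dominates the sum of [sg ^+ (n - j)] over a cover of [E] by saturated cubes,
    which up to [Kc] is the sum of the [s]-th powers of their diameters. A small total mass would
    thus contradict the positive Hausdorff content. The constant [c] is uniform in [n]. *)
Lemma frostman (R : realType) (d : nat) (E : set 'rV[R]_d) (s B : R) :
  0 < s -> 0 < B -> (forall x i, E x -> `|x 0 i| < B) -> (s%:E < hausdorff_dim E)%E ->
  exists2 c : R, 0 < c & forall n, exists m : {ffun 'I_d -> 'I_(2 ^ n)} -> R,
  [/\ forall Y, 0 <= m Y,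
     forall Y, m Y != 0 -> exists2 x, E x & forall i,
       0 <= x 0 i - grid_pt R d n B Y i < 2 * B / (2 ^ n)%:R,
     forall j Y, (j <= n)%N -> cube_mass R d _ m j Y <= (2 `^ (- s)) ^+ (n - j) &
     c <= \sum_Y m Y].
Proof.
move=> s0 B0 hB hdim.
have [delta [c0 [d0 c00 hcov]]] := hausdorff_content_gt0 R d E s (ltW s0) hdim.
pose Kc : R := (d.+1%:R * (2 * B)) `^ s.
have Kc0 : 0 < Kc by rewrite powR_gt0 // !mulr_gt0.
set sg : R := 2 `^ (- s).
have sg0 : 0 < sg by rewrite powR_gt0.
have sg1 : sg <= 1.
  by rewrite /sg powRN invf_le1 ?powR_gt0 // -{1}(powRr0 2) ler_powR ?ler1n // ltW.
pose c1 := Num.min (delta `^ s) c0 / (2 * Kc).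
have m0 : 0 < Num.min (delta `^ s) c0 by rewrite lt_min powR_gt0.
have c10 : 0 < c1 by rewrite divr_gt0 // mulr_gt0.
exists c1 => // n; set N := (2 ^ n)%N.
have N0 : 0 < (N%:R : R) by rewrite ltr0n expn_gt0.
pose P (Y : {ffun 'I_d -> 'I_N}) : bool := `[< exists2 x, E x & forall i,
       0 <= x 0 i - grid_pt R d n B Y i < 2 * B / N%:R >].
have [m [mpos mP mle msat]] := dyadic_flow R d n P sg sg0 sg1.
exists m; split=> //; first by move=> Y /mP /asboolP.
have [C [Ccov Cle]] := saturated_cover R d n P sg m mpos msat.
rewrite leNgt; apply/negP => small.
pose sz (c : 'I_n.+1 * {ffun 'I_d -> 'I_N}) : R := 2 * B * (2 ^ c.1)%:R / N%:R.
have sz0 c : 0 <= sz c by rewrite /sz !mulr_ge0 ?invr_ge0 // ltW.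
pose cube (c : 'I_n.+1 * {ffun 'I_d -> 'I_N}) : set 'rV[R]_d :=
  [set x | forall i, 0 <= x 0 i - (- B + 2 * B * (c.2 i %/ 2 ^ c.1 * 2 ^ c.1)%N%:R / N%:R) < sz c].
have szE c : (d.+1%:R * sz c) `^ s = Kc * sg ^+ (n - c.1).
  have cn : (c.1 <= n)%N by rewrite -ltnS.
  have -> : d.+1%:R * sz c = (d.+1%:R * (2 * B)) * 2^-1 ^+ (n - c.1).
    have e (k : nat) : (k <= n)%N -> N%:R = 2 ^+ (n - k) * 2 ^+ k :> R.
      by move=> kn; rewrite /N natrX -exprD subnK.
    by rewrite /sz (e _ cn) natrX exprVn; field; rewrite !expf_neq0.
  rewrite powRM ?mulr_ge0 ?exprn_ge0 // ?ltW // -/Kc; congr (_ * _).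
  exact: powR_half_exp.
have cubeP c : (diam (cube c) <= (d.+1%:R * sz c)%:E)%E /\ (diam_pow s (cube c) <= (Kc * sg ^+ (n - c.1))%:E)%E.
  rewrite -szE; apply: diam_pow_le => //; first exact: ltW.
  by move=> x y hx hy i; have := hx i; have := hy i; rewrite ler_norml; lra.
pose g c : R := Kc * sg ^+ (n - (c : 'I_n.+1 * {ffun 'I_d -> 'I_N}).1).
have g0 c : 0 < g c by rewrite mulr_gt0 // exprn_gt0.
have gsum : \sum_(c in C) g c < Num.min (delta `^ s) c0.
  rewrite -mulr_sumr; apply: (@le_lt_trans _ _ (Kc * \sum_Y m Y)); first by rewrite ler_pM2l.
  apply: (@lt_trans _ _ (Kc * c1)); first by rewrite ltr_pM2l.
  have -> : Kc * c1 = Num.min (delta `^ s) c0 / 2 by rewrite /c1; field; rewrite gt_eqF.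
  lra.
move: gsum; rewrite lt_min => /andP[gsum1 gsum2].
have gle c : c \in C -> g c < delta `^ s.
  move=> cC; apply: le_lt_trans gsum1; rewrite (bigD1 c) //= lerDl sumr_ge0 // => *; exact: ltW.
have exC i : (i < size (enum C))%N -> exists c, c \in C.
  by case e: (enum C) => [|c l] // _; exists c; rewrite -mem_enum e mem_head.
pose U i := nth set0 [seq cube c | c <- enum C] i.
have hU : delta_cover delta E U.
  split=> [x Ex|i].
    have cell i : exists q : 'I_N, 0 <= x 0 i - (- B + 2 * B * q%:R / N%:R) < 2 * B / N%:R.
      have /ltr_normlP[h1 h2] := hB x i Ex.
      have y0 : 0 <= (x 0 i + B) * N%:R / (2 * B) by rewrite !mulr_ge0 ?invr_ge0 //; lra.
      have /andP[q1 q2] := truncn_itv y0.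
      have ql : (Num.truncn ((x 0 i + B) * N%:R / (2 * B))%R < N)%N.
        rewrite -(ltr_nat R); apply: le_lt_trans q1 _.
        rewrite ltr_pdivrMr ?mulr_gt0 // mulrC ltr_pM2l //; lra.
      exists (Ordinal ql) => /=.
      move: q1 q2; rewrite -[(Num.truncn _).+1%:R]natr1 ler_pdivlMr ?ltr_pdivrMr ?mulr_gt0 //.
      move: ((Num.truncn _)%:R) => q q1 q2.
      have -> : x 0 i - (- B + 2 * B * q / N%:R) = ((x 0 i + B) * N%:R - q * (2 * B)) / N%:R.
        by field; rewrite gt_eqF.
      apply/andP; split; first by rewrite divr_ge0 ?subr_ge0 // ltW.
      by rewrite ltr_pM2r ?invr_gt0 //; lra.
    pose Y : {ffun 'I_d -> 'I_N} := [ffun i => xchoose (cell i)].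
    have YP i : 0 <= x 0 i - (- B + 2 * B * (Y i)%:R / N%:R) < 2 * B / N%:R.
      by rewrite /Y ffunE; exact: (xchooseP (cell i)).
    have PY : P Y by apply/asboolP; exists x.
    have [c cC /forallP cY] := Ccov Y PY.
    exists (index c (enum C)) => //.
    rewrite /U (nth_map c) ?index_mem ?mem_enum // nth_index ?mem_enum // => i.
    have /eqP e := cY i; rewrite /sz e.
    have b1 : (Y i %/ 2 ^ c.1 * 2 ^ c.1)%N%:R <= (Y i)%:R :> R by rewrite ler_nat leq_trunc_div.
    have b2 : (Y i)%:R + 1 <= (Y i %/ 2 ^ c.1 * 2 ^ c.1)%N%:R + (2 ^ c.1)%:R :> R.
      by rewrite natr1 -natrD ler_nat -mulSnr ltn_ceil // expn_gt0.
    have BN : 0 < 2 * B / N%:R by rewrite divr_gt0 // mulr_gt0.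
    have fin (f a b l y : R) : 0 < f -> a <= b -> b + 1 <= a + l ->
        0 <= y - (- B + f * b) < f -> 0 <= y - (- B + f * a) < f * l.
      move=> f0 ab bl /andP[y1 y2]; have := ler_wpM2l (ltW f0) ab; have := ler_wpM2l (ltW f0) bl.
      by rewrite !mulrDr mulr1 => ? ?; apply/andP; split; lra.
    have := YP i; rewrite ![2 * B * _ / _]mulrAC; exact: fin.
  rewrite /U; case: (ltnP i (size (enum C))) => h; last first.
    rewrite nth_default ?size_map // /diam ge_ereal_sup //.
    by move=> y [[a b] /= [[]]].
  have [c0' _] := exC _ h.
  rewrite (nth_map c0') //; set c := nth _ _ _.
  have cC : c \in C by rewrite -mem_enum mem_nth.
  have [dc _] := cubeP c; apply: le_trans dc _; rewrite lee_fin.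
  rewrite leNgt; apply/negP => lt.
  have := gle c cC; rewrite /g -szE; apply/negP; rewrite -leNgt.
  by apply: ge0_ler_powR; rewrite ?nnegrE ?mulr_ge0 // ltW.
have := hcov U hU; apply/negP; rewrite -ltNge.
apply: (@le_lt_trans _ _ (\sum_(c in C) g c)%:E); last by rewrite lte_fin.
apply: lime_le.
  apply: is_cvg_nneseries => k _ _; rewrite /diam_pow; case: ifP => // _; exact: poweR_ge0.
apply: nearW => k.
apply: (@le_trans _ _ (\sum_(0 <= i < k) (nth 0 [seq g c | c <- enum C] i)%:E)%E).
  apply: lee_sum => i _; rewrite /U; case: (ltnP i (size (enum C))) => h; last first.
    by rewrite !nth_default ?size_map // /diam_pow eqxx.
  have [c0' _] := exC _ h.
  by rewrite !(nth_map c0') //; have [] := cubeP (nth c0' (enum C) i).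
rewrite sumEFin lee_fin; apply: le_trans (sum_nth_le _ _ _ _) _.
  by move=> x /mapP[c _ ->]; apply: ltW.
by rewrite big_map big_enum.
Qed.

(** * Decay of the incidence coefficients *)

Definition restr_mass (R : realType) (d n : nat) (m : {ffun 'I_d -> 'I_(2 ^ n)} -> R)
  (Q : pred {ffun 'I_d -> 'I_(2 ^ n)}) (Y : {ffun 'I_d -> 'I_(2 ^ n)}) : R :=
  if Q Y then m Y else 0.

(* Division by the [i0]-th coordinate makes the incidence relation affine in
   the second point with linear part [x / x i0], whose [i0]-th entry is 1. *)
Definition incidence (R : realType) (d n : nat) (B S : R) (i0 : 'I_d) (t : R)
  (Y Y' : {ffun 'I_d -> 'I_(2 ^ n)}) : R :=
  (t - \sum_i grid_pt R d n B Y i * grid_pt R d n B Y' i) / (S * grid_pt R d n B Y i0).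

Definition incidence_coef (R : realType) (d n : nat) (B S : R) (i0 : 'I_d) (t : R)
  (a : {ffun 'I_d -> 'I_(2 ^ n)} -> R) (l : nat) : R :=
  \sum_Y \sum_Y' a Y * a Y' * cos (2 * pi * l%:R * incidence R d n B S i0 t Y Y').

Lemma sum_mass_le1 (R : realType) (d n : nat) (m : {ffun 'I_d -> 'I_(2 ^ n)} -> R) (sg : R) :
  (forall j Y, (j <= n)%N -> cube_mass R d _ m j Y <= sg ^+ (n - j)) -> \sum_Y m Y <= 1.
Proof.
move=> h; have Y0 : {ffun 'I_d -> 'I_(2 ^ n)}.
  by have p : (0 < 2 ^ n)%N; [rewrite expn_gt0 | exact: [ffun=> Ordinal p]].
have := h n Y0 (leqnn n); rewrite subnn expr0; apply: le_trans.
rewrite /cube_mass le_eqVlt; apply/orP; left; apply/eqP; apply: eq_bigl => Y.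
by apply/esym/forallP => i; rewrite !divn_small.
Qed.

Lemma grid_pt_bound (R : realType) (d n : nat) (B : R) Y i :
  0 < B -> `|grid_pt R d n B Y i| <= B.
Proof.
move=> B0; have N0 : 0 < ((2 ^ n)%:R : R) by rewrite ltr0n expn_gt0.
have h : (Y i)%:R / (2 ^ n)%:R <= 1 :> R.
  by rewrite ler_pdivrMr // mul1r ler_nat ltnW.
have h0 : 0 <= (Y i)%:R / (2 ^ n)%:R :> R by rewrite divr_ge0.
rewrite /grid_pt -mulrA; move: h h0; move: (_ / _) => q h h0.
by rewrite ler_norml; apply/andP; split; nra.
Qed.

Lemma lattice_gap (p q f s g c : nat) : (0 < g)%N -> (0 < c)%N ->
  `|(2 * p%:Z - 2 * q%:Z) * (c * g)%N%:Z| < (2 * (f * s) * g)%N%:Z -> (p <= q + s * f)%N.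
Proof.
move=> g0 c0; rewrite ltr_norml => /andP[_ h]; rewrite leqNgt; apply/negP => lt.
have [r er] : exists r, p = (q + s * f + 1 + r)%N by exists (p - (q + s * f + 1))%N; lia.
move: h; rewrite er {er lt p}; case: c c0 => // c _; case: g g0 => // g _; nia.
Qed.

Lemma norm_double_lt (x y : int) : `|(-2) * x| < y -> `|x| < y.
Proof. lia. Qed.

Lemma dist_le_double (R : realFieldType) (a b z e : R) :
  `|a - z| <= e -> `|b - z| <= e -> `|a - b| <= 2 * e.
Proof. by rewrite !ler_norml; lra. Qed.

Lemma lattice_size (f y N s w : nat) : (y < N)%N -> (f <= 2)%N -> (4 <= s)%N ->
  `|- (f%:Z * (2 * y%:Z - N%:Z) * w%:Z)| * 4 <= (2 * N * s * w)%N%:Z.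
Proof.
move=> yN f2 s4; rewrite normrN normrM [leRHS]PoszM (ger0_norm (x := w%:Z)) // mulrAC ler_wpM2r //.
move: yN f2 s4; clear; case: f => [|[|[|f]]] // yN _ s4; nia.
Qed.

(** Recovers the dividing coordinate from [r]. The loss is proportional to [1 / t], which is why [t]
    has to stay away from 0. *)
Lemma inv_close (R : realFieldType) (t S B x y e : R) : 0 < t -> 0 < S ->
  x != 0 -> y != 0 -> `|x| <= B -> `|y| <= B ->
  `|t / (S * x) - t / (S * y)| <= e -> `|x - y| <= e * (B ^+ 2 * S / t).
Proof.
move=> t0 S0 x0 y0 xB yB h.
have -> : x - y = - ((t / (S * x) - t / (S * y)) * (x * y * S / t)).
  by field; rewrite x0 y0 !gt_eqF.
rewrite normrN normrM ler_pM // !normrM normfV (gtr0_norm t0) (gtr0_norm S0) ler_pM2r ?invr_gt0 //.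
by rewrite ler_pM2r // expr2 ler_pM.
Qed.

(** Recovers the other coordinates from the quotients [u] once the dividing coordinate is known. *)
Lemma ratio_close (R : realFieldType) (B a b x y e : R) :
  x != 0 -> y != 0 -> `|x| <= B -> `|b| <= 3 / 2 * `|y| ->
  `|a / (2 * x) - b / (2 * y)| <= e -> `|a - b| <= e * (2 * B) + 3 / 2 * `|x - y|.
Proof.
move=> x0 y0 xB bB h.
have -> : a - b = (a / (2 * x) - b / (2 * y)) * (2 * x) + (b / y) * (x - y).
  by field; rewrite x0 y0.
apply: le_trans (ler_normD _ _) _; apply: lerD.
  by rewrite normrM ler_pM // normrM ger0_norm // ler_pM2l.
rewrite normrM ler_wpM2r // normrM normfV ler_pdivrMr ?normr_gt0 //.
Qed.

(* [block_bound] applies with [r = t / (S * x i0)], [u = x / (2 * x i0)],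
   [z = - 2 * y / S] and [h = - y i0 / S], the last two being multiples of
   [1 / M] with [M] divisible by every frequency of the block. *)
Lemma block_decay (R : realType) (n0 n : nat) (i0 : 'I_n0.+1) (B tau t sg kap X1 : R) (S0 w1 : nat)
    (m : {ffun 'I_n0.+1 -> 'I_(2 ^ n)} -> R) (Q : pred {ffun 'I_n0.+1 -> 'I_(2 ^ n)}) (l : nat)
    (S := 2 * B * S0%:R) (a := restr_mass R _ n m Q) :
  0 < B -> 0 < tau -> (4 <= S0)%N -> 0 < sg ->
  (forall Y, 0 <= m Y) ->
  (forall j Y, (j <= n)%N -> cube_mass R _ _ m j Y <= sg ^+ (n - j)) ->
  (forall Y, Q Y -> tau <= `|grid_pt R _ n B Y i0|) ->
  (forall Y i, Q Y -> `|grid_pt R _ n B Y i| <= 3 / 2 * `|grid_pt R _ n B Y i0|) ->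
  0 < t -> t < S * tau -> 2 + 2 * B * S / t <= w1%:R ->
  0 <= X1 -> 0 <= kap ->
  (2 * w1 + 3)%:R ^+ n0.+1 * (2 * S0 + 3)%:R ^+ n0.+1 * (64 * n0.+1%:R * 4) *
     (32 * n0.+1%:R) ^+ n0 * (64 * n0.+1%:R) ^+ n0.+1 <= X1 ^+ 2 ->
  sg ^+ 2 * 2 ^+ n0.+2 <= kap ^+ 2 -> (l <= n)%N ->
  \sum_(i < 2 ^ l) `|incidence_coef R _ n B S i0 t a (2 ^ l + i)| <= 2 * X1 * kap ^+ l.
Proof.
move=> B0 tau0 S04 sg0 m0 mle Q1 Q2 t0 tS hw1 X10 kap0 hX1 hkap ln.
pose L := (2 ^ l)%N; have L0 : (0 < L)%N by rewrite expn_gt0.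
have S00 : (0 < S0)%N := leq_trans (isT : 0 < 4)%N S04.
have S0r : 4 <= S0%:R :> R by rewrite (ler_nat R 4).
have Sp : 0 < S by rewrite /S !mulr_gt0 // ltr0n.
(* [F] makes every frequency below [2 * L] divide [M]. As [M = 2 ^ n.+1 * S0 * w], the quotient
   [x Y i / S] is an integer multiple of [w / M]. *)
pose F := ((2 * L)`!)%N; have F0 : (0 < F)%N by rewrite fact_gt0.
have [K KE] : exists K, K = (2 ^ n.+1 * S0 * F)%N by eexists.
have [M ME] : exists M, M = (64 * n0.+1 * L * K)%N by eexists.
have [w wE] : exists w, w = (64 * n0.+1 * L * F)%N by eexists.
have w0 : (0 < w)%N by rewrite wE muln_gt0 F0 andbT muln_gt0 L0.
have Mw : M = (2 ^ n.+1 * S0 * w)%N by rewrite ME KE wE; ring.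
have K0 : (0 < K)%N by rewrite KE muln_gt0 F0 andbT muln_gt0 expn_gt0 S00.
have M0r : 0 < (M%:R : R) by rewrite ltr0n ME muln_gt0 K0 andbT muln_gt0 L0.
have dvM lam : (L <= lam < 2 * L)%N -> (lam %| M)%N.
  move=> /andP[l1 l2]; rewrite ME KE; apply: dvdn_mull; apply: dvdn_mull.
  by apply: dvdn_fact; rewrite (leq_trans L0 l1) ltnW.
pose x (Y : {ffun 'I_n0.+1 -> 'I_(2 ^ n)}) i := grid_pt R _ n B Y i.
pose H (Y : {ffun 'I_n0.+1 -> 'I_(2 ^ n)}) : int := - ((2 * (Y i0 : nat)%:Z - (2 ^ n)%:Z) * w%:Z).
pose Z (Y : {ffun 'I_n0.+1 -> 'I_(2 ^ n)}) : {ffun 'I_n0 -> int} :=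
  [ffun k => - (2 * (2 * (Y (lift i0 k) : nat)%:Z - (2 ^ n)%:Z) * w%:Z)].
pose r (Y : {ffun 'I_n0.+1 -> 'I_(2 ^ n)}) : R := if Q Y then t / (S * x Y i0) else 0.
pose u (Y : {ffun 'I_n0.+1 -> 'I_(2 ^ n)}) (k : 'I_n0) : R :=
  if Q Y then x Y (lift i0 k) / (2 * x Y i0) else 0.
have a0 Y : 0 <= a Y by rewrite /a /restr_mass; case: ifP.
have am Y : a Y <= m Y by rewrite /a /restr_mass; case: ifP.
have sa1 : \sum_Y a Y <= 1.
  by apply: le_trans (sum_mass_le1 R _ n m sg mle); apply: ler_sum.
have sa0 : 0 <= \sum_Y a Y by apply: sumr_ge0.
have xn0 Y : Q Y -> x Y i0 != 0.
  by move=> /Q1 h; rewrite -normr_gt0; apply: lt_le_trans h.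
have yE Y i : x Y i / S = (2 * (Y i : nat)%:Z - (2 ^ n)%:Z)%:~R * w%:R / M%:R.
  rewrite /x /grid_pt /S Mw !natrM expnS natrM rmorphB rmorphM /=.
  rewrite -[(Y i : nat)%:~R]/((Y i)%:R) -[(2 ^ n)%N%:~R]/((2 ^ n)%:R).
  have wr : (w%:R : R) != 0 by rewrite pnatr_eq0 -lt0n.
  have Sn : (S0%:R : R) != 0 by rewrite pnatr_eq0 -lt0n.
  have Nn : ((2 ^ n)%:R : R) != 0 by rewrite pnatr_eq0 -lt0n expn_gt0.
  move: (w%:R) wr ((2 ^ n)%:R) Nn (S0%:R) Sn => w' ? N' ? S' ?.
  by field; apply/and4P; split=> //; rewrite gt_eqF.
have incE Y Y' : Q Y -> incidence R _ n B S i0 t Y Y' =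
   r Y + \sum_k u Y k * ((Z Y' k)%:~R / M%:R) + (H Y')%:~R / M%:R.
  move=> QY; rewrite /incidence /r /u QY (bigD1_ord i0) //=.
  have -> : (H Y')%:~R / M%:R = - (x Y' i0 / S) :> R.
    by rewrite yE /H rmorphN rmorphM /= -[w%:~R]/(w%:R) mulNr.
  have -> : \sum_k x Y (lift i0 k) / (2 * x Y i0) * ((Z Y' k)%:~R / M%:R) =
     - (\sum_k x Y (lift i0 k) * x Y' (lift i0 k)) / (S * x Y i0) :> R.
    rewrite mulNr mulr_suml -sumrN; apply: eq_bigr => k _.
    have -> : (Z Y' k)%:~R / M%:R = - 2 * (x Y' (lift i0 k) / S) :> R.
      by rewrite yE /Z ffunE rmorphN !rmorphM /= -[w%:~R]/(w%:R); ring.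
    by field; rewrite xn0 // gt_eqF.
  rewrite -/(x Y i0) -/(x Y' i0); field; by rewrite xn0 // gt_eqF.
pose A : R := (2 * S0 + 3)%:R ^+ n0.+1 * sg ^+ l.
pose A' : R := (2 * w1 + 3)%:R ^+ n0.+1 * sg ^+ l.
have sgl : 0 < sg ^+ l by rewrite exprn_gt0.
have A0 : 0 <= A by rewrite mulr_ge0 ?exprn_ge0 // ltW.
have A'0 : 0 <= A' by rewrite mulr_ge0 ?exprn_ge0 // ltW.
have nl : (2 ^ n = 2 ^ (n - l) * L)%N by rewrite /L -expnD subnK.
have mle' Y : cube_mass R _ _ m (n - l) Y <= sg ^+ l.
  by have := mle (n - l)%N Y (leq_subr _ _); rewrite subKn.
have key (S1 : pred {ffun 'I_n0.+1 -> 'I_(2 ^ n)}) (w' : nat) (Y : {ffun 'I_n0.+1 -> 'I_(2 ^ n)}) :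
   (forall Y', S1 Y' -> Q Y' -> forall i, (Y' i <= Y i + w' * 2 ^ (n - l))%N /\ (Y i <= Y' i + w' * 2 ^ (n - l))%N) ->
   \sum_(Y' | S1 Y') a Y' <= (2 * w' + 3)%:R ^+ n0.+1 * sg ^+ l.
  move=> hS; apply: (le_trans _ (near_mass_le R _ _ m (n - l) w' _ Y m0 mle')).
  rewrite big_mkcond [leRHS]big_mkcond; apply: ler_sum => Y' _.
  case: ifP => SY; last by case: ifP.
  rewrite /a /restr_mass; case: ifP => QY; last by case: ifP.
  rewrite ifT //; apply/forallP => i; have [h1 h2] := hS Y' SY QY i.
  by rewrite h1 h2.
(* By the choice of [K] and [w], points in a common box differ by at most [S0] cubes of level [l] in
   each coordinate. *)
have hA j : \sum_(i | (`|H i - H j| < K%:Z) && [forall k, `|Z i k - Z j k| < K%:Z]) a i <= A.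
  apply: key => Y' /andP[h1 /forallP h2] _ i.
  have fin (p q : nat) : `|(2 * p%:Z - 2 * q%:Z) * w%:Z| < K%:Z -> (p <= q + S0 * 2 ^ (n - l))%N.
    have -> : K = (2 * (2 ^ (n - l) * S0) * (L * F))%N by rewrite KE expnS nl; ring.
    have -> : (w = 64 * n0.+1 * (L * F))%N by rewrite wE; ring.
    by apply: lattice_gap; rewrite ?muln_gt0 ?L0.
  have fin2 (p q : nat) : `|(2 * p%:Z - 2 * q%:Z) * w%:Z| < K%:Z ->
      (p <= q + S0 * 2 ^ (n - l))%N /\ (q <= p + S0 * 2 ^ (n - l))%N.
    move=> h; split; apply: fin => //.
    by rewrite -normrN -mulNr opprB.
  case: (unliftP i0 i) => [k ->|->]; apply: fin2.
    have := h2 k; rewrite /Z !ffunE; move: (Posz (2 ^ n)%N) => N.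
    rewrite (_ : _ - _ = (-2) * ((2 * (Y' (lift i0 k) : nat)%:Z - 2 * (j (lift i0 k) : nat)%:Z) * w%:Z)); last by ring.
    exact: norm_double_lt.
  move: h1; rewrite /H -normrN; move: (Posz (2 ^ n)%N) => N.
  by rewrite (_ : - (_ - _) = ((2 * (Y' i0 : nat)%:Z - 2 * (j i0 : nat)%:Z) * w%:Z)); last by ring.
pose J := (32 * n0.+1 * L)%N.
have J0r : 0 < (J%:R : R) by rewrite ltr0n !muln_gt0 L0.
have hA' j : \sum_(i | (`|r i - r j| <= J%:R^-1) && [forall k, `|u i k - u j k| <= J%:R^-1]) a i <= A'.
  (* [j] may lie outside [Q], where [r] and [u] have the default value 0; the neighbourhood is
     recentred at one of its points [Y1] in [Q], which doubles the radius to [2 / J]. *)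
  case: (pickP (fun i => (`|r i - r j| <= J%:R^-1) && [forall k, `|u i k - u j k| <= J%:R^-1] && Q i))
    => [Y1 /andP[/andP[r1 /forallP u1] QY1]|none]; last first.
    rewrite big1 // => Y hY; rewrite /a /restr_mass; case: ifP => // QY.
    by have := none Y; rewrite hY QY.
  apply: (key _ w1 Y1) => Y' /andP[r2 /forallP u2] QY'.
  have rr : `|t / (S * x Y' i0) - t / (S * x Y1 i0)| <= 2 / J%:R.
    by move: r1 r2; rewrite /r QY1 QY' => r1 r2; apply: dist_le_double r2 r1.
  have xb Y i : `|x Y i| <= B by apply: grid_pt_bound.
  have xc := inv_close R _ _ _ _ _ _ t0 Sp (xn0 _ QY') (xn0 _ QY1) (xb Y' i0) (xb Y1 i0) rr.
  have bst : 0 <= B ^+ 2 * S / t by rewrite !mulr_ge0 ?invr_ge0 ?sqr_ge0 // ltW.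
  have Ji : 0 < (J%:R^-1 : R) by rewrite invr_gt0.
  (* The origin of [w1]: the coordinate [i0] is known up to [2 * ga] and the others up to
     [4 * be + 3 * ga], while [4 * be + 4 * ga] is [2 * B * (2 + 2 * B * S / t) / J]. *)
  have fin i : `|x Y' i - x Y1 i| <= 2 * B * w1%:R / J%:R.
    have h1 : 2 * B * (2 + 2 * B * S / t) / J%:R <= 2 * B * w1%:R / J%:R.
      by rewrite ler_pM2r // ler_pM2l // mulr_gt0.
    apply: le_trans h1.
    pose be := B / J%:R; pose ga := B ^+ 2 * S / t / J%:R.
    have be0 : 0 <= be by rewrite divr_ge0 // ltW.
    have ga0 : 0 <= ga by rewrite mulr_ge0 // ltW.
    have -> : 2 * B * (2 + 2 * B * S / t) / J%:R = 4 * be + 4 * ga by rewrite /be /ga; ring.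
    have {}xc : `|x Y' i0 - x Y1 i0| <= 2 * ga by apply: le_trans xc _; rewrite /ga mulrAC mulrA.
    case: (unliftP i0 i) => [k ->|->]; last first.
      by apply: le_trans xc _; move: be0 ga0; move: be ga => be ga; clear; lra.
    have uu : `|x Y' (lift i0 k) / (2 * x Y' i0) - x Y1 (lift i0 k) / (2 * x Y1 i0)| <= 2 / J%:R.
      by move: (u1 k) (u2 k); rewrite /u QY1 QY' => h2 h3; apply: dist_le_double h3 h2.
    apply: le_trans (ratio_close R B _ _ _ _ _ (xn0 _ QY') (xn0 _ QY1) (xb Y' i0) (Q2 Y1 (lift i0 k) QY1) uu) _.
    have -> : 2 / J%:R * (2 * B) = 4 * be by rewrite /be; ring.
    by move: xc be0 ga0; move: (`|_|) be ga => q be ga; clear; lra.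
  move=> i; have := fin i.
  have N0 : 0 < ((2 ^ n)%:R : R) by rewrite ltr0n expn_gt0.
  have -> : x Y' i - x Y1 i = 2 * B * (((Y' i)%:R - (Y1 i)%:R) / (2 ^ n)%:R).
    by rewrite /x /grid_pt; ring.
  rewrite normrM gtr0_norm ?mulr_gt0 // -[2 * B * w1%:R / _]mulrA ler_pM2l ?mulr_gt0 //.
  rewrite normrM normfV (gtr0_norm N0) ler_pdivrMr // => h.
  have {}h : `|(Y' i)%:R - (Y1 i)%:R| <= (w1 * 2 ^ (n - l))%:R :> R.
    apply: le_trans h _; rewrite -mulrA natrM ler_wpM2l // mulrC ler_pdivrMr //.
    rewrite -natrM ler_nat {1}nl leq_mul2l /J; apply/orP; right.
    by rewrite leq_pmull.
  by move: h; rewrite ler_norml lerNl lerBlDr opprB lerBlDr -!natrD !ler_nat addnC [(_ * _ + _)%N]addnC => /andP[].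
pose s i := incidence_coef R _ n B S i0 t a i.
(* Signs turn the sum of absolute values into a linear form with coefficients bounded by 1. *)
pose c (i : 'I_L) : R := Num.sg (s (L + i)%N).
have -> : \sum_(i < 2 ^ l) `|s (2 ^ l + i)%N| = \sum_(i < L) c i *
  (\sum_Y \sum_Y' a Y * a Y' *
     cos (2 * pi * (L + i)%:R * (r Y + \sum_k u Y k * ((Z Y' k)%:~R / M%:R) + (H Y')%:~R / M%:R))).
  apply: eq_bigr => i _; rewrite normrEsg -/L -/(c i); congr (_ * _).
  apply: eq_bigr => Y _; apply: eq_bigr => Y' _.
  case QY : (Q Y); first by rewrite incE.
  by rewrite /a /restr_mass QY !mul0r.
apply: le_trans (ler_norm _) _; rewrite -mulrA.
apply: (block_bound R _ _ n0 L M K a a r u H Z c A A') => //.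
- by move=> i; rewrite /c; case: sgrP; rewrite ?normr0 ?normrN ?normr1.
- move=> Y; rewrite /r; case: ifP => QY; last by rewrite lerN10 ltr01.
  have : `|t / (S * x Y i0)| < 1.
    rewrite normrM normfV normrM (gtr0_norm Sp) (gtr0_norm t0) ltr_pdivrMr ?mul1r.
      by apply: lt_le_trans tS _; rewrite ler_pM2l // Q1.
    by rewrite mulr_gt0 // normr_gt0 xn0.
  by rewrite ltr_norml => /andP[/ltW -> ->].
- move=> Y k; rewrite /u; case: ifP => QY; last by rewrite lerN10 ltr01.
  have : `|x Y (lift i0 k) / (2 * x Y i0)| < 1.
    have xp : 0 < `|x Y i0| by rewrite normr_gt0 xn0.
    rewrite normrM normfV normrM (ger0_norm (x := 2)) // ltr_pdivrMr ?mul1r ?mulr_gt0 //.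
    apply: le_lt_trans (Q2 Y (lift i0 k) QY) _; rewrite -/(x Y i0) ltr_pM2r //.
    by rewrite ltr_pdivrMr // -natrM ltr_nat.
  by rewrite ltr_norml => /andP[/ltW -> ->].
- by move=> Y k; rewrite /Z ffunE Mw expnS; apply: (lattice_size 2).
- by move=> Y; rewrite /H Mw expnS -[X in - (X * _)]mul1r; apply: (lattice_size 1).
- by rewrite mulr_ge0 // exprn_ge0.
- set SA := \sum_Y a Y.
  have LE : L%:R = 2 ^+ l :> R by rewrite /L natrX.
  set c1 := (2 * w1 + 3)%:R ^+ n0.+1 : R; set c2 := (2 * S0 + 3)%:R ^+ n0.+1 : R.
  (* Exponent count per level: [A] and [A'] give [sg ^+ 2], the grid in [r] gives one factor 2, and
     the large sieve gives [n0.+1] of them. *)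
  have -> : SA * (A' * ((2 * (32 * n0.+1 * L))%:R * (4 * (32 * n0.+1%:R) ^+ n0 * (64 * n0.+1%:R * L%:R) ^+ n0.+1 * A * SA)))
    = SA ^+ 2 * ((c1 * c2 * (64 * n0.+1%:R * 4) * (32 * n0.+1%:R) ^+ n0 * (64 * n0.+1%:R) ^+ n0.+1) *
       (sg ^+ 2 * 2 ^+ n0.+2) ^+ l).
    have -> : (sg ^+ 2 * 2 ^+ n0.+2) ^+ l = sg ^+ l ^+ 2 * (2 ^+ l ^+ n0.+1 * 2 ^+ l).
      by rewrite exprMn -!exprM -exprD; congr (_ ^+ _ * _ ^+ _); ring.
    rewrite /A /A' -/c1 -/c2 !natrM LE [(_ * 2 ^+ l) ^+ _]exprMn.
    move: ((64 * n0.+1%:R) ^+ n0.+1) ((32 * n0.+1%:R) ^+ n0) => p1 p2.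
    by move: (sg ^+ l) (2 ^+ l) => g p; move: (p ^+ n0.+1) => q; ring.
  have sg0' := ltW sg0.
  have c0 : 0 <= c1 * c2 * (64 * n0.+1%:R * 4) * (32 * n0.+1%:R) ^+ n0 * (64 * n0.+1%:R) ^+ n0.+1.
    by repeat first [apply: exprn_ge0 | apply: mulr_ge0 | by []].
  have k0 : 0 <= sg ^+ 2 * 2 ^+ n0.+2 by rewrite mulr_ge0 ?exprn_ge0.
  have k1 : (sg ^+ 2 * 2 ^+ n0.+2) ^+ l <= (kap ^+ l) ^+ 2.
    by rewrite -exprM mulnC exprM; apply: lerXn2r => //; rewrite nnegrE // exprn_ge0.
  rewrite [(X1 * _) ^+ 2]exprMn -[leRHS]mul1r; apply: ler_pM; first exact: sqr_ge0.
  - exact: mulr_ge0 c0 (exprn_ge0 _ k0).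
  - by rewrite expr_le1.
  - by apply: ler_pM => //; rewrite exprn_ge0.
Qed.

Lemma fejer_incidence (R : realType) (d n : nat) (B S : R) (i0 : 'I_d) (t : R)
    (a : {ffun 'I_d -> 'I_(2 ^ n)} -> R) (L : nat) : (0 < L)%N ->
  \sum_Y \sum_Y' a Y * a Y' * fejer R L (incidence R d n B S i0 t Y Y') =
  2 * (\sum_(0 <= k < L) (1 - k%:R / L%:R) * incidence_coef R d n B S i0 t a k) -
  incidence_coef R d n B S i0 t a 0.
Proof.
move=> L0.
have -> : \sum_(0 <= k < L) (1 - k%:R / L%:R) * incidence_coef R d n B S i0 t a k =
  \sum_Y \sum_Y' a Y * a Y' * \sum_(0 <= k < L) (1 - k%:R / L%:R) *
     cos (2 * pi * k%:R * incidence R d n B S i0 t Y Y').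
  rewrite (eq_bigr (fun k => \sum_Y \sum_Y' a Y * a Y' * ((1 - k%:R / L%:R) *
     cos (2 * pi * k%:R * incidence R d n B S i0 t Y Y')))); last first.
    move=> k _; rewrite /incidence_coef mulr_sumr; apply: eq_bigr => Y _.
    by rewrite mulr_sumr; apply: eq_bigr => Y' _; ring.
  rewrite exchange_big; apply: eq_bigr => Y _ /=.
  by rewrite exchange_big; apply: eq_bigr => Y' _ /=; rewrite mulr_sumr.
rewrite /incidence_coef mulr_sumr -sumrB; apply: eq_bigr => Y _.
rewrite mulr_sumr -sumrB; apply: eq_bigr => Y' _.
by rewrite fejerE // mulr0 mul0r cos0; ring.
Qed.

(** Two Fejer averages are compared. At scale [l1], pairs with [x . y] within [h] of [t] lie in the
    peak and contribute [2 ^ l1 / 4] each. At scale [l2], all pairs are [rho]-separated from [t],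
    hence off the peak; the bound [S * tau / 2] keeps the incidence value within half a period,
    where the decay of the kernel applies. *)
Lemma incidence_gap (R : realType) (n0 n : nat) (i0 : 'I_n0.+1) (B tau t sg kap X1 p h rho : R) (S0 w1 : nat)
    (m : {ffun 'I_n0.+1 -> 'I_(2 ^ n)} -> R) (Q : pred {ffun 'I_n0.+1 -> 'I_(2 ^ n)}) (l1 l2 : nat)
    (S := 2 * B * S0%:R) (a := restr_mass R _ n m Q)
    (dot := fun Y Y' => \sum_i grid_pt R n0.+1 n B Y i * grid_pt R n0.+1 n B Y' i) :
  0 < B -> 0 < tau -> (4 <= S0)%N -> 0 < sg ->
  (forall Y, 0 <= m Y) ->
  (forall j Y, (j <= n)%N -> cube_mass R _ _ m j Y <= sg ^+ (n - j)) ->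
  (forall Y, Q Y -> tau <= `|grid_pt R _ n B Y i0|) ->
  (forall Y i, Q Y -> `|grid_pt R _ n B Y i| <= 3 / 2 * `|grid_pt R _ n B Y i0|) ->
  0 < t -> t < S * tau -> 2 + 2 * B * S / t <= w1%:R ->
  0 <= X1 -> 3 / 4 <= kap -> kap < 1 ->
  (2 * w1 + 3)%:R ^+ n0.+1 * (2 * S0 + 3)%:R ^+ n0.+1 * (64 * n0.+1%:R * 4) *
     (32 * n0.+1%:R) ^+ n0 * (64 * n0.+1%:R) ^+ n0.+1 <= X1 ^+ 2 ->
  sg ^+ 2 * 2 ^+ n0.+2 <= kap ^+ 2 -> (l1 <= l2)%N -> (l2 <= n)%N ->
  h * (16 * (2 ^ l1)%:R) <= S * tau ->
  p <= \sum_Y \sum_(Y' | `|dot Y Y' - t| <= h) a Y * a Y' ->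
  0 < rho ->
  (forall Y Y', a Y != 0 -> a Y' != 0 -> rho <= `|dot Y Y' - t| <= S * tau / 2) ->
  (2 ^ l1)%:R / 4 * p <= 12 * X1 * kap ^+ l1 / (1 - kap) +
     (sin (pi * (rho / (S * B)))) ^- 2 / (2 ^ l2)%:R.
Proof.
move=> B0 tau0 S04 sg0 m0 mle Q1 Q2 t0 tS hw1 X10 k34 k1 hX1 hkap l12 l2n hh hp rho0 hsep.
have S00 : (0 < S0)%N := leq_trans (isT : 0 < 4)%N S04.
have Sp : 0 < S by rewrite /S !mulr_gt0 // ltr0n.
have a0 Y : 0 <= a Y by rewrite /a /restr_mass; case: ifP.
have am Y : a Y <= m Y by rewrite /a /restr_mass; case: ifP.
have sa1 : \sum_Y a Y <= 1.
  by apply: le_trans (sum_mass_le1 R _ n m sg mle); apply: ler_sum.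
have sa0 : 0 <= \sum_Y a Y by apply: sumr_ge0.
have aQ Y : a Y != 0 -> Q Y by rewrite /a /restr_mass; case: ifP; rewrite ?eqxx.
have kap0 : 0 <= kap by apply: le_trans k34; rewrite divr_ge0.
pose s l := incidence_coef R n0.+1 n B S i0 t a l.
pose Sf l := 2 * (\sum_(0 <= k < 2 ^ l) (1 - k%:R / (2 ^ l)%:R) * s k) - s 0%N.
have SfE l : Sf l = \sum_Y \sum_Y' a Y * a Y' * fejer R (2 ^ l) (incidence R n0.+1 n B S i0 t Y Y').
  by rewrite fejer_incidence // expn_gt0.
have diff : `|Sf l2 - Sf l1| <= 12 * X1 * kap ^+ l1 / (1 - kap).
  have -> : 12 * X1 = 6 * (2 * X1) by rewrite mulrA -natrM.
  apply: fejer_dyadic_diff => //; first by rewrite mulr_ge0.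
  move=> l ll; apply: block_decay Q1 Q2 t0 tS hw1 X10 kap0 hX1 hkap _ => //.
  by apply: leq_trans l2n; apply: ltnW.
have incn Y Y' : `|incidence R n0.+1 n B S i0 t Y Y'| = `|dot Y Y' - t| / (S * `|grid_pt R _ n B Y i0|).
  by rewrite /incidence normrM normfV normrM (gtr0_norm Sp) distrC.
have low : (2 ^ l1)%:R / 4 * p <= Sf l1.
  rewrite SfE; apply: (@le_trans _ _ ((2 ^ l1)%:R / 4 * \sum_Y \sum_(Y' | `|dot Y Y' - t| <= h) a Y * a Y')).
    by rewrite ler_wpM2l // divr_ge0.
  rewrite mulr_sumr; apply: ler_sum => Y _; rewrite mulr_sumr big_mkcond; apply: ler_sum => Y' _.
  case: ifP => hY; last by exact: mulr_ge0 (mulr_ge0 (a0 _) (a0 _)) (fejer_ge0 _ _ _).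
  case: (eqVneq (a Y) 0) => [->|aY]; first by rewrite !mul0r mulr0.
  rewrite mulrC ler_wpM2l ?mulr_ge0 //; apply: fejer_lower; first by rewrite expn_gt0.
  have xQ := Q1 Y (aQ Y aY).
  have xp : 0 < S * `|grid_pt R _ n B Y i0| by rewrite mulr_gt0 // (lt_le_trans tau0).
  rewrite incn mulrAC ler_pdivrMr // mul1r.
  apply: le_trans (_ : h * (16 * (2 ^ l1)%:R) <= _); first by apply: ler_wpM2r; [rewrite mulr_ge0|exact: hY].
  by apply: le_trans hh _; rewrite ler_pM2l.
have up : Sf l2 <= (sin (pi * (rho / (S * B)))) ^- 2 / (2 ^ l2)%:R.
  rewrite SfE; set C := _ / _.
  have C0 : 0 <= C by rewrite /C mulr_ge0 ?invr_ge0 // sqr_ge0.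
  apply: (@le_trans _ _ (\sum_Y \sum_Y' a Y * a Y' * C)).
    apply: ler_sum => Y _; apply: ler_sum => Y' _.
    case: (eqVneq (a Y) 0) => [->|aY]; first by rewrite !mul0r.
    case: (eqVneq (a Y') 0) => [->|aY']; first by rewrite !(mulr0, mul0r).
    rewrite ler_wpM2l ?mulr_ge0 //.
    have xQ := Q1 Y (aQ Y aY); have xB := grid_pt_bound R _ n B Y i0 B0.
    have x0 : 0 < `|grid_pt R _ n B Y i0| by apply: lt_le_trans xQ.
    have xp : 0 < S * `|grid_pt R _ n B Y i0| by rewrite mulr_gt0.
    have /andP[h1 h2] := hsep Y Y' aY aY'.
    apply: fejer_upper; first by rewrite expn_gt0.
    - by rewrite divr_gt0 // mulr_gt0.
    - rewrite incn; apply: ler_pM => //; [exact: ltW|by rewrite invr_ge0 mulr_ge0 // ltW|].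
      have hle := ler_wpM2l (ltW Sp) xB.
      by rewrite lef_pV2 // posrE mulr_gt0.
    - rewrite incn ler_pdivrMr //; apply: le_trans h2 _.
      have := ler_wpM2l (ltW Sp) xQ.
      by move: (S * tau) (S * _) => y z; clear; lra.
  have -> : \sum_Y \sum_Y' a Y * a Y' * C = (\sum_Y a Y) ^+ 2 * C.
    rewrite expr2 -mulrA mulr_suml; apply: eq_bigr => Y _; rewrite mulr_suml mulr_sumr.
    by apply: eq_bigr => Y' _; rewrite mulrA.
  by rewrite ler_piMl // expr_le1.
move: diff; rewrite ler_norml => /andP[h1 _].
move: low up h1; move: (_ / 4 * p) (12 * X1 * _ / _) (_ / (2 ^ l2)%:R) (Sf l1) (Sf l2) => x y z s1 s2; clear; lra.
Qed.

(** * Values of the dot product *)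

Lemma dotp_continuous (R : realType) (d : nat) : continuous (fun p : 'rV[R]_d * 'rV[R]_d => dotp p.1 p.2).
Proof.
move=> p; rewrite /dotp; apply: cvg_big => [|i _]; first exact: add_continuous.
apply: cvgM.
apply: (@continuous_comp _ _ _ fst (fun x : 'rV[R]_d => x 0 i)); [exact: cvg_fst|exact: coord_continuous].
apply: (@continuous_comp _ _ _ snd (fun x : 'rV[R]_d => x 0 i)); [exact: cvg_snd|exact: coord_continuous].
Qed.
(** The set of values [x . y] is compact, hence closed. *)
Lemma dotp_gap (R : realType) (d : nat) (E : set 'rV[R]_d) (t : R) : compact E ->
  (forall x y, E x -> E y -> dotp x y <> t) ->
  exists2 rho : R, 0 < rho & forall x y, E x -> E y -> rho <= `|dotp x y - t|.
Proof.
move=> hE ht.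
pose A : set R := (fun p : 'rV[R]_d * 'rV[R]_d => dotp p.1 p.2) @` (E `*` E).
have cA : closed A.
  apply: compact_closed; first exact: Rhausdorff.
  apply: continuous_compact; last exact: compact_setX.
  apply: continuous_subspaceT; exact: dotp_continuous.
have : nbhs t (~` A).
  apply: open_nbhs_nbhs; split; first exact: closed_openC.
  by move=> [[x y] /= [Ex Ey] e]; apply: (ht x y).
move=> /nbhs_ballP[r /= r0 hr]; exists r => // x y Ex Ey.
rewrite leNgt; apply/negP => lt; apply: (hr (dotp x y)); first by rewrite /ball /= distrC.
by exists (x, y).
Qed.

Lemma compact_coord_bound (R : realType) (d : nat) (E : set 'rV[R]_d) : compact E ->
  exists2 B : R, 0 < B & forall x i, E x -> `|x 0 i| < B.
Proof.
move=> hE; have [M M0 hM] := pinfty_ex_gt0 (compact_bounded hE).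
exists (M + 1); first by rewrite addr_gt0.
move=> x i Ex; apply: le_lt_trans (_ : M < _); last by rewrite ltrDl.
apply: le_trans (hM x Ex); rewrite [leRHS]/Num.norm /= mx_normrE.
by apply: (le_bigmax _ (fun ij : 'I_1 * 'I_d => `|x ij.1 ij.2|) (0, i)).
Qed.

Lemma expr_small (R : realType) (x e : R) : 0 <= x -> x < 1 -> 0 < e -> exists l, x ^+ l < e.
Proof.
move=> x0 x1 e0; have : `|x| < 1 by rewrite ger0_norm.
move=> /cvg_expr /cvgrPdist_lt /(_ e e0) [N _ hN]; exists N.
by have := hN N (leqnn N); rewrite /= sub0r normrN; apply: le_lt_trans; apply: ler_norm.
Qed.

Lemma half_small (R : realType) (e : R) (N : nat) : 0 < e -> exists2 l, (N <= l)%N & ((2 ^ l)%:R)^-1 < e.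
Proof.
move=> e0; exists (maxn N (Num.truncn e^-1).+1); first exact: leq_maxl.
have h := truncnS_gt e^-1.
set l := maxn _ _; have ll : ((Num.truncn e^-1).+1 <= 2 ^ l)%N.
  apply: leq_trans (ltnW (ltn_expl l (isT : 1 < 2)%N)); exact: leq_maxr.
rewrite -[ltRHS]invrK ltf_pV2 ?posrE ?invr_gt0 ?ltr0n ?expn_gt0 //.
by apply: lt_le_trans h _; rewrite ler_nat.
Qed.

Lemma nat_upper (R : realType) (x : R) (N : nat) : exists2 M, (N <= M)%N & x <= M%:R.
Proof.
exists (maxn N (Num.truncn x).+1); first exact: leq_maxl.
by apply: le_trans (ltW (truncnS_gt x)) _; rewrite ler_nat leq_maxr.
Qed.

Lemma exists_avg (R : realFieldType) (T : finType) (f : T -> R) (C : R) :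
  (0 < #|T|)%N -> C <= \sum_i f i -> exists i, C / #|T|%:R <= f i.
Proof.
move=> T0 hC; apply: contrapT => H; move: hC; apply/negP; rewrite -ltNge.
have T0r : 0 < (#|T|%:R : R) by rewrite ltr0n.
have [i0 _] : exists i, i \in T by apply/card_gt0P.
have lt i : f i < C / #|T|%:R by rewrite ltNge; apply/negP => h; apply: H; exists i.
apply: (@lt_le_trans _ _ (\sum_(i : T) C / #|T|%:R)).
  rewrite (bigD1 i0) // [ltRHS](bigD1 i0) //=; apply: ltr_leD; first exact: lt.
  by apply: ler_sum => i _; exact: ltW.
by rewrite sumr_const -[leLHS]mulr_natl mulrC divfK ?gt_eqF.
Qed.

Lemma pigeonhole_infinite (T : finType) (P : T -> nat -> Prop) (N0 : nat) :
  (forall n, (N0 <= n)%N -> exists x, P x n) ->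
  exists x, forall N, exists2 n, (N <= n)%N & P x n.
Proof.
move=> hP; apply: contrapT => H.
have hx x : exists N, forall n, (N <= n)%N -> ~ P x n.
  apply: contrapT => h; apply: H; exists x => N; apply: contrapT => h'.
  by apply: h; exists N => n Nn Pn; apply: h'; exists n.
have [f hf] := choice hx.
have [x Px] := hP (maxn N0 (\max_x f x)) (leq_maxl _ _).
by apply: (hf x _ _ Px); rewrite leq_max leq_bigmax orbT.
Qed.

(** The remaining cells lie within [2 ^ (n - l0)] cells of [Yc], whose corner is the origin;
    [near_mass_le] with [w = 1] bounds their mass, whence the base 5. *)
Lemma mass_away (R : realType) (d n l0 : nat) (m : {ffun 'I_d -> 'I_(2 ^ n)} -> R) (sg B c : R) :
  0 < B -> (forall Y, 0 <= m Y) ->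
  (forall j Y, (j <= n)%N -> cube_mass R d _ m j Y <= sg ^+ (n - j)) ->
  (l0 < n)%N -> 5%:R ^+ d * sg ^+ l0 <= c / 2 -> c <= \sum_Y m Y ->
  c / 2 <= \sum_(Y | [exists i, B / (2 ^ l0)%:R <= `|grid_pt R d n B Y i|]) m Y.
Proof.
move=> B0 m0 mle ln small big.
have n0 : (0 < n)%N by apply: leq_ltn_trans ln.
have hlt : (2 ^ n.-1 < 2 ^ n)%N by rewrite ltn_exp2l // prednK.
pose Yc : {ffun 'I_d -> 'I_(2 ^ n)} := [ffun=> Ordinal hlt].
have mle' Y : cube_mass R d _ m (n - l0) Y <= sg ^+ l0.
  by have := mle (n - l0)%N Y (leq_subr _ _); rewrite subKn // ltnW.
have := near_mass_le R d _ m (n - l0) 1 _ Yc m0 mle'; rewrite mul1n => near.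
rewrite (bigID (fun Y => [exists i, B / (2 ^ l0)%:R <= `|grid_pt R d n B Y i|])) /= in big.
suff : \sum_(Y | ~~ [exists i, B / (2 ^ l0)%:R <= `|grid_pt R d n B Y i|]) m Y <= c / 2.
  by move: big; move: (\sum_(_ | _) _) (\sum_(_ | _) _) => u v; lra.
apply: le_trans small; apply: le_trans near; rewrite big_mkcond [leRHS]big_mkcond.
apply: ler_sum => Y _; case: ifP => [|_]; last by case: ifP.
rewrite negb_exists => /forallP far; rewrite ifT //; apply/forallP => i.
have := far i; rewrite -ltNge ffunE /=.
have p2 k : 0 < ((2 ^ k)%:R : R) by rewrite ltr0n expn_gt0.
have -> : grid_pt R d n B Y i = B / (2 ^ l0)%:R * (((Y i)%:R - (2 ^ n.-1)%:R) / ((2 ^ (n - l0))%:R / 2)).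
  have e1 : (2 ^ n)%:R = (2 ^ l0)%:R * (2 ^ (n - l0))%:R :> R.
    by rewrite -natrM -expnD (subnKC (ltnW ln)).
  have e2 : (2 ^ n.-1)%:R = (2 ^ l0)%:R * (2 ^ (n - l0))%:R / 2 :> R.
    by rewrite -e1 -[in RHS](prednK n0) expnS natrM; field.
  rewrite /grid_pt e1 e2; move: (p2 l0) (p2 (n - l0)%N); move: ((2 ^ l0)%:R) ((2 ^ (n - l0))%:R) => u v u0 v0.
  by field; rewrite !gt_eqF.
rewrite normrM gtr0_norm ?divr_gt0 // gtr_pMr ?divr_gt0 // normrM normfV.
rewrite (gtr0_norm (x := _ / 2)) ?divr_gt0 // ltr_pdivrMr ?divr_gt0 // mul1r => h.
have {}h : `|(Y i)%:R - (2 ^ n.-1)%:R| <= (2 ^ (n - l0))%:R :> R.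
  by apply: le_trans (ltW h) _; rewrite ler_pdivrMr // ler_peMr // ler1n.
move: h; rewrite ler_norml lerNl lerBlDr opprB lerBlDr -!natrD !ler_nat => /andP[h1 h2].
by rewrite addnC h2 addnC h1.
Qed.

Lemma eq_divn_close (a b s : nat) : (0 < s)%N -> (a %/ s = b %/ s)%N -> (a <= b + s)%N.
Proof.
move=> s0 e; apply: ltnW; apply: leq_trans (ltn_ceil a s0) _.
by rewrite e mulSnr leq_add2r leq_trunc_div.
Qed.

(** Averaging over the cubes of level [l] gives one cube with a fixed share of the mass. It is so
    small compared with [tau] that the largest coordinate of one point dominates at all its points,
    and dot products inside it are positive; this keeps [t] away from 0. *)
Lemma cube_away (R : realType) (n0 n l : nat) (m : {ffun 'I_n0.+1 -> 'I_(2 ^ n)} -> R)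
    (B c tau : R) :
  0 < B -> 0 < c -> 0 < tau -> (forall Y, 0 <= m Y) -> (l <= n)%N ->
  2 * B / (2 ^ l)%:R <= tau / (8 * n0.+1%:R) ->
  c <= \sum_(Y | [exists i, tau <= `|grid_pt R n0.+1 n B Y i|]) m Y ->
  exists (q : {ffun 'I_n0.+1 -> 'I_(2 ^ l)}) (i0 : 'I_n0.+1),
    let Q := fun Y : {ffun 'I_n0.+1 -> 'I_(2 ^ n)} => [forall i, (Y i %/ 2 ^ (n - l))%N == q i] in
    [/\ c / #|{ffun 'I_n0.+1 -> 'I_(2 ^ l)}|%:R <= \sum_Y restr_mass R _ n m Q Y,
        forall Y, Q Y -> tau / 2 <= `|grid_pt R _ n B Y i0|,
        forall Y i, Q Y -> `|grid_pt R _ n B Y i| <= 3 / 2 * `|grid_pt R _ n B Y i0| &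
        forall Y Y', Q Y -> Q Y' ->
          tau ^+ 2 / 8 <= \sum_i grid_pt R n0.+1 n B Y i * grid_pt R n0.+1 n B Y' i].
Proof.
move=> B0 c0 tau0 m0 ln hl hc.
have p2 k : 0 < ((2 ^ k)%:R : R) by rewrite ltr0n expn_gt0.
pose x (Y : {ffun 'I_n0.+1 -> 'I_(2 ^ n)}) i := grid_pt R n0.+1 n B Y i.
have keyP (Y : {ffun 'I_n0.+1 -> 'I_(2 ^ n)}) i : (Y i %/ 2 ^ (n - l) < 2 ^ l)%N.
  by rewrite ltn_divLR ?expn_gt0 // -expnD subnKC.
pose key (Y : {ffun 'I_n0.+1 -> 'I_(2 ^ n)}) : {ffun 'I_n0.+1 -> 'I_(2 ^ l)} := [ffun i => Ordinal (keyP Y i)].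
pose P Y := [exists i, tau <= `|x Y i|].
have hc' : c <= \sum_(q : {ffun 'I_n0.+1 -> 'I_(2 ^ l)}) \sum_(Y | P Y && (key Y == q)) m Y.
  by rewrite -(partition_big key xpredT).
have cpos : (0 < #|{ffun 'I_n0.+1 -> 'I_(2 ^ l)}|)%N.
  by rewrite card_ffun !card_ord expn_gt0 expn_gt0.
have [q hq] := exists_avg R _ _ _ cpos hc'.
have [Y0 /andP[PY0 /eqP kY0]] : exists Y, P Y && (key Y == q).
  apply: contrapT => H; move: hq; rewrite big_pred0; last first.
    by move=> Y; apply/negP => h; apply: H; exists Y.
  by apply/negP; rewrite -ltNge divr_gt0 // ltr0n.
pose Q (Y : {ffun 'I_n0.+1 -> 'I_(2 ^ n)}) := [forall i, (Y i %/ 2 ^ (n - l))%N == q i].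
have QE (Y : {ffun 'I_n0.+1 -> 'I_(2 ^ n)}) : Q Y = (key Y == q).
  apply/forallP/eqP => [h|<- i]; last by rewrite ffunE.
  by apply/ffunP => i; apply: val_inj; rewrite ffunE /=; apply/eqP.
pose i0 : 'I_n0.+1 := [arg max_(i > ord0) `|x Y0 i|]%O.
have i0P i : `|x Y0 i| <= `|x Y0 i0|.
  by rewrite /i0; case: arg_maxP => // j _ h; apply: h.
have x0 : tau <= `|x Y0 i0| by have /existsP[i hi] := PY0; apply: le_trans hi (i0P i).
set D : R := n0.+1%:R in hl *; have D1 : 1 <= D by rewrite ler1n.
set th := 2 * B / (2 ^ l)%:R in hl.
have th0 : 0 < th by rewrite divr_gt0 // mulr_gt0.
have thD : th * (8 * D) <= tau by rewrite -ler_pdivlMr //; lra.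
have near Y Y' i : Q Y -> Q Y' -> `|x Y i - x Y' i| <= th.
  move=> /forallP/(_ i)/eqP e /forallP/(_ i)/eqP e'.
  have e1 : (2 ^ n)%:R = (2 ^ l)%:R * (2 ^ (n - l))%:R :> R by rewrite -natrM -expnD subnKC.
  have -> : x Y i - x Y' i = th * (((Y i)%:R - (Y' i)%:R) / (2 ^ (n - l))%:R).
    rewrite /x /grid_pt e1 /th; move: (p2 l) (p2 (n - l)%N).
    by move: ((2 ^ l)%:R) ((2 ^ (n - l))%:R) => u v u0 v0; field; rewrite !gt_eqF.
  rewrite normrM (gtr0_norm th0); apply: ler_piMr; first exact: ltW.
  rewrite normrM normfV (gtr0_norm (p2 _)) ler_pdivrMr // mul1r.
  have g0 : (0 < 2 ^ (n - l))%N by rewrite expn_gt0.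
  rewrite ler_norml lerNl lerBlDr opprB lerBlDr -!natrD !ler_nat ![(2 ^ _ + _)%N]addnC.
  by rewrite !eq_divn_close // e e'.
have QY0 : Q Y0 by rewrite QE kY0.
have th8 : 8 * th <= tau.
  by apply: le_trans thD; rewrite [leRHS]mulrCA ler_pM2l // ler_peMr // ltW.
have tri (a b : R) : `|a - b| <= th -> `|a| <= `|b| + th.
  by move=> h; have := ler_normD (a - b) b; rewrite subrK; lra.
have big Y : Q Y -> tau / 2 <= `|x Y i0|.
  move=> QY; have := tri _ _ (near Y0 Y i0 QY0 QY); move: x0 th8 tau0; clear; lra.
exists q, i0; split.
- apply: le_trans hq _; rewrite big_mkcond; apply: ler_sum => Y _.
  by rewrite /restr_mass -/(Q Y) QE; case: (key Y == q); rewrite ?andbF // andbT; case: ifP.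
- exact: big.
- move=> Y i QY; have h1 := tri _ _ (near Y Y0 i QY QY0); have h2 := tri _ _ (near Y0 Y i0 QY0 QY).
  have := i0P i; have := big Y QY; move: h1 h2 th8; rewrite /x; clear; lra.
- move=> Y Y' QY QY'; rewrite (bigD1 i0) //=.
  (* Nearby coordinates may still have opposite signs; [a * b = ((a + b)^2 - (a - b)^2) / 4] bounds
     the damage. *)
  have ab (a b : R) : `|a - b| <= th -> - (th ^+ 2 / 4) <= a * b.
    move=> h; have : (a - b) ^+ 2 <= th ^+ 2.
      by rewrite -(real_normK (num_real (a - b))) lerXn2r ?nnegrE // ltW.
    have := sqr_ge0 (a + b); clear; lra.
  have h1 : 3 / 16 * tau ^+ 2 <= x Y i0 * x Y' i0.
    have h := near _ _ i0 QY QY'; have b := big Y QY.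
    have : x Y i0 * (x Y i0 - x Y' i0) <= `|x Y i0| * th.
      by apply: le_trans (ler_norm _) _; rewrite normrM ler_wpM2l.
    have : `|x Y i0| ^+ 2 = x Y i0 * x Y i0 by rewrite real_normK ?num_real // expr2.
    move: b th8 tau0; move: (`|x Y i0|) => u; clear; nra.
  have h2 : - (D * (th ^+ 2 / 4)) <= \sum_(i < n0.+1 | i != i0) x Y i * x Y' i.
    apply: (@le_trans _ _ (\sum_(i < n0.+1 | i != i0) - (th ^+ 2 / 4))); last first.
      by apply: ler_sum => i _; apply: ab; apply: near.
    rewrite sumr_const -[leRHS]mulr_natl mulrN lerN2 ler_wpM2r ?divr_ge0 ?sqr_ge0 // ler_nat.
    by rewrite -[leqRHS]card_ord max_card.
  have h3 : D * th ^+ 2 <= tau ^+ 2 / 64.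
    have : th * (th * (8 * D)) <= th * tau by rewrite ler_pM2l.
    have : tau * (8 * th) <= tau * tau by rewrite ler_pM2l.
    clear; lra.
  move: h1 h2 h3; rewrite /x; have := sqr_ge0 tau; move: (\sum_(_ | _) _) => w; clear; lra.
Qed.

(** Pigeonhole over bins of width [h]. A bin of positive mass contains some value at least [T0],
    which bounds [g * h] from below. *)
Lemma popular_value (R : realType) (V : finType) (a : V -> R) (dot : V -> V -> R) (T0 c h : R) (G : nat) :
  (forall Y, 0 <= a Y) -> 0 < c -> c <= \sum_Y a Y -> 0 < h -> 0 <= T0 ->
  (forall Y Y', a Y != 0 -> a Y' != 0 -> T0 <= dot Y Y' <= G%:R * h) ->
  exists g : 'I_G.+1, T0 - h <= g%:R * h /\
    c ^+ 2 / G.+1%:R <= \sum_Y \sum_(Y' | `|dot Y Y' - g%:R * h| <= h) a Y * a Y'.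
Proof.
move=> a0 c0 hc h0 T00 hdot.
pose bin Y Y' : 'I_G.+1 := inord (Num.truncn (dot Y Y' / h)).
pose f g := \sum_Y \sum_(Y' | bin Y Y' == g) a Y * a Y'.
have sf : c ^+ 2 <= \sum_g f g.
  have -> : \sum_g f g = (\sum_Y a Y) ^+ 2.
    rewrite expr2 mulr_suml exchange_big; apply: eq_bigr => Y _ /=.
    by rewrite mulr_sumr [RHS](partition_big (bin Y) xpredT).
  by apply: lerXn2r => //; rewrite nnegrE; [exact: ltW | exact: le_trans (ltW c0) hc].
have G0 : (0 < #|'I_G.+1|)%N by rewrite card_ord.
have [g hg] := exists_avg R _ f _ G0 sf.
rewrite card_ord in hg.
have key Y Y' : a Y != 0 -> a Y' != 0 -> bin Y Y' = g ->
    `|dot Y Y' - g%:R * h| <= h /\ T0 - h <= g%:R * h.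
  move=> aY aY' <-; have /andP[d1 d2] := hdot Y Y' aY aY'.
  have q0 : 0 <= dot Y Y' / h by apply: divr_ge0; [exact: (le_trans T00 d1) | exact: ltW].
  have /andP[q1 q2] := truncn_itv q0.
  have ql : (Num.truncn (dot Y Y' / h) < G.+1)%N.
    rewrite ltnS -(ler_nat R); apply: le_trans q1 _; by rewrite ler_pdivrMr.
  rewrite /bin inordK //; move: q1 q2; rewrite -[(Num.truncn _).+1%:R]natr1 ler_pdivlMr // ltr_pdivrMr //.
  move: ((Num.truncn _)%:R) d1 => q d1 q1 q2; split; last by lra.
  by rewrite ler_norml; lra.
have fpos : 0 < f g by apply: lt_le_trans hg; rewrite divr_gt0 // exprn_gt0.
exists g; split.
  apply: contrapT => H; move: fpos; rewrite /f big1 ?ltxx // => Y _; apply: big1 => Y' /eqP e.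
  case: (eqVneq (a Y) 0) => [->|aY]; first by rewrite mul0r.
  case: (eqVneq (a Y') 0) => [->|aY']; first by rewrite mulr0.
  by case: H; have [] := key Y Y' aY aY' e.
apply: le_trans hg _; apply: ler_sum => Y _; rewrite big_mkcond [leRHS]big_mkcond; apply: ler_sum => Y' _.
case: ifP => [/eqP e|_]; last by case: ifP => // _; rewrite mulr_ge0.
case: (eqVneq (a Y) 0) => [->|aY]; first by rewrite mul0r; case: ifP.
case: (eqVneq (a Y') 0) => [->|aY']; first by rewrite mulr0; case: ifP.
by have [-> _] := key Y Y' aY aY' e.
Qed.

Lemma powR2_lt1 (R : realType) (x : R) : x < 0 -> 2 `^ x < 1.
Proof.
move=> x0; rewrite -[x]opprK powRN invf_lt1 ?powR_gt0 //.
have y0 : 0 < - x by rewrite oppr_gt0.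
suff : 1 `^ (- x) < 2 `^ (- x) by rewrite powR1.
by apply: (gt0_ltr_powR y0); rewrite ?nnegrE // ltr1n.
Qed.

Lemma exists_dim_between (R : realType) (u : R) (D : \bar R) : (u%:E < D)%E ->
  exists2 s : R, u < s & (s%:E < D)%E.
Proof.
case: D => [r| |] //.
  by rewrite lte_fin => ur; exists ((u + r) / 2); rewrite ?lte_fin; lra.
by move=> _; exists (u + 1); rewrite ?ltry //; lra.
Qed.

(** Here the threshold enters: [sg ^+ 2 * 2 ^+ d.+1] is 2 to the power [d + 1 - 2 * s]. The value
    3/4 is the one required by [fejer_dyadic_diff]. *)
Lemma contraction_rate (R : realType) (d : nat) (s : R) : (d%:R + 1) / 2 < s ->
  let sg := 2 `^ (- s) in
  [/\ 0 < sg, sg < 1 & exists kap : R, [/\ 3 / 4 <= kap, kap < 1 & sg ^+ 2 * 2 ^+ d.+1 <= kap ^+ 2]].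
Proof.
move=> hs sg; have d0 : 0 <= (d%:R : R) by [].
have sg0 : 0 < sg by rewrite powR_gt0.
split=> //; first by apply: powR2_lt1; lra.
have p : sg ^+ 2 * 2 ^+ d.+1 < 1.
  rewrite /sg -!powR_mulrn ?powR_ge0 // -powRrM -powRD ?(implybT, pnatr_eq0) //.
  by apply: powR2_lt1; rewrite -natr1; lra.
have p0 : 0 <= sg ^+ 2 * 2 ^+ d.+1 by rewrite mulr_ge0 ?exprn_ge0 // ltW.
exists (Num.max (3 / 4) (Num.sqrt (sg ^+ 2 * 2 ^+ d.+1))); split.
- by rewrite le_max lexx.
- have q1 : Num.sqrt (sg ^+ 2 * 2 ^+ d.+1) < 1 by rewrite -[ltRHS](sqrtr1 R) ltr_sqrt.
  by rewrite gt_max q1 andbT ltr_pdivrMr // mul1r ltr_nat.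
- set q := Num.sqrt _; have q0 : 0 <= q by apply: sqrtr_ge0.
  have qm : q <= Num.max (3 / 4) q by rewrite le_max lexx orbT.
  by rewrite -[leLHS]sqr_sqrtr // -/q; apply: lerXn2r => //; rewrite nnegrE // (le_trans q0).
Qed.

Lemma grid_dot_close (R : realType) (d n : nat) (B : R) (Y Y' : {ffun 'I_d -> 'I_(2 ^ n)})
    (x y : 'rV[R]_d) : 0 < B ->
  (forall i, `|y 0 i| <= B) ->
  (forall i, 0 <= x 0 i - grid_pt R d n B Y i < 2 * B / (2 ^ n)%:R) ->
  (forall i, 0 <= y 0 i - grid_pt R d n B Y' i < 2 * B / (2 ^ n)%:R) ->
  `|\sum_i grid_pt R d n B Y i * grid_pt R d n B Y' i - dotp x y| <=
    d%:R * (4 * B ^+ 2 / (2 ^ n)%:R).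
Proof.
move=> B0 yB hx hy; rewrite /dotp -sumrB; apply: le_trans (ler_norm_sum _ _ _) _.
apply: (@le_trans _ _ (\sum_(i < d) 4 * B ^+ 2 / (2 ^ n)%:R)); last first.
  by rewrite sumr_const card_ord -[leLHS]mulr_natl.
apply: ler_sum => i _.
have gB := grid_pt_bound R d n B Y i B0.
set g := grid_pt R d n B Y i in gB *; set g' := grid_pt R d n B Y' i.
have /andP[x1 x2] := hx i; have /andP[y1 y2] := hy i.
have -> : g * g' - x 0 i * y 0 i = g * (g' - y 0 i) + (g - x 0 i) * y 0 i by ring.
set dl := 2 * B / (2 ^ n)%:R in x2 y2.
have -> : 4 * B ^+ 2 / (2 ^ n)%:R = B * dl + dl * B by rewrite /dl; ring.
have c1 : `|g' - y 0 i| <= dl by rewrite distrC ger0_norm // ltW.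
have c2 : `|g - x 0 i| <= dl by rewrite distrC ger0_norm // ltW.
by apply: le_trans (ler_normD _ _) _; rewrite !normrM lerD // ler_pM.
Qed.

Lemma grid_dot_bound (R : realType) (d n : nat) (B : R) (Y Y' : {ffun 'I_d -> 'I_(2 ^ n)}) : 0 < B ->
  `|\sum_i grid_pt R d n B Y i * grid_pt R d n B Y' i| <= d%:R * B ^+ 2.
Proof.
move=> B0; apply: le_trans (ler_norm_sum _ _ _) _.
apply: (@le_trans _ _ (\sum_(i < d) B ^+ 2)); last by rewrite sumr_const card_ord -[leLHS]mulr_natl.
by apply: ler_sum => i _; rewrite normrM expr2 ler_pM // grid_pt_bound.
Qed.

Lemma dot_product_interval (R : realType) (d : nat) (E : set 'rV[R]_d) :
  compact E -> (((d%:R + 1) / 2 : R)%:E < hausdorff_dim E)%E ->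
  exists t1 t2 : R, t1 < t2 /\
    forall t, t1 < t < t2 -> exists x y, [/\ E x, E y & dotp x y = t].
Proof.
move=> cE /exists_dim_between[s hs hdim].
have [B B0 hB] := compact_coord_bound R d E cE.
have s0 : 0 < s by apply: lt_trans hs; rewrite divr_gt0 // ltr_wpDl.
have [c c0 hfr] := frostman R d E s B s0 B0 hB hdim.
have [sg0 sg1 [kap [k34 k1 hkap]]] := contraction_rate R d s hs.
set sg := 2 `^ (- s) in hfr sg0 sg1 hkap.
have [l0 hl0] : exists l0, 5%:R ^+ d * sg ^+ l0 <= c / 2.
  have p5 : 0 < (5%:R : R) ^+ d by rewrite exprn_gt0.
  have e0 : 0 < c / 2 / 5%:R ^+ d by rewrite !divr_gt0.
  have [l hl] := expr_small R sg _ (ltW sg0) sg1 e0; exists l.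
  by rewrite mulrC -ler_pdivlMr // ltW.
have p2 k : 0 < ((2 ^ k)%:R : R) by rewrite ltr0n expn_gt0.
pose tau := B / (2 ^ l0)%:R; have tau0 : 0 < tau by rewrite divr_gt0.
have away n m : (l0 < n)%N -> (forall Y, 0 <= m Y) ->
    (forall j Y, (j <= n)%N -> cube_mass R d _ m j Y <= sg ^+ (n - j)) -> c <= \sum_Y m Y ->
    c / 2 <= \sum_(Y | [exists i, tau <= `|grid_pt R d n B Y i|]) m Y.
  by move=> ln m0 mle mc; apply: mass_away mle ln hl0 mc.
have c20 : 0 < c / 2 by rewrite divr_gt0.
case: d E cE hs hdim hB hfr hkap hl0 away => [|n0] E cE hs hdim hB hfr hkap hl0 away.
  (* In dimension 0 no coordinate is large, so the mass away from the origin is 0, against its lower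
     bound. *)
  have [m [m0 _ mle mc]] := hfr l0.+1.
  have := away l0.+1 m (leqnn _) m0 mle mc.
  by rewrite big_pred0 ?leNgt ?c20 // => Y; apply/existsP => -[[]].
set D : R := n0.+1%:R; have D1 : 1 <= D by rewrite ler1n.
have D0 : 0 < D by apply: lt_le_trans D1.
have [l _ hl] : exists2 l, (0 <= l)%N & ((2 ^ l)%:R)^-1 < tau / (8 * D) / (2 * B).
  by apply: half_small; rewrite !divr_gt0 // mulr_gt0.
have {}hl : 2 * B / (2 ^ l)%:R <= tau / (8 * D).
  by rewrite mulrC -ler_pdivlMr ?mulr_gt0 // ltW.
pose N := #|{ffun 'I_n0.+1 -> 'I_(2 ^ l)}|.
have N0 : 0 < (N%:R : R) by rewrite ltr0n /N card_ffun !card_ord expn_gt0 expn_gt0.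
pose c' := c / 2 / N%:R; have c'0 : 0 < c' by rewrite divr_gt0.
pose T0 := tau ^+ 2 / 8; have T00 : 0 < T0 by rewrite divr_gt0 // exprn_gt0.
pose ta := tau / 2; have ta0 : 0 < ta by rewrite divr_gt0.
pose DB := D * B ^+ 2; have DB0 : 0 < DB by rewrite mulr_gt0 // exprn_gt0.
(* [S] is large enough for [t < S * ta] and [|x . y - t| <= S * ta / 2] to hold for all [t] of the
   interval. *)
have [S0 S04 hS0] := nat_upper R ((2 * DB + 2 * T0) / (B * ta)) 4.
pose S := 2 * B * S0%:R.
have hS : 2 * (2 * DB + 2 * T0) <= S * ta.
  move: hS0; rewrite ler_pdivrMr ?mulr_gt0 // /S => h.
  have -> : 2 * B * S0%:R * ta = 2 * (S0%:R * (B * ta)) by ring.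
  by rewrite ler_pM2l.
have Sp : 0 < S.
  by rewrite /S !mulr_gt0 // ltr0n; apply: leq_trans S04.
(* [T0 / 2] will bound all [t] of the interval from below, so [w1] does not depend on [t]. *)
have [w1 _ hw1] := nat_upper R (2 + 2 * B * S / (T0 / 2)) 0.
pose C : R := (2 * w1 + 3)%:R ^+ n0.+1 * (2 * S0 + 3)%:R ^+ n0.+1 * (64 * n0.+1%:R * 4) *
     (32 * n0.+1%:R) ^+ n0 * (64 * n0.+1%:R) ^+ n0.+1.
have C0 : 0 <= C by repeat first [apply: exprn_ge0 | apply: mulr_ge0 | by []].
pose X1 := C + 1; have X10 : 0 < X1 by rewrite ltr_wpDl.
have hX1 : C <= X1 ^+ 2 by rewrite /X1; move: C0; clear; nra.
(* [g0] makes the bins narrow, compared with the Fejer peak in [ga] and with [T0] in [gb]. *)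
have [g0 g01 hg0] := nat_upper R (32 * DB / (S * ta) + 4 * DB / T0) 1.
have [ga gb] : 32 * DB <= g0%:R * (S * ta) /\ 4 * DB <= g0%:R * T0.
  have u0 : 0 <= 32 * DB / (S * ta) by rewrite divr_ge0 // ltW // mulr_gt0.
  have v0 : 0 <= 4 * DB / T0 by rewrite divr_ge0 // ltW // mulr_gt0.
  have q1 : 32 * DB / (S * ta) <= g0%:R by apply: le_trans hg0; rewrite lerDl.
  have q2 : 4 * DB / T0 <= g0%:R by apply: le_trans hg0; rewrite lerDr.
  by split; [move: q1; rewrite ler_pdivrMr // mulr_gt0 | move: q2; rewrite ler_pdivrMr].
have g0r : 0 < (g0%:R : R) by rewrite ltr0n.
(* A lower bound for the bin mass [c' ^+ 2 / G.+1] times the peak height [2 ^ l1 / 4]. With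
   [G = 2 ^ l1 * g0] the powers of 2 cancel, so [l1] can be chosen after [c4]. *)
pose c4 := c' ^+ 2 / (8 * g0%:R).
have c40 : 0 < c4 by rewrite divr_gt0 ?exprn_gt0 // mulr_gt0.
have k1' : 0 < 1 - kap by rewrite subr_gt0.
have kap0 : 0 <= kap by apply: le_trans k34; rewrite divr_ge0.
have [l1 hl1] : exists l1, 12 * X1 * kap ^+ l1 / (1 - kap) < c4 / 2.
  have e0 : 0 < c4 / 2 * (1 - kap) / (12 * X1) by rewrite !(divr_gt0, mulr_gt0).
  have [l1 h] := expr_small R kap _ kap0 k1 e0; exists l1.
  rewrite ltr_pdivrMr // mulrC -ltr_pdivlMr ?mulr_gt0 //.
pose G := (2 ^ l1 * g0)%N.
have G0 : 0 < (G%:R : R) by rewrite ltr0n /G muln_gt0 expn_gt0.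
pose h := DB / G%:R; have h0 : 0 < h by rewrite divr_gt0.
have Gh : G%:R * h = DB by rewrite /h mulrC divfK // gt_eqF.
have hT : h <= T0 / 4.
  rewrite /h ler_pdivrMr // /G natrM.
  have : 1 <= (2 ^ l1)%:R :> R by rewrite ler1n expn_gt0.
  have : 0 <= g0%:R * T0 by rewrite mulr_ge0 // ltW.
  move: gb; clear; nra.
have hh : (2 * h) * (16 * (2 ^ l1)%:R) <= S * ta.
  have -> : 2 * h * (16 * (2 ^ l1)%:R) = 32 * DB / g0%:R.
    by rewrite /h /G natrM; field; rewrite !gt_eqF.
  by rewrite ler_pdivrMr // [leRHS]mulrC.
have c4le : c4 <= (2 ^ l1)%:R / 4 * (c' ^+ 2 / G.+1%:R).
  have -> : c4 = (2 ^ l1)%:R / 4 * (c' ^+ 2 / (2 * G%:R)).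
    by rewrite /c4 /G natrM; field; rewrite !gt_eqF.
  rewrite ler_wpM2l ?divr_ge0 // ler_wpM2l ?sqr_ge0 // lef_pV2 ?posrE ?mulr_gt0 //.
  by rewrite -natrM ler_nat mul2n -addnn -addn1 leq_add2l /G muln_gt0 expn_gt0.
pose dot n (Y Y' : {ffun 'I_n0.+1 -> 'I_(2 ^ n)}) : R :=
  \sum_i grid_pt R n0.+1 n B Y i * grid_pt R n0.+1 n B Y' i.
(* [z] collects the finitely valued data that may vary with [n]: the cube, the dominant coordinate
   and the popular bin. *)
pose good (z : {ffun 'I_n0.+1 -> 'I_(2 ^ l)} * 'I_n0.+1 * 'I_G.+1) (n : nat) : Prop :=
  exists (m : {ffun 'I_n0.+1 -> 'I_(2 ^ n)} -> R),
  let Q := fun Y : {ffun 'I_n0.+1 -> 'I_(2 ^ n)} => [forall i, (Y i %/ 2 ^ (n - l))%N == z.1.1 i] in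
  let a := restr_mass R _ n m Q in
  [/\ [/\ forall Y, 0 <= m Y,
     forall Y, m Y != 0 -> exists2 x, E x & forall i,
       0 <= x 0 i - grid_pt R _ n B Y i < 2 * B / (2 ^ n)%:R &
     forall j Y, (j <= n)%N -> cube_mass R _ _ m j Y <= sg ^+ (n - j)],
     forall Y, Q Y -> ta <= `|grid_pt R _ n B Y z.1.2|,
     forall Y i, Q Y -> `|grid_pt R _ n B Y i| <= 3 / 2 * `|grid_pt R _ n B Y z.1.2|,
     T0 - h <= z.2%:R * h &
     c' ^+ 2 / G.+1%:R <= \sum_Y \sum_(Y' | `|dot n Y Y' - z.2%:R * h| <= h) a Y * a Y'].
have good_ex n : (maxn l0.+1 l <= n)%N -> exists z, good z n.
  rewrite geq_max => /andP[n1 n2].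
  have [m [m0 mE mle mc]] := hfr n.
  have mc' := away n m n1 m0 mle mc.
  have [q [i0 [Q1 Q2 Q3 Q4]]] := cube_away R n0 n l m B (c / 2) tau B0 c20 tau0 m0 n2 hl mc'.
  pose Q (Y : {ffun 'I_n0.+1 -> 'I_(2 ^ n)}) := [forall i, (Y i %/ 2 ^ (n - l))%N == q i].
  pose a := restr_mass R _ n m Q.
  have a0 Y : 0 <= a Y by rewrite /a /restr_mass; case: ifP.
  have aQ Y : a Y != 0 -> Q Y by rewrite /a /restr_mass; case: ifP; rewrite ?eqxx.
  have bd Y Y' : a Y != 0 -> a Y' != 0 -> T0 <= dot n Y Y' <= G%:R * h.
    move=> /aQ QY /aQ QY'; rewrite Gh; apply/andP; split; first exact: Q4.
    by apply: le_trans (ler_norm _) _; apply: grid_dot_bound.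
  have [g [hg1 hg2]] := popular_value R _ a (dot n) T0 c' h G a0 c'0 Q1 h0 (ltW T00) bd.
  by exists (q, i0, g), m; split.
have [[[q i0] g] hgood] := pigeonhole_infinite _ good _ good_ex.
(* For [t] in this interval, pairs within [h] of the bin value are within [2 * h] of [t], which is
   the width allowed by [hh]. *)
exists (g%:R * h - h), (g%:R * h + h); split; first by move: h0; clear; lra.
move=> t /andP[tl tu].
have gl : T0 - h <= g%:R * h by have [n _ [m []]] := hgood 0%N.
have gu : g%:R * h <= DB by rewrite -Gh ler_pM2r // ler_nat -ltnS.
have tT : T0 / 2 <= t by move: gl tl hT; clear; lra.
have t0 : 0 < t by apply: lt_le_trans tT; rewrite divr_gt0.
have tD : t <= DB + T0 by move: gu tu hT T00; clear; lra.
apply: contrapT => none.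
have [rho rho0 hrho] : exists2 rho : R, 0 < rho & forall x y, E x -> E y -> rho <= `|dotp x y - t|.
  by apply: dotp_gap => // x y Ex Ey e; apply: none; exists x, y.
(* Half of [rho] is given up for replacing points of [E] by cell corners, which the choice of [n2]
   permits. *)
pose K : R := (sin (pi * (rho / 2 / (S * B)))) ^- 2.
have K0 : 0 <= K by rewrite /K invr_ge0 sqr_ge0.
have K1 : 0 < K + 1 by rewrite ltr_wpDl.
have [l2 l12 hl2] : exists2 l2, (l1 <= l2)%N & ((2 ^ l2)%:R)^-1 < c4 / 2 / (K + 1).
  by apply: half_small; apply: divr_gt0 => //; apply: divr_gt0.
have {}hl2 : K / (2 ^ l2)%:R < c4 / 2.
  move: hl2; rewrite ltr_pdivlMr //; apply: le_lt_trans.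
  by rewrite mulrC ler_wpM2l ?invr_ge0 // lerDl.
have [n2 _ hn2] : exists2 n2, (0 <= n2)%N & ((2 ^ n2)%:R)^-1 < rho / 2 / (4 * DB).
  by apply: half_small; rewrite !divr_gt0 // mulr_gt0.
have [n hn [m [[m0 mE mle] Q2 Q3 _ hp]]] := hgood (maxn l2 n2).
move: hn; rewrite geq_max => /andP[nl2 nn2].
pose Q (Y : {ffun 'I_n0.+1 -> 'I_(2 ^ n)}) := [forall i, (Y i %/ 2 ^ (n - l))%N == q i].
pose a := restr_mass R _ n m Q.
rewrite /= -/Q -/a in Q2 Q3 hp.
have a0 Y : 0 <= a Y by rewrite /a /restr_mass; case: ifP.
have am Y : a Y != 0 -> m Y != 0 by rewrite /a /restr_mass; case: ifP; rewrite ?eqxx.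
have close Y Y' : m Y != 0 -> m Y' != 0 -> rho / 2 <= `|dot n Y Y' - t|.
  move=> /mE[x Ex hx] /mE[y Ey hy].
  have yB i : `|y 0 i| <= B by apply: ltW; apply: hB.
  have h1 : `|dotp x y - dot n Y Y'| <= n0.+1%:R * (4 * B ^+ 2 / (2 ^ n)%:R).
    by rewrite distrC; exact: grid_dot_close.
  have h2 := hrho x y Ex Ey.
  have h3 : n0.+1%:R * (4 * B ^+ 2 / (2 ^ n)%:R) <= rho / 2.
    have -> : n0.+1%:R * (4 * B ^+ 2 / (2 ^ n)%:R) = (2 ^ n)%:R^-1 * (4 * DB) by rewrite /DB /D; ring.
    rewrite -ler_pdivlMr ?mulr_gt0 //; apply: le_trans (ltW hn2).
    by rewrite lef_pV2 ?posrE // ler_nat leq_exp2l.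
  have h4 := ler_distD (dot n Y Y') (dotp x y) t.
  by move: (le_trans h1 h3) h2 h4; clear; lra.
have hp' : c' ^+ 2 / G.+1%:R <= \sum_Y \sum_(Y' | `|dot n Y Y' - t| <= 2 * h) a Y * a Y'.
  apply: le_trans hp _; apply: ler_sum => Y _; rewrite big_mkcond [leRHS]big_mkcond; apply: ler_sum => Y' _.
  case: ifP => [hY|_]; last by case: ifP => // _; rewrite mulr_ge0.
  rewrite ifT //; move: hY tl tu; rewrite !ler_norml /=; move: (dot n Y Y') => u; clear; lra.
have hsep Y Y' : a Y != 0 -> a Y' != 0 -> rho / 2 <= `|dot n Y Y' - t| <= S * ta / 2.
  move=> aY aY'; rewrite close ?am //=.
  have h1 := grid_dot_bound R n0.+1 n B Y Y' B0.
  apply: le_trans (ler_normB _ _) _; rewrite (gtr0_norm t0).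
  move: h1 tD hS T00; rewrite -/D -/DB -/(dot n Y Y'); clear; lra.
have tS : t < S * ta by move: tD hS DB0 T00; clear; lra.
have tw : 2 + 2 * B * S / t <= w1%:R.
  have tV : t^-1 <= (T0 / 2)^-1 by rewrite lef_pV2 // posrE divr_gt0.
  by apply: le_trans hw1; rewrite lerD2l; apply: ler_wpM2l tV; rewrite mulr_ge0 ?mulr_ge0 // ltW.
have rho20 : 0 < rho / 2 by rewrite divr_gt0.
have := incidence_gap R n0 n i0 B ta t sg kap X1 (c' ^+ 2 / G.+1%:R) (2 * h) (rho / 2) S0 w1 m Q l1 l2
  B0 ta0 S04 sg0 m0 mle Q2 Q3 t0 tS tw (ltW X10) k34 k1 hX1 hkap l12 nl2 hh hp' rho20 hsep.
rewrite -/S -/K; move: c4le hl1 hl2; move: (_ / 4 * _) (12 * X1 * _ / _) (K / _) => u v w; clear; lra.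
Qed.

(** * Two-colouring of a tree and the theorem *)

(* The edges from a vertex to its predecessor on a shortest path to the root
   are [k] in number, hence they are all the edges. *)
Lemma tree_two_coloring (k : nat) (e : rel 'I_k.+1) :
  symmetric e -> irreflexive e -> (forall x y, connect e x y) -> #|edges e| = k ->
  exists f : 'I_k.+1 -> bool, forall x y, e x y -> f x != f y.
Proof.
move=> esym eirr econ ecard.
(* Existence of a walk of length [n] from the root to [v]; its least length [dist v] is the graph
   distance. *)
pose reach := fix reach (n : nat) (v : 'I_k.+1) {struct n} : bool :=
  if n is m.+1 then [exists u, reach m u && e u v] else v == ord0.
have ex v : exists n, reach n v.
  have /connectP[p pp ->] := econ ord0 v; exists (size p).
  elim/last_ind: p pp => [|p x IH] //=.
  rewrite rcons_path last_rcons size_rcons => /andP[/IH h ex] /=.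
  by apply/existsP; exists (last ord0 p); rewrite h.
pose dist v := ex_minn (ex v).
have distP v : reach (dist v) v by rewrite /dist; case: ex_minnP.
have dist_le v n : reach n v -> (dist v <= n)%N by rewrite /dist; case: ex_minnP => m _ h /h.
have parP v : v != ord0 -> exists u, e u v && (dist v == (dist u).+1).
  move=> v0; have := distP v; case dv : (dist v) => [|m] /=; first by rewrite (negbTE v0).
  case/existsP => u /andP[ru euv]; exists u; rewrite euv eqSS eqn_leq dist_le // andbT.
  rewrite -ltnS -dv; apply: dist_le => /=; apply/existsP; exists u; by rewrite distP.
pose par v := odflt v [pick u | e u v && (dist v == (dist u).+1)].
have par1 v : v != ord0 -> e (par v) v /\ dist v = (dist (par v)).+1.
  move=> /parP[u hu]; rewrite /par; case: pickP => [w /andP[? /eqP] //|/(_ u)].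
  by rewrite hu.
(* Ordered as in [edges], where the smaller end comes first. *)
pose g v := if (par v < v)%N then (par v, v) else (v, par v).
have gE v : v != ord0 -> g v \in edges e.
  move=> /par1[h1 h2]; rewrite /g; case: (ltngtP (par v) v) => h; rewrite inE /=.
  - by rewrite h h1.
  - by rewrite h esym h1.
  - by rewrite (val_inj h) eirr in h1.
(* If two vertices gave the same edge with opposite roles, each would be the parent of the other,
   against the distances. *)
have gi : {in [set~ ord0]%SET &, injective g}.
  move=> v w; rewrite !inE => /par1[_ dv] /par1[_ dw]; rewrite /g.
  case: ifP => _; case: ifP => _ [e1 e2] //.
    by move: dv dw; rewrite e1 -e2 => -> ; lia.
  by move: dv dw; rewrite -e1 e2 => ->; lia.
have gall : (g @: [set~ ord0])%SET = edges e.
  apply/eqP; rewrite eqEcard; apply/andP; split.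
    by apply/fintype.subsetP => q /imsetP[v v0 ->]; apply: gE; rewrite !inE in v0.
  by rewrite ecard card_in_imset // cardsC1 card_ord.
have main (x y : 'I_k.+1) : (x < y)%N -> e x y -> odd (dist x) != odd (dist y).
  move=> xy exy.
  have : (x, y) \in edges e by rewrite inE /= xy exy.
  rewrite -gall => /imsetP[v]; rewrite !inE => /par1[_ dv].
  by rewrite /g; case: ifP => _ [-> ->]; rewrite dv /=; case: odd.
exists (fun v => odd (dist v)) => x y exy.
case: (ltngtP x y) => h; first exact: main.
  by rewrite eq_sym main // esym.
by move: exy; rewrite (val_inj h) eirr.
Qed.

Theorem corollary2 (R : realType) (d k : nat) (e : rel 'I_k.+1)
    (E : set 'rV[R]_d) (hk : (1 <= k)%N)
    (hT : is_tree e) (hedges : #|edges e| = k)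
    (hE : compact E)
    (hdim : (((d%:R + 1) / 2 : R)%:E < hausdorff_dim E)%E) :
  exists I : set R,
    [/\ open I, is_interval I, I !=set0
      & forall t : R, I t -> tree_configs e E t !=set0].
Proof.
have [t1 [t2 [t12 ht]]] := dot_product_interval R d E hE hdim.
have [esym eirr econn _] := hT.
have [f hf] := tree_two_coloring k e esym eirr econn hedges.
exists `]t1, t2[%classic; split.
- exact: interval_open.
- exact: interval_is_interval.
- by exists ((t1 + t2) / 2); rewrite /= in_itv /=; lra.
- move=> t; rewrite /= in_itv /= => /ht[x [y [Ex Ey xy]]].
  exists (fun i => if f i then x else y); split=> [i|i j eij]; first by case: (f i).
  have := hf i j eij; case: (f i); case: (f j) => // _.
  by rewrite -xy /dotp; apply: eq_bigr => l _; rewrite mulrC.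
Qed.
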